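(* For $n\ge1$, let $(\mathcal H^{mono}_{\mathbb Q})^n$ be the set of homomorphisms $f:A\to B$ with $A$ finitely generated and $B$ finitely presented that induce a monomorphism $H_1(A;\mathbb Q)\to H_1(B;\mathbb Q)$ and an epimorphism $H_2(A;\mathbb Q)/\Phi^{(n-1)}_{\mathbb Q}(A)\to H_2(B;\mathbb Q)/\Phi^{(n-1)}_{\mathbb Q}(B)$, and let $(\mathcal H^{CH}_{\mathbb Q})^n$ be the subset of those $f$ that induce an isomorphism on $H_1(-;\mathbb Q)$. Let $\mathcal H=\{\mathcal H^n\}_{n\ge1}$ be any family where each $\mathcal H^n$ is a class of maps contained in $(\mathcal H^{mono}_{\mathbb Q})^n$ (for example $\mathcal H^n=(\mathcal H^{CH}_{\mathbb Q})^n$). For a group $A$ let $\Gamma^n_S(A)=\{a\in A\mid \exists f:A\to B\text{ in }\mathcal H^n\text{ with } f(a)\in B^{(n)}\}$ be the stabilization of the derived series. Then for every finitely presented group $A$ and every $n\ge1$, $$A^{(n)}\subset\Gamma^n_S(A)\subset A^{(n)}_H\cap A^r_{2^n}.$$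
   Context: The derived series is $A^{(0)}=A$, $A^{(n+1)}=[A^{(n)},A^{(n)}]$. The rational lower central series is $A^r_1=A$, $A^r_{k+1}=\{x\mid x^m\in[A,A^r_k]\text{ for some positive integer }m\}$. The torsion-free derived series is defined by $A^{(0)}_H=A$; given the normal subgroup $A^{(n)}_H$, the abelian group $A^{(n)}_H/[A^{(n)}_H,A^{(n)}_H]$ is a right $\mathbb Z[A/A^{(n)}_H]$-module via conjugation, $\mathbb Z[A/A^{(n)}_H]$ is an Ore domain so this module has a well-defined torsion submodule $T$, and $A^{(n+1)}_H$ is the inverse image of $T$ under $A^{(n)}_H\to A^{(n)}_H/[A^{(n)}_H,A^{(n)}_H]$. For $m\ge0$, $\Phi^{(m)}_{\mathbb Q}(A)$ is the image of $H_2(A^{(m)};\mathbb Q)\to H_2(A;\mathbb Q)$. A class of maps (on the relevant groups) is a set of homomorphisms containing all isomorphisms, closed under composition, and closed under nudge-outs (if $f:A\to B$, $f':A\to B'$ are in the class, there are $g:B\to C$, $g':B'\to C$ in the class with $g f=g'f'$). *)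

(* Defs.v *)
From Stdlib Require Import List ClassicalEpsilon.
From mathcomp Require Import all_boot all_algebra.
Set Implicit Arguments. Unset Strict Implicit. Unset Printing Implicit Defensive.
Import GRing.Theory Num.Theory.
Local Open Scope ring_scope.

Record group := Group {
  carrier :> Type;
  gmul : carrier -> carrier -> carrier;
  gone : carrier;
  ginv : carrier -> carrier;
  gmulA : forall x y z, gmul x (gmul y z) = gmul (gmul x y) z;
  gmul1 : forall x, gmul gone x = x;
  gmulV : forall x, gmul (ginv x) x = gone }.

Definition pdec (P : Prop) : bool :=
  if excluded_middle_informative P then true else false.

Section GroupDefs.
Variable A : group.

Definition gprod (s : seq A) : A := foldr (@gmul A) (gone A) s.
Fixpoint gpow (x : A) (m : nat) : A :=
  match m with O => gone A | S m' => gmul x (gpow x m') end.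
Definition gzpow (x : A) (z : int) : A :=
  match z with Posz m => gpow x m | Negz m => ginv (gpow x m.+1) end.
Definition comm (x y : A) : A := gmul (gmul (ginv x) (ginv y)) (gmul x y).
Definition conjg (x g : A) : A := gmul (gmul (ginv g) x) g.

Definition commsub (P Q : A -> Prop) (x : A) : Prop :=
  exists s : seq ((A * A) * bool),
    (forall e, List.In e s -> P e.1.1 /\ Q e.1.2) /\
    x = gprod [seq (if e.2 then comm e.1.1 e.1.2 else ginv (comm e.1.1 e.1.2))
              | e <- s].

Fixpoint derived (n : nat) : A -> Prop :=
  match n with
  | O => fun _ => True
  | S n' => commsub (derived n') (derived n')
  end.

(* rational lower central series: rlcs_aux k = A^r_(k+1) *)
Fixpoint rlcs_aux (k : nat) : A -> Prop :=
  match k with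
  | O => fun _ => True
  | S k' => fun x => exists m : nat, (0 < m)%N /\
                      commsub (fun _ => True) (rlcs_aux k') (gpow x m)
  end.
Definition rlcs (k : nat) : A -> Prop := rlcs_aux k.-1.

(* sum of the coefficients of r in Z[A] lying over the coset g N,
   i.e. the coefficient of gN of the image of r in Z[A/N] *)
Definition coset_coef (N : A -> Prop) (r : seq (int * A)) (g : A) : int :=
  \sum_(p <- r) (if pdec (N (gmul (ginv g) p.2)) then p.1 else 0).

(* torsion-free derived series A^(n)_H.  For N = A^(n)_H, x in N lies in
   A^(n+1)_H iff its class in N/[N,N] is torsion for the right
   Z[A/N]-module structure given by conjugation: there is a nonzero
   r = sum_i n_i g_i in Z[A/N] (represented by a formal sum over A) with
   x.r = prod_i (g_i^-1 x g_i)^(n_i) in [N,N]. *)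
Fixpoint tfderived (n : nat) : A -> Prop :=
  match n with
  | O => fun _ => True
  | S n' => fun x => tfderived n' x /\
      exists r : seq (int * A),
        (exists g : A, coset_coef (tfderived n') r g != 0) /\
        commsub (tfderived n') (tfderived n')
          (gprod [seq gzpow (conjg x p.2) p.1 | p <- r])
  end.

Definition word := seq (nat * bool).
Definition wf_word (n : nat) (w : word) : Prop := forall e, List.In e w -> (e.1 < n)%N.
Definition evalw (gens : seq A) (w : word) : A :=
  gprod [seq (if e.2 then nth (gone A) gens e.1 else ginv (nth (gone A) gens e.1))
        | e <- w].

Definition fin_gen : Prop :=
  exists gens : seq A, forall x : A, exists w, wf_word (size gens) w /\ evalw gens w = x.

End GroupDefs.
Arguments derived : clear implicits.
Arguments rlcs_aux : clear implicits.
Arguments rlcs : clear implicits.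
Arguments tfderived : clear implicits.
Arguments fin_gen : clear implicits.

Inductive releq (n : nat) (R : seq word) : word -> word -> Prop :=
| releq_refl w : releq n R w w
| releq_sym u v : releq n R u v -> releq n R v u
| releq_trans u v w : releq n R u v -> releq n R v w -> releq n R u w
| releq_free u v i b : (i < n)%N ->
    releq n R (u ++ v) (u ++ (i, b) :: (i, ~~ b) :: v)
| releq_rel u v r : List.In r R -> releq n R (u ++ v) (u ++ r ++ v).

Definition fin_pres (A : group) : Prop :=
  exists (gens : seq A) (R : seq word),
    (forall x : A, exists w, wf_word (size gens) w /\ evalw gens w = x) /\
    (forall r, List.In r R -> wf_word (size gens) r /\ evalw gens r = gone A) /\
    (forall w, wf_word (size gens) w -> evalw gens w = gone A ->
       releq (size gens) R w [::]).

Definition ishom (A B : group) (f : A -> B) : Prop :=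
  forall x y, f (gmul x y) = gmul (f x) (f y).
Definition isiso (A B : group) (f : A -> B) : Prop := ishom f /\ bijective f.

(* Rational group homology via the (inhomogeneous) bar complex with
   trivial coefficients Q:  C_k(A;Q) = Q[A^k], formal finite sums.      *)
Section Homology.
Variable A : group.

Definition coef (T : Type) (c : seq (rat * T)) (x : T) : rat :=
  \sum_(p <- c) (if pdec (p.2 = x) then p.1 else 0).
Definition ceq (T : Type) (c c' : seq (rat * T)) : Prop :=
  forall x, coef c x = coef c' x.

Definition chain1 := seq (rat * A).
Definition chain2 := seq (rat * (A * A)).
Definition chain3 := seq (rat * (A * A * A)).

Definition d2 (c : chain2) : chain1 :=
  flatten [seq [:: (p.1, p.2.2); (- p.1, gmul p.2.1 p.2.2); (p.1, p.2.1)] | p <- c].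
Definition d3 (c : chain3) : chain2 :=
  flatten [seq [:: (p.1, (p.2.1.2, p.2.2));
                   (- p.1, (gmul p.2.1.1 p.2.1.2, p.2.2));
                   (p.1, (p.2.1.1, gmul p.2.1.2 p.2.2));
                   (- p.1, (p.2.1.1, p.2.1.2))] | p <- c].
(* 2-cycles (d1 = 0, so every 1-chain is a cycle) *)
Definition cycle2 (z : chain2) : Prop := ceq (d2 z) [::].
Definition supported2 (S : A -> Prop) (z : chain2) : Prop :=
  forall p, List.In p z -> S p.2.1 /\ S p.2.2.
End Homology.

Definition map1 (A B : group) (f : A -> B) (c : chain1 A) : chain1 B :=
  [seq (p.1, f p.2) | p <- c].
Definition map2 (A B : group) (f : A -> B) (c : chain2 A) : chain2 B :=
  [seq (p.1, (f p.2.1, f p.2.2)) | p <- c].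

Definition H1_mono (A B : group) (f : A -> B) : Prop :=
  forall c : chain1 A, (exists e : chain2 B, ceq (map1 f c) (d2 e)) ->
    exists e' : chain2 A, ceq c (d2 e').

(* f_* : H_2(A;Q)/Phi^(m)(A) -> H_2(B;Q)/Phi^(m)(B) is surjective, where
   Phi^(m)(B) = image of H_2(B^(m);Q) = classes of cycles supported on B^(m) *)
Definition H2_mod_Phi_epi (m : nat) (A B : group) (f : A -> B) : Prop :=
  forall z : chain2 B, cycle2 z ->
    exists z' : chain2 A, cycle2 z' /\
    exists w : chain2 B, cycle2 w /\ supported2 (derived B m) w /\
    exists c : chain3 B, ceq z (map2 f z' ++ w ++ d3 c).

Definition Hmono (n : nat) (A B : group) (f : A -> B) : Prop :=
  fin_gen A /\ fin_pres B /\ ishom f /\ H1_mono f /\ H2_mod_Phi_epi n.-1 f.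

Definition H1_epi (A B : group) (f : A -> B) : Prop :=
  forall c : chain1 B, exists c' : chain1 A, exists e : chain2 B,
    ceq c (map1 f c' ++ d2 e).
Definition HCH (n : nat) (A B : group) (f : A -> B) : Prop :=
  Hmono n f /\ H1_epi f.

Definition class_of_maps (C : forall A B : group, (A -> B) -> Prop) : Prop :=
  (forall (A B : group) (f : A -> B), fin_pres A -> fin_pres B -> isiso f -> C A B f) /\
  (forall (A B D : group) (f : A -> B) (g : B -> D),
      C A B f -> C B D g -> C A D (fun x => g (f x))) /\
  (forall (A B B' : group) (f : A -> B) (f' : A -> B'),
      C A B f -> C A B' f' ->
      exists (D : group) (g : B -> D) (g' : B' -> D),
        C B D g /\ C B' D g' /\ forall a, g (f a) = g' (f' a)).

Definition GammaS (H : nat -> forall A B : group, (A -> B) -> Prop)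
  (n : nat) (A : group) (a : A) : Prop :=
  exists (B : group) (f : A -> B), H n A B f /\ derived B n (f a).

(* Main.v *)
(** The identity map shows A^(n) in Gamma_S^n(A).  Conversely let f : A -> B lie in the class and
    f(a) in B^(n).  A 2-cocycle of B with trivial rational coefficients that vanishes on cycles
    supported on B^(n-1), and whose pullback to A is a coboundary dg, is itself the coboundary of
    some h with h o f = g: this is what injectivity on H_1 and surjectivity on H_2/Phi^(n-1) say.

    Rational lower central series: with m = 2^n, the tautological map of A to the units of
    Q[A]/Delta_m, for Jennings' filtration Delta, extends along f to B, one layer of the filtration
    at a time, the obstruction being a cocycle as above.  As elements of B^(j) act trivially modulo
    Delta_(2^j), a - 1 lies in Delta_m, so a lies in A^r_m by Jennings' theorem.

    Torsion-free derived series: one shows f^-1(B^(k)_H) = A^(k)_H by induction on k <= n.  Let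
    Gamma = B/B^(k)_H with k < n, a poly-(torsion-free abelian) group.  Over R = Q[Gamma] a matrix
    with injective augmentation is injective (Strebel), more vectors than coordinates are dependent
    (Folner sets), and R is a domain (unique products).  By the Fox calculus, x in B^(k)_H lies in
    B^(k+1)_H iff a nonzero multiple of its row of Fox derivatives is spanned by those of the
    relators.  Consider the matrix of the rows of the relators of B and of the images of the
    generators of A.  Every rational relation between its augmented rows lifts to a relation over R
    whose A-part vanishes in R (x) I_A: dually, a suitable functional on relators, seen as a cocycle
    of B with rational coefficients, is a coboundary.  Dependence and Strebel's lemma then show that
    every relation over R has a nonzero multiple with vanishing A-part, and for the relation given
    by f(x) in B^(k+1)_H this means that x is torsion in A. *)

Require Import Defs.
From Stdlib Require Import List ClassicalEpsilon.
From HB Require Import structures.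
From mathcomp Require Import all_boot all_order all_algebra finmap.
From mathcomp Require Import boolp functions.
From mathcomp Require classical_sets.
From mathcomp.multinomials Require Import monalg.
From mathcomp Require Import zify ring lra.
Set Implicit Arguments. Unset Strict Implicit. Unset Printing Implicit Defensive.
Import Order.TTheory GRing.Theory Num.Theory.
Local Open Scope ring_scope.

(** No quotient ring or field of fractions is formed. A map to Q[A]/Delta_k is a map to Q[A] that is
    multiplicative modulo [Delta]; R (x) I_B is R^n modulo the rows of the relators; vanishing in R
    (x) I_A is tested by derivations into functions on Gamma; rank counts become the dependence of c
    + l + 1 vectors. Both halves solve the same extension problem for a 1-cochain, and their bounds
    come from the condition on Phi^(n-1). In the first, two factors of weight 2^(n-1), coming from
    elements of B^(n-1), multiply into Delta_(2^n). In the second, B^(n-1) must die in B/B^(k)_H,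
    which is ensured for k <= n - 1, so the last level reached is n. Two obstacles shape the second
    half. The map A -> Gamma need not be onto, so a torsion witness in A has to be extracted from a
    single orbit of A on Gamma. And that the torsion elements form a subgroup rests on the Ore
    condition for Q[Gamma], hence on the structure of Gamma; so the regularity of the series of B is
    proved in the same induction as the pullback. *)

Lemma pdecP (P : Prop) : reflect P (pdec P).
Proof. by rewrite /pdec; case: excluded_middle_informative => h; constructor. Qed.

Lemma rat_scaleE (a : rat) (b : rat^o) : a *: b = a * b. Proof. by []. Qed.

Section GroupInstance.
Variable A : group.

HB.instance Definition _ := gen_eqMixin (carrier A).
HB.instance Definition _ := gen_choiceMixin (carrier A).

Let mulVr : right_inverse (gone A) (@ginv A) (@gmul A).
Proof.
move=> x; rewrite -[LHS]gmul1 -{1}(gmulV (ginv x)) -gmulA (gmulA (ginv x)).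
by rewrite gmulV gmul1 gmulV.
Qed.

Let mul1r : right_id (gone A) (@gmul A).
Proof. by move=> x; rewrite -(gmulV x) gmulA mulVr gmul1. Qed.

HB.instance Definition _ := isGroup.Build (carrier A)
  (@gmulA A) (@gmul1 A) mul1r (@gmulV A) mulVr.
End GroupInstance.

Lemma gmulE (A : group) (x y : A) : gmul x y = (x * y)%g. Proof. by []. Qed.
Lemma ginvE (A : group) (x : A) : ginv x = (x^-1)%g. Proof. by []. Qed.
Lemma goneE (A : group) : gone A = 1%g. Proof. by []. Qed.
Definition gE := (gmulE, ginvE, goneE).

(** * Rational group algebras *)

Section LinearExtension.
Variables (X : choiceType) (W : lmodType rat).
Implicit Types (F : X -> W) (u v : {malg rat[X]}).

Definition lin F u : W := \sum_(k <- msupp u) u@_k *: F k.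

Lemma lin_superset F u (d : {fset X}) : (msupp u `<=` d)%fset ->
  lin F u = \sum_(k <- d) u@_k *: F k.
Proof.
move=> le; rewrite /lin (big_fset_incl _ le) // => k _ /mcoeff_outdom ->.
by rewrite scale0r.
Qed.

Lemma lin_is_linear F : linear (lin F).
Proof.
move=> a u v.
have le : (msupp (a *: u + v) `<=` msupp u `|` msupp v)%fset.
  apply: fsubset_trans (msuppD_le _ _) _; apply: fsetUSS => //.
  exact: msuppZ_le.
rewrite (lin_superset F le) (lin_superset F (fsubsetUl (msupp u) (msupp v))).
rewrite (lin_superset F (fsubsetUr (msupp u) (msupp v))) scaler_sumr -big_split.
by apply: eq_bigr => k _; rewrite mcoeffD mcoeffZ scalerDl scalerA.
Qed.

HB.instance Definition _ F :=
  GRing.isLinear.Build rat {malg rat[X]} W *:%R (lin F) (lin_is_linear F).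

Lemma linU F x : lin F << x >> = F x.
Proof. by rewrite /lin msuppU oner_eq0 big_seq_fset1 mcoeffUU scale1r. Qed.

End LinearExtension.

Lemma malgUZ (X : choiceType) c (x : X) : << c *g x >> = c *: << x >> :> {malg rat[X]}.
Proof. by apply/malgP => k; rewrite mcoeffZ !mcoeffU mulrnAr mulr1. Qed.

Lemma linear_malg_eq (X : choiceType) (W : lmodType rat)
    (f g : {linear {malg rat[X]} -> W}) :
  (forall x, f << x >> = g << x >>) -> f =1 g.
Proof.
move=> fg u; rewrite [u]monalgE !linear_sum; apply: eq_bigr => k _.
by rewrite malgUZ !linearZ /= fg.
Qed.

Lemma lin_id (X : choiceType) (u : {malg rat[X]}) : lin (fun x => << x >>) u = u.
Proof. by apply: (linear_malg_eq (f := lin _) (g := idfun)) => x; rewrite /= linU. Qed.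

Lemma lin_add (X : choiceType) (W : lmodType rat) (F G : X -> W) u :
  lin (fun x => F x + G x) u = lin F u + lin G u.
Proof. by rewrite /lin -big_split; apply: eq_bigr => k _; rewrite scalerDr. Qed.

Lemma lin_scale (X : choiceType) (W : lmodType rat) a (F : X -> W) u :
  lin (fun x => a *: F x) u = a *: lin F u.
Proof.
rewrite /lin scaler_sumr; apply: eq_bigr => k _.
by rewrite !scalerA mulrC.
Qed.

Lemma lin_comp (X : choiceType) (W W' : lmodType rat) (h : {linear W -> W'}) (F : X -> W) u :
  h (lin F u) = lin (fun x => h (F x)) u.
Proof. by rewrite /lin linear_sum; apply: eq_bigr => k _; rewrite linearZ. Qed.

Lemma eq_lin (X : choiceType) (W : lmodType rat) (F G : X -> W) (u : {malg rat[X]}) :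
  (forall x, x \in msupp u -> F x = G x) -> lin F u = lin G u.
Proof. by move=> FG; apply: eq_big_seq => k ku; rewrite FG. Qed.

Lemma malg_coefE (X : choiceType) (u : {malg rat[X]}) x :
  u@_x = lin (fun y => (y == x)%:R : rat^o) u.
Proof.
rewrite [in LHS](monalgE u) raddf_sum.
by under eq_bigr do rewrite /= mcoeffU -mulr_natr.
Qed.

(* The group algebra over Q; [monalg] only provides the product for monoids
   without invertible elements. *)
Definition galg (G : groupType) := {malg rat[G]}.

HB.instance Definition _ G := GRing.Lmodule.on (galg G).

Definition gbase (G : groupType) (x : G) : galg G := << x >>.

HB.lock Definition galg_mul (G : groupType) (u v : galg G) : galg G :=
  lin (fun x => lin (fun y => gbase (x * y)%g) v) u.

Section GroupAlgebra.
Variable G : groupType.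
Local Notation R := (galg G).
Local Notation gbase := (@gbase G).
Local Notation galg_mul := (@galg_mul G).

Definition galg_mulr (v u : R) : R := galg_mul u v.

Lemma galg_ext (W : lmodType rat) (f g : {linear R -> W}) :
  (forall x, f (gbase x) = g (gbase x)) -> f =1 g.
Proof. exact: linear_malg_eq. Qed.

Let mulB x y : galg_mul (gbase x) (gbase y) = gbase (x * y)%g.
Proof. by rewrite unlock !linU. Qed.

Let mull v a u u' : galg_mulr v (a *: u + u') = a *: galg_mulr v u + galg_mulr v u'.
Proof. by rewrite /galg_mulr unlock lin_is_linear. Qed.

Let mulr_lin u a v v' : galg_mul u (a *: v + v') = a *: galg_mul u v + galg_mul u v'.
Proof.
rewrite unlock -lin_scale -lin_add; apply: eq_lin => x _; exact: lin_is_linear.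
Qed.

HB.instance Definition _ v := GRing.isLinear.Build rat R R *:%R (galg_mulr v) (mull v).
HB.instance Definition _ u := GRing.isLinear.Build rat R R *:%R (galg_mul u) (mulr_lin u).

Lemma galg_mulA : associative galg_mul.
Proof.
move=> u v w.
pose f1 : {linear R -> R} := galg_mulr (galg_mul v w).
pose f2 : {linear R -> R} := galg_mulr w \o galg_mulr v.
suff E : f1 =1 f2 by exact: E u.
apply: galg_ext => x.
pose g1 : {linear R -> R} := galg_mul (gbase x) \o galg_mulr w.
pose g2 : {linear R -> R} := galg_mulr w \o galg_mul (gbase x).
suff E : g1 =1 g2 by exact: E v.
apply: galg_ext => y.
pose h1 : {linear R -> R} := galg_mul (gbase x) \o galg_mul (gbase y).
pose h2 : {linear R -> R} := galg_mul (galg_mul (gbase x) (gbase y)).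
suff E : h1 =1 h2 by exact: E w.
apply: galg_ext => z.
by rewrite /= /galg_mulr !mulB mulgA.
Qed.

Lemma galg_mul1l : left_id (gbase 1%g) galg_mul.
Proof.
move=> u; pose f1 : {linear R -> R} := galg_mul (gbase 1%g).
suff E : f1 =1 idfun by exact: E u.
by apply: galg_ext => x; rewrite /= mulB mul1g.
Qed.

Lemma galg_mul1r : right_id (gbase 1%g) galg_mul.
Proof.
move=> u; pose f1 : {linear R -> R} := galg_mulr (gbase 1%g).
suff E : f1 =1 idfun by exact: E u.
by apply: galg_ext => x; rewrite /= /galg_mulr mulB mulg1.
Qed.

Lemma galg_mulDl : left_distributive galg_mul +%R.
Proof. by move=> u v w; exact: (raddfD (galg_mulr w)). Qed.

Lemma galg_mulDr : right_distributive galg_mul +%R.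
Proof. by move=> u v w; exact: (raddfD (galg_mul u)). Qed.

Lemma gbase_neq0 x : gbase x != 0.
Proof. by rewrite monalgU_eq0 oner_eq0. Qed.

HB.instance Definition _ := GRing.Zmodule_isNzRing.Build R
  galg_mulA galg_mul1l galg_mul1r galg_mulDl galg_mulDr (gbase_neq0 1%g).

Lemma galg_scaleAl (a : rat) (u v : R) : a *: (u * v) = a *: u * v.
Proof. by have := mull v a u 0; rewrite linear0 !addr0. Qed.
Lemma galg_scaleAr (a : rat) (u v : R) : a *: (u * v) = u * (a *: v).
Proof. by have := mulr_lin u a v 0; rewrite linear0 !addr0. Qed.

HB.instance Definition _ := GRing.Lmodule_isLalgebra.Build rat R galg_scaleAl.
HB.instance Definition _ := GRing.Lalgebra_isAlgebra.Build rat R galg_scaleAr.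

Lemma gbaseM x y : gbase (x * y)%g = gbase x * gbase y.
Proof. exact: esym (mulB x y). Qed.
Lemma gbase1 : gbase 1%g = 1. Proof. by []. Qed.

Lemma galg_ind (P : R -> Prop) : (forall x, P (gbase x)) -> P 0 ->
  (forall u v, P u -> P v -> P (u + v)) -> (forall a u, P u -> P (a *: u)) ->
  forall u, P u.
Proof.
move=> Pb P0 PD PZ u; rewrite [u]monalgE.
apply: (big_ind P) => // x _; rewrite malgUZ; apply: PZ; exact: Pb.
Qed.

Definition aug : R -> rat^o := lin (fun _ : G => 1 : rat^o).

HB.instance Definition _ := GRing.Linear.on aug.

Lemma augB x : aug (gbase x) = 1. Proof. exact: linU. Qed.

Lemma augM u v : aug (u * v) = aug u * aug v :> rat.
Proof.
elim/galg_ind: u => [x||u u' Hu Hu'|a u Hu]; last 3 first.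
- by rewrite mul0r !raddf0 mul0r.
- by rewrite mulrDl !raddfD /= Hu Hu' mulrDl.
- by rewrite -scalerAl !linearZ /= Hu !rat_scaleE mulrA.
elim/galg_ind: v => [y||v v' Hv Hv'|a v Hv].
- by rewrite -gbaseM !augB mulr1.
- by rewrite mulr0 !raddf0 mulr0.
- by rewrite mulrDr !raddfD /= Hv Hv' mulrDr.
- by rewrite -scalerAr !linearZ /= Hv augB !mul1r.
Qed.

Lemma aug1 : aug 1 = 1. Proof. exact: augB. Qed.

Lemma lin_left (W : lmodType rat) (F : G -> W) (x : G) u :
  lin F (gbase x * u) = lin (fun y => F (x * y)%g) u.
Proof.
pose f1 : {linear R -> W} := lin F \o galg_mul (gbase x).
suff E : f1 =1 lin (fun y => F (x * y)%g) by exact: E u.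
apply: galg_ext => y; rewrite /= linU.
by rewrite /galg_mulr mulB linU.
Qed.

Lemma lin_right (W : lmodType rat) (F : G -> W) (x : G) u :
  lin F (u * gbase x) = lin (fun y => F (y * x)%g) u.
Proof.
pose f1 : {linear R -> W} := lin F \o galg_mulr (gbase x).
suff E : f1 =1 lin (fun y => F (y * x)%g) by exact: E u.
apply: galg_ext => y; rewrite /= linU.
by rewrite /galg_mulr mulB linU.
Qed.

Lemma lin_mul (W : lmodType rat) (F : G -> W) (u v : R) :
  lin F (u * v) = lin (fun y => lin F (u * gbase y)) v.
Proof.
pose f1 : {linear R -> W} := lin F \o galg_mul u.
suff E : f1 =1 lin (fun y => lin F (u * gbase y)) by exact: E v.
by apply: galg_ext => y; rewrite /= linU.
Qed.
End GroupAlgebra.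

(** * Linear systems and homomorphisms to Q *)

Lemma zorn_above (T : Type) (good : (T -> Prop) -> Prop) (S : T -> Prop) :
  good S ->
  (forall F : (T -> Prop) -> Prop, (exists X, F X) -> (forall X, F X -> good X) ->
     (forall X Y, F X -> F Y -> (forall t, X t -> Y t) \/ (forall t, Y t -> X t)) ->
     good (fun t => exists2 X, F X & X t)) ->
  exists M, good M /\ forall M', good M' -> (forall t, M t -> M' t) -> forall t, M' t -> M t.
Proof.
move=> gS chain; pose P (X : T -> Prop) := good X \/ forall t, ~ X t.
have [F FP totF|M [PM Mmax]] := classical_sets.Zorn_bigcup (P := P).
  have -> : classical_sets.bigcup F (fun X => X) = (fun t => exists2 X, F X & X t) by [].
  have [[X FX gX]|noX] := pselect (exists2 X, F X & good X); last first.
    right=> t [X FX Xt]; case: (FP _ FX) => [gX|/(_ t)//].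
    by apply: noX; exists X.
  left; have -> : (fun t => exists2 X, F X & X t) =
      (fun t => exists2 X, (F X /\ good X) & X t).
    apply/funext => t; apply/propext; split=> [[Y FY Yt]|[Y [FY _] Yt]].
      by exists Y => //; split => //; case: (FP _ FY) => // /(_ t).
    by exists Y.
  apply: chain => [|Y []|Y Z [FY _] [FZ _]] //; first by exists X.
  by have [YZ|ZY] := totF _ _ FY FZ; [left => t; apply: YZ|right => t; apply: ZY].
have gM : good M.
  case: PM => // M0; have [Sne|S0] := pselect (exists t, S t); last first.
    suff -> : M = S by [].
    apply/funext => t; apply/propext; split=> [/M0//|St].
    by case: S0; exists t.
  case: (Mmax S); last by left.
  by split=> [t /M0//|SM]; case: Sne => t /SM /M0.
exists M; split=> // M' gM' MM' t M't.
have [Mt|nMt] := pselect (M t) => //; case: (Mmax M'); last by left.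
by split=> [u|M'M]; [exact: MM'|apply: nMt; exact: M'M].
Qed.

Definition linear_rel (V W : lmodType rat) (S : V -> W -> Prop) :=
  S 0 0 /\ forall a v w v' w', S v w -> S v' w' -> S (a *: v + v') (a *: w + w').

(** A linear relation is a linear map from its domain to W modulo the subspace [S 0]. Adjoining a
    vector outside the domain, with value 0, leaves that subspace unchanged; Zorn's lemma does the
    rest, as V may have infinite dimension. *)
Lemma linear_rel_total (V W : lmodType rat) (S : V -> W -> Prop) (W1 : W -> Prop) :
  linear_rel S -> (forall v w, S v w -> W1 w) ->
  exists S' : V -> W -> Prop, [/\ linear_rel S', forall v w, S v w -> S' v w,
    forall v w, S' v w -> W1 w, forall w, S' 0 w -> S 0 w & forall v, exists w, S' v w].
Proof.
move=> linS SW.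
pose good (T : V * W -> Prop) := [/\ linear_rel (fun v w => T (v, w)),
  forall v w, S v w -> T (v, w), forall v w, T (v, w) -> W1 w & forall w, T (0, w) -> S 0 w].
have [||M [[linM SM MW M0] Mmax]] := zorn_above (good := good) (S := fun p => S p.1 p.2).
- by split.
- move=> F [X0 FX0] Fg Ftot.
  have pick2 p q : (exists2 X, F X & X p) -> (exists2 X, F X & X q) ->
      exists X, [/\ F X, X p & X q].
    move=> [X FX Xp] [Y FY Yq]; have [XY|YX] := Ftot _ _ FX FY.
      by exists Y; split=> //; apply: XY.
    by exists X; split=> //; apply: YX.
  split=> [|v w Svw|v w [X /Fg[_ _ XW _] /XW]|w [X /Fg[_ _ _ X0'] /X0']] //.
  + split; first by exists X0 => //; have [[]] := Fg _ FX0.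
    move=> a v w v' w' h h'; have [X [FX Xp Xq]] := pick2 _ _ h h'.
    by exists X => //; have [[_ +] _ _ _] := Fg _ FX; apply.
  + by exists X0 => //; have [_ + _ _] := Fg _ FX0; apply.
exists (fun v w => M (v, w)); split=> // v0.
have [//|nov0] := pselect (exists w, M (v0, w)).
pose M' (p : V * W) := exists a v, M (v, p.2) /\ p.1 = a *: v0 + v.
have MM' p : M p -> M' p by case: p => v w Mp; exists 0, v; rewrite scale0r add0r.
have {}Mmax : forall p, M' p -> M p.
  apply: Mmax => //; split.
  - split; first by apply: MM'; case: linM.
    move=> a v w v' w' [b [u [Mu /= ->]]] [b' [u' [Mu' /= ->]]].
    exists (a * b + b'), (a *: u + u'); split; first by case: linM => _; apply.
    by rewrite /= scalerDl scalerDr scalerA; rewrite [_ *: u + _]addrC addrACA [a *: u + _]addrC addrA addrAC -!addrA.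
  - by move=> v w /SM/MM'.
  - by move=> v w [a [u [/MW]]].
  - move=> w [a [u [Mu /= /esym/eqP]]]; rewrite addrC addr_eq0 => /eqP eu.
    have [a0|a0] := eqVneq a 0; first by move: Mu; rewrite eu a0 scale0r oppr0; exact: M0.
    case: nov0; exists (- a^-1 *: w).
    have := linM.2 (- a^-1) _ _ _ _ Mu linM.1; rewrite !addr0 eu.
    by rewrite scalerN scaleNr opprK scalerA mulVf // scale1r.
by exists 0; apply: Mmax; exists 1, 0; rewrite addr0 scale1r; split=> //; case: linM.
Qed.

(* Solvability of a consistent system of linear equations [lin h u = w],
   (u, w) in S, in the unknowns [h x]; equality is modulo the subspace [S 0]. *)
Lemma linear_system (X : choiceType) (W : lmodType rat)
    (S : {malg rat[X]} -> W -> Prop) (W1 : W -> Prop) :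
  linear_rel S -> (forall u w, S u w -> W1 w) ->
  exists h : X -> W, (forall x, W1 (h x)) /\ forall u w, S u w -> S 0 (lin h u - w).
Proof.
move=> linS SW; have [S' [[S'0 S'l] SS' S'W S'0S tot]] := linear_rel_total linS SW.
have [h hP] : {h : X -> W & forall x, S' << x >> (h x)}.
  by apply: (@choice X W (fun x w => S' << x >> w)) => x; exact: tot.
exists h; split=> [x|u w Suw]; first exact: S'W (hP x).
have S'h v : S' v (lin h v).
  rewrite {1}[v]monalgE /lin; elim/big_rec2: _ => // x v1 v2 _ ih.
  by rewrite malgUZ; apply: S'l.
apply: S'0S; have := S'l (-1) _ _ _ _ (SS' _ _ Suw) (S'h u).
by rewrite !scaleN1r addNr addrC.
Qed.

Definition gz (G : groupType) (x : G) (z : int) : G :=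
  match z with Posz n => x ^+ n | Negz n => x ^- n.+1 end%g.

Section IntegerPowers.
Variable G : groupType.
Implicit Types (x y : G) (a b z : int).

Lemma gz0 x : gz x 0 = 1%g. Proof. by []. Qed.
Lemma gz1 x : gz x 1 = x. Proof. exact: expg1. Qed.
Lemma gzN x z : gz x (- z) = (gz x z)^-1%g.
Proof.
by case: z => [[|n]|n] //=; rewrite ?invg1 ?invgK // -?NegzE //.
Qed.

Lemma gzS x z : gz x (z + 1) = (gz x z * x)%g.
Proof.
case: z => n; first by rewrite -PoszD addn1 /= expgSr.
rewrite NegzE -[n.+1]addn1 PoszD opprD addrNK; case: n => [|n].
  by rewrite /= mulVg.
have -> : - (n.+1 : int) = Negz n by [].
have -> : - (n.+1 : int) - 1 = Negz n.+1 by rewrite !NegzE; lia.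
by rewrite /= [(x ^+ n.+2)%g]expgS invgM mulgVK.
Qed.

Let intSr (n : nat) : (n.+1 : int) = n%:Z + 1. Proof. by rewrite intS addrC. Qed.

Lemma gzD x a b : gz x (a + b) = (gz x a * gz x b)%g.
Proof.
have pos (c : int) (n : nat) : gz x (c + n%:Z) = (gz x c * gz x n)%g.
  elim: n => [|n ih]; first by rewrite addr0 mulg1.
  by rewrite intSr addrA !gzS ih mulgA.
have [[n ->]|[n ->]] : (exists n : nat, b = n) \/ (exists n : nat, b = - (n : int)).
  by case: b => n; [left; exists n|right; exists n.+1].
exact: pos.
by apply: (@mulIg _ (gz x n)); rewrite -pos addrNK gzN mulgVK.
Qed.

Lemma gzM x a b : gz x (a * b) = gz (gz x a) b.
Proof.
have pos (n : nat) : gz x (a * n%:Z) = gz (gz x a) n.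
  elim: n => [|n ih]; first by rewrite mulr0.
  by rewrite intSr gzS -ih mulrDr mulr1 gzD.
have [[n ->]|[n ->]] : (exists n : nat, b = n) \/ (exists n : nat, b = - (n : int)).
- by case: b => n; [left; exists n|right; exists n.+1].
- exact: pos.
- by rewrite mulrN !gzN pos.
Qed.
End IntegerPowers.

Record subgrp (G : groupType) (P : G -> Prop) : Prop := Subgrp {
  subgrp1 : P 1%g;
  subgrpM : forall x y, P x -> P y -> P (x * y)%g;
  subgrpV : forall x, P x -> P x^-1%g }.

Lemma subgrp_gz (G : groupType) (P : G -> Prop) x z : subgrp P -> P x -> P (gz x z).
Proof.
move=> sP Px; have pos (n : nat) : P (x ^+ n)%g.
  elim: n => [|n ih]; first exact: subgrp1.
  by rewrite expgS; apply: subgrpM.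
by case: z => n /=; [|apply: subgrpV => //]; apply: pos.
Qed.

Lemma subgrpMl (G : groupType) (P : G -> Prop) x y : subgrp P -> P x -> P (x * y)%g -> P y.
Proof. by move=> sP Px Pxy; rewrite -[y](mulKg x); apply: subgrpM => //; exact: subgrpV. Qed.

Lemma subgrpMr (G : groupType) (P : G -> Prop) x y : subgrp P -> P y -> P (x * y)%g -> P x.
Proof. by move=> sP Py Pxy; rewrite -[x](mulgK y); apply: subgrpM => //; exact: subgrpV. Qed.

Definition commutators_in (G : groupType) (P Q : G -> Prop) :=
  forall x y : G, P x -> P y -> Q [~ x, y]%g.

Definition hom_on (G : groupType) (P : G -> Prop) (chi : G -> rat) :=
  forall x y, P x -> P y -> chi (x * y)%g = chi x + chi y.

Section SeparatingHom.
Variables (G : groupType) (P Q : G -> Prop).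
Hypotheses (sP : subgrp P) (sQ : subgrp Q) (QP : forall x, Q x -> P x).
Hypothesis PQ : commutators_in P Q.

(* Graphs of homomorphisms to Q, defined on subgroups between [Q] and [P] and vanishing on [Q]. *)
Record partial_hom (T : G * rat -> Prop) : Prop := PartialHom {
  ph_dom : forall x r, T (x, r) -> P x;
  ph_0 : forall q, Q q -> T (q, 0);
  ph_M : forall x y r s, T (x, r) -> T (y, s) -> T ((x * y)%g, r + s);
  ph_V : forall x r, T (x, r) -> T (x^-1%g, - r);
  ph_fun : forall r, T (1%g, r) -> r = 0 }.

Lemma ph_z T x r z : partial_hom T -> T (x, r) -> T (gz x z, z%:~R * r).
Proof.
move=> hT Tx; have pos (n : nat) : T ((x ^+ n)%g, n%:R * r).
  elim: n => [|n ih]; first by rewrite mul0r; apply: ph_0 hT _ (subgrp1 sQ).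
  by rewrite expgS -[n.+1]add1n natrD mulrDl mul1r; apply: ph_M.
case: z => n; first exact: pos.
by rewrite NegzE mulrNz mulNr; apply: ph_V => //; exact: pos.
Qed.

Definition ph_adjoin T (x0 : G) (c : rat) (p : G * rat) : Prop :=
  exists z x r, T (x, r) /\ p = ((gz x0 z * x)%g, z%:~R * c + r).

Lemma partial_hom_adjoin T x0 c : partial_hom T -> P x0 ->
  (forall z r, T (gz x0 z, r) -> r = z%:~R * c) -> partial_hom (ph_adjoin T x0 c).
Proof.
move=> hT Px0 compat.
have cT x z r : T (x, r) -> T ((x ^ gz x0 z)%g, r).
  move=> Tx; have -> : (x ^ gz x0 z = x * [~ x, gz x0 z])%g by rewrite commgEl mulVKg.
  rewrite -[r]addr0; apply: (ph_M hT) => //; apply: (ph_0 hT); apply: PQ.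
    exact: ph_dom hT _ _ Tx.
  exact: subgrp_gz.
split.
- move=> y s [z [x [r [Tx [-> _]]]]]; apply: subgrpM => //; first exact: subgrp_gz.
  exact: ph_dom hT _ _ Tx.
- move=> q /(ph_0 hT) Tq; exists 0, q, 0; split=> //.
  by rewrite gz0 mul1g mul0r addr0.
- move=> _ _ _ _ [z [x [r [Tx [-> ->]]]]] [w [y [s [Ty [-> ->]]]]].
  exists (z + w), (x ^ gz x0 w * y)%g, (r + s); split.
    by apply: (ph_M hT) => //; exact: cT.
  congr (_, _); last by rewrite intrD mulrDl addrACA.
  by rewrite gzD !mulgA; congr (_ * _)%g; rewrite -!mulgA -conjgC.
- move=> _ _ [z [x [r [Tx [-> ->]]]]].
  exists (- z), (x^-1 ^ gz x0 (- z))%g, (- r); split; first exact/cT/(ph_V hT).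
  by rewrite -conjgC invgM gzN mulrNz mulNr opprD.
- move=> t [z [x [r [Tx [e ->]]]]].
  have ex : x = gz x0 (- z) by rewrite gzN; apply/esym/mulg1_eq/esym.
  by move: Tx; rewrite ex => /compat ->; rewrite mulrNz mulNr subrr.
Qed.

(** The quotient P/Q is abelian and y0 has infinite order in it, so sending y0 to 1 defines a
    homomorphism on the cyclic subgroup it generates. The rationals are divisible, so it extends to
    all of P. *)
Lemma separating_hom (y0 : G) : P y0 -> (forall m : nat, (0 < m)%N -> ~ Q (y0 ^+ m)%g) ->
  exists chi : G -> rat, [/\ hom_on P chi, forall q, Q q -> chi q = 0 & chi y0 = 1].
Proof.
move=> Py0 y0Q.
pose TQ (p : G * rat) := Q p.1 /\ p.2 = 0.
have hTQ : partial_hom TQ.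
  split=> [x r [/QP]|q Qq|x y r s [Qx /= ->] [Qy /= ->]|x r [Qx /= ->]|r []] //.
    by split; [exact: subgrpM|rewrite addr0].
  by split; [exact: subgrpV|rewrite oppr0].
pose T0 := ph_adjoin TQ y0 1.
have hT0 : partial_hom T0.
  apply: partial_hom_adjoin => // z r [/= Qz ->].
  case: z Qz => [[|n]|n] /=; first by rewrite mul0r.
    by move=> /y0Q; case.
  by move=> /(subgrpV sQ); rewrite invgK => /y0Q; case.
pose good T := partial_hom T /\ forall p, T0 p -> T p.
have [||T [[hT T0T] Tmax]] := zorn_above (good := good) (S := T0).
- by split.
- move=> F [X0 FX0] Fg Ftot.
  have pick2 p q : (exists2 X, F X & X p) -> (exists2 X, F X & X q) ->
      exists X, [/\ F X, X p & X q].
    move=> [X FX Xp] [Y FY Yq]; have [XY|YX] := Ftot _ _ FX FY.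
      by exists Y; split=> //; apply: XY.
    by exists X; split=> //; apply: YX.
  split; last by move=> p T0p; exists X0 => //; apply: (Fg _ FX0).2.
  split.
  + by move=> x r [X /Fg[hX _] /(ph_dom hX)].
  + by move=> q Qq; exists X0 => //; exact: (ph_0 (Fg _ FX0).1).
  + move=> x y r s h h'; have [X [FX Xp Xq]] := pick2 _ _ h h'.
    by exists X => //; exact: (ph_M (Fg _ FX).1).
  + by move=> x r [X FX Xx]; exists X => //; exact: (ph_V (Fg _ FX).1).
  + by move=> r [X FX Xx]; exact: (ph_fun (Fg _ FX).1).
have tot x0 : P x0 -> exists r, T (x0, r).
  move=> Px0.
  (* If some nonzero power x0^z already has a value s, then c = s / z is forced; otherwise any c
     works and 0 is taken. *)
  have [c compat] : exists c, forall z r, T (gz x0 z, r) -> r = z%:~R * c.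
    have [[z [s [z0 Tz]]]|noz] := pselect (exists z s, z != 0 /\ T (gz x0 z, s)).
      exists (s / z%:~R) => w r Tw.
      have /(ph_fun hT) : T (1%g, z%:~R * r - w%:~R * s).
        have := ph_M hT (ph_z z hT Tw) (ph_V hT (ph_z w hT Tz)).
        by rewrite -!gzM mulrC mulgV.
      move/eqP; rewrite subr_eq0 => /eqP e.
      have zQ : z%:~R != 0 :> rat by rewrite intr_eq0.
      by apply: (mulfI zQ); rewrite e mulrCA; congr (_ * _); rewrite mulrC divfK.
    exists 0 => z r Tz; have [z0|z0] := eqVneq z 0; last by case: noz; exists z, r.
    by rewrite mulr0; apply: (ph_fun hT); move: Tz; rewrite z0.
  have hT' := partial_hom_adjoin hT Px0 compat.
  have TT' p : T p -> ph_adjoin T x0 c p.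
    by case: p => x r Tx; exists 0, x, r; rewrite mul1g mul0r add0r.
  exists c; apply: (Tmax (ph_adjoin T x0 c)) => //.
    by split=> // p /T0T/TT'.
  exists 1, 1%g, 0; split; first exact: ph_0 hT _ (subgrp1 sQ).
  by rewrite gz1 mulg1 mul1r addr0.
have fn x r s : T (x, r) -> T (x, s) -> r = s.
  move=> Tr Ts; apply/eqP; rewrite -subr_eq0; apply/eqP/(ph_fun hT).
  by rewrite -(mulgV x); apply: (ph_M hT) => //; exact: ph_V.
have [chi chiP] : {chi : G -> rat & forall x, P x -> T (x, chi x)}.
  apply: (@choice G rat (fun x r => P x -> T (x, r))) => x.
  have [/tot[r Tr]|nPx] := pselect (P x); first by exists r.
  by exists 0 => /nPx.
exists chi; split.
- move=> x y Px Py; apply: (fn (x * y)%g); first by apply: chiP; apply: subgrpM.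
  by apply: (ph_M hT); exact: chiP.
- by move=> q Qq; apply: (fn q); [exact/chiP/QP|exact: ph_0].
- apply: (fn y0); first exact: chiP.
  apply: T0T; exists 1, 1%g, 0; rewrite gz1 mulg1 mul1r addr0.
  by split=> //; split=> //; exact: subgrp1.
Qed.
End SeparatingHom.

(** * Commutator subgroups *)

Lemma In_cat (T : Type) (s t : seq T) e : List.In e (s ++ t) -> List.In e s \/ List.In e t.
Proof. by elim: s => [|x s ih] /=; [right|move=> [->|/ih[]]; tauto]. Qed.

Lemma commE (A : group) (x y : A) : comm x y = [~ x, y]%g.
Proof. by rewrite /comm !gE /commg /monoid.conjg !mulgA. Qed.

Lemma conjE (A : group) (x g : A) : Defs.conjg x g = (x ^ g)%g.
Proof. by rewrite /Defs.conjg !gE /monoid.conjg mulgA. Qed.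

Lemma gpowE (A : group) (x : A) n : gpow x n = (x ^+ n)%g.
Proof. by elim: n => //= n ->; rewrite expgS. Qed.

Lemma gzpowE (A : group) (x : A) z : gzpow x z = gz x z.
Proof. by case: z => n; rewrite /gz -gpowE. Qed.

Lemma gprod_cat (A : group) (s t : seq A) : gprod (s ++ t) = (gprod s * gprod t)%g.
Proof. by elim: s => [|x s ih] /=; rewrite ?mul1g // !gE ih mulgA. Qed.

Definition normal_sub (G : groupType) (P : G -> Prop) := forall x g, P x -> P (x ^ g)%g.

Section CommutatorSubgroup.
Variables (A : group) (P Q : A -> Prop).

Lemma commsub1 : commsub P Q 1%g.
Proof. by exists [::]; split. Qed.

Lemma commsub_mem x y : P x -> Q y -> commsub P Q [~ x, y]%g.
Proof.
move=> Px Qy; exists [:: ((x, y), true)]; split=> [e [<-|[]]|] //=.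
by rewrite !gE mulg1 commE.
Qed.

Lemma commsub_subgrp : subgrp (commsub P Q).
Proof.
split; first exact: commsub1.
- move=> x y [s [sPQ ->]] [t [tPQ ->]]; exists (s ++ t); split.
    by move=> e es; case: (In_cat es) => [/sPQ|/tPQ].
  by rewrite map_cat gprod_cat.
move=> x [s [sPQ ->]]; exists (rev [seq (e.1, ~~ e.2) | e <- s]); split.
  move=> e; elim: s sPQ => //= e0 s ih sPQ; rewrite rev_cons -cats1 => es; case: (In_cat es).
    by apply: ih => e1 e1s; apply: sPQ; right.
  by move=> [<-|[]]; exact: (sPQ e0 (or_introl erefl)).
elim: s {sPQ} => [|e s ih] /=; first by rewrite invg1.
rewrite rev_cons -cats1 map_cat gprod_cat -ih !gE invgM; congr (_ * _)%g => /=.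
by case: e.2; rewrite /= !gE mulg1 ?invgK.
Qed.

Lemma commsub_min (S : A -> Prop) : subgrp S -> (forall x y, P x -> Q y -> S [~ x, y]%g) ->
  forall z, commsub P Q z -> S z.
Proof.
move=> sS PQS _ [s [sPQ ->]]; elim: s sPQ => [|e s ih] sPQ /=; first exact: (subgrp1 sS).
apply: (subgrpM sS); last by apply: ih => e' e's; apply: sPQ; right.
have [Pe Qe] := sPQ e (or_introl erefl).
by case: e.2; rewrite ?ginvE commE; [|apply: (subgrpV sS)]; apply: PQS.
Qed.

Lemma commsub_normal : normal_sub P -> normal_sub Q -> normal_sub (commsub P Q).
Proof.
move=> nP nQ x g; apply: (commsub_min (S := fun x => commsub P Q (x ^ g)%g)).
  have [s1 sM sV] := commsub_subgrp.
  split=> [|y z|y]; rewrite ?conj1g ?conjMg ?conjVg; [exact: s1|exact: sM|exact: sV].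
by move=> y z Py Qz; rewrite conjRg; apply: commsub_mem; [apply: nP|apply: nQ].
Qed.
End CommutatorSubgroup.

Lemma commsub_hom (A B : group) (f : A -> B) (P Q : A -> Prop) (P' Q' : B -> Prop) :
  ishom f -> (forall x, P x -> P' (f x)) -> (forall x, Q x -> Q' (f x)) ->
  forall x, commsub P Q x -> commsub P' Q' (f x).
Proof.
move=> fM fP fQ; have f1 : f 1%g = 1%g.
  by apply: (@mulgI _ (f 1%g)); rewrite -[LHS]fM gE !mulg1.
have fV x : f x^-1%g = (f x)^-1%g.
  by apply/esym/mulg1_eq; rewrite -[LHS]fM gE mulgV.
apply: commsub_min.
  have [s1 sM sV] := commsub_subgrp P' Q'.
  split=> [|y z|y]; first by rewrite f1.
    by rewrite -gmulE fM; apply: sM.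
  by rewrite fV; apply: sV.
move=> x y Px Qy; rewrite -commE /comm !fM !ginvE !fV -!ginvE -/(comm _ _) commE.
by apply: commsub_mem; auto.
Qed.

Lemma hom1 (A B : group) (f : A -> B) : ishom f -> f 1%g = 1%g.
Proof. by move=> fM; apply: (@mulgI _ (f 1%g)); rewrite -[LHS]fM gE !mulg1. Qed.

Lemma homV (A B : group) (f : A -> B) x : ishom f -> f x^-1%g = (f x)^-1%g.
Proof. by move=> fM; apply/esym/mulg1_eq; rewrite -[LHS]fM gE mulgV hom1. Qed.

Lemma homM (A B : group) (f : A -> B) (x y : A) : ishom f -> f (x * y)%g = (f x * f y)%g.
Proof. by move=> fM; exact: fM. Qed.

(** * Subspaces of rational vector spaces *)

Record subsp (V : lmodType rat) (S : V -> Prop) : Prop := Subsp {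
  subsp0 : S 0;
  subspP : forall a u v, S u -> S v -> S (a *: u + v) }.

Section Subspaces.
Variables (V : lmodType rat) (S : V -> Prop).
Hypothesis sS : subsp S.

Lemma subspZ a u : S u -> S (a *: u).
Proof. by move=> Su; rewrite -[_ *: _]addr0; apply: (subspP sS) => //; exact: subsp0. Qed.
Lemma subspD u v : S u -> S v -> S (u + v).
Proof. by move=> Su Sv; rewrite -[u]scale1r; apply: (subspP sS). Qed.
Lemma subspN u : S u -> S (- u).
Proof. by rewrite -scaleN1r; exact: subspZ. Qed.
Lemma subspB u v : S u -> S v -> S (u - v).
Proof. by move=> Su Sv; apply: subspD => //; exact: subspN. Qed.
Lemma subsp_sum I (r : seq I) (P : pred I) (F : I -> V) :
  (forall i, P i -> S (F i)) -> S (\sum_(i <- r | P i) F i).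
Proof. by move=> SF; apply: big_ind => //; [exact: subsp0|exact: subspD]. Qed.
Lemma subsp_lin (X : choiceType) (F : X -> V) u :
  (forall x, x \in msupp u -> S (F x)) -> S (lin F u).
Proof.
move=> SF; rewrite /lin big_seq; apply: subsp_sum => x /SF; exact: subspZ.
Qed.
Lemma subspBK u v : S (u - v) -> S v -> S u.
Proof. by move=> Suv Sv; rewrite -[u](subrK v); apply: subspD. Qed.
End Subspaces.

Lemma lin_sub (X : choiceType) (W : lmodType rat) (F G : X -> W) u :
  lin F u - lin G u = lin (fun x => F x - G x) u.
Proof. by rewrite lin_add -scaleN1r -lin_scale; congr (_ + _); apply: eq_lin => x _; rewrite scaleN1r. Qed.

(** * Extension of cochains along f *)

Definition mchain (X : choiceType) (c : seq (rat * X)) : {malg rat[X]} :=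
  \sum_(p <- c) p.1 *: << p.2 >>.

Lemma coef_mchain (X : choiceType) (c : seq (rat * X)) x : coef c x = (mchain c)@_x.
Proof.
rewrite /coef /mchain raddf_sum /=; apply: eq_bigr => p _.
rewrite mcoeffZ mcoeffU; case: pdecP => [->|]; first by rewrite eqxx mulr1.
by case: eqVneq => // _ _; rewrite mulr0.
Qed.

Lemma ceqP (X : choiceType) (c c' : seq (rat * X)) : ceq c c' <-> mchain c = mchain c'.
Proof.
split=> [e|e x]; last by rewrite !coef_mchain e.
by apply/malgP => x; rewrite -!coef_mchain.
Qed.

Lemma mchain_cat (X : choiceType) (c c' : seq (rat * X)) :
  mchain (c ++ c') = mchain c + mchain c'.
Proof. exact: big_cat. Qed.

Lemma mchain_nil (X : choiceType) : mchain [::] = 0 :> {malg rat[X]}.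
Proof. exact: big_nil. Qed.

Lemma mchain_surj (X : choiceType) (u : {malg rat[X]}) : exists c, mchain c = u.
Proof.
exists [seq (u@_k, k) | k <- msupp u]; rewrite /mchain big_map.
by rewrite -[RHS]lin_id.
Qed.

Lemma lin_mchain (X : choiceType) (W : lmodType rat) (F : X -> W) c :
  lin F (mchain c) = \sum_(p <- c) p.1 *: F p.2.
Proof.
by rewrite /mchain linear_sum; apply: eq_bigr => p _; rewrite linearZ /= linU.
Qed.

Definition bd2 (A : group) : {malg rat[(A * A)%type]} -> {malg rat[A]} :=
  lin (fun p => << p.1 >> + << p.2 >> - << (p.1 * p.2)%g >>).
Definition bd3 (A : group) : {malg rat[(A * A * A)%type]} -> {malg rat[(A * A)%type]} :=
  lin (fun p => << (p.1.2, p.2) >> - << ((p.1.1 * p.1.2)%g, p.2) >>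
      + << (p.1.1, (p.1.2 * p.2)%g) >> - << p.1 >>).
Definition push (X Y : choiceType) (f : X -> Y) : {malg rat[X]} -> {malg rat[Y]} :=
  lin (fun x => << f x >>).
HB.instance Definition _ A := GRing.Linear.on (@bd2 A).
HB.instance Definition _ A := GRing.Linear.on (@bd3 A).
HB.instance Definition _ X Y f := GRing.Linear.on (@push X Y f).

Lemma lin_push (X Y : choiceType) (W : lmodType rat) (f : X -> Y) (F : Y -> W) u :
  lin F (push f u) = lin (fun x => F (f x)) u.
Proof. by rewrite /push (lin_comp (lin F)); apply: eq_lin => x _; rewrite /= linU. Qed.

Lemma lin_bd2 (A : group) (W : lmodType rat) (F : A -> W) u :
  lin F (bd2 u) = lin (fun p => F p.1 + F p.2 - F (p.1 * p.2)%g) u.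
Proof.
rewrite /bd2 (lin_comp (lin F)); apply: eq_lin => x _.
by rewrite linearB linearD /= !linU.
Qed.

Lemma lin_bd3 (A : group) (W : lmodType rat) (F : A * A -> W) u :
  lin F (bd3 u) = lin (fun p => F (p.1.2, p.2) - F ((p.1.1 * p.1.2)%g, p.2)
      + F (p.1.1, (p.1.2 * p.2)%g) - F p.1) u.
Proof.
rewrite /bd3 (lin_comp (lin F)); apply: eq_lin => x _.
by rewrite linearB linearD linearB /= !linU.
Qed.

Lemma lmod_sum3 (V : lmodType rat) (a : rat) (x y z : V) :
  a *: x + (- a *: y + (a *: z + 0)) = a *: (z + x - y).
Proof. by rewrite addr0 scalerBr scalerDr scaleNr [LHS]addrA [LHS]addrC [LHS]addrA. Qed.

Lemma lmod_sum4 (V : lmodType rat) (a : rat) (x y z w : V) :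
  a *: x + (- a *: y + (a *: z + (- a *: w + 0))) = a *: (x - y + z - w).
Proof. by rewrite addr0 scalerBr scalerDr scalerBr !scaleNr !addrA. Qed.

Lemma mchain_d2 (A : group) (c : chain2 A) : mchain (d2 c) = bd2 (mchain c).
Proof.
rewrite /bd2 lin_mchain /mchain /d2 big_flatten big_map; apply: eq_bigr => p _.
rewrite !big_cons big_nil; exact: lmod_sum3.
Qed.

Lemma mchain_d3 (A : group) (c : chain3 A) : mchain (d3 c) = bd3 (mchain c).
Proof.
rewrite /bd3 lin_mchain /mchain /d3 big_flatten big_map; apply: eq_bigr => p _.
rewrite !big_cons big_nil /= -surjective_pairing; exact: lmod_sum4.
Qed.

Lemma mchain_map1 (A B : group) (f : A -> B) (c : chain1 A) :
  mchain (map1 f c) = push f (mchain c).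
Proof. by rewrite /push lin_mchain /mchain big_map. Qed.

Definition fpair (A B : group) (f : A -> B) (p : A * A) := (f p.1, f p.2).

Lemma mchain_map2 (A B : group) (f : A -> B) (c : chain2 A) :
  mchain (map2 f c) = push (fpair f) (mchain c).
Proof. by rewrite /push lin_mchain /mchain big_map. Qed.

Lemma bd2_push (A B : group) (f : A -> B) u : ishom f ->
  bd2 (push (fpair f) u) = push f (bd2 u).
Proof.
move=> fM; rewrite /bd2 lin_push -/(bd2 _) [RHS]lin_bd2; apply: eq_lin => p _ /=.
by rewrite -(homM _ _ fM).
Qed.

Lemma H1_monoP (A B : group) (f : A -> B) u e : H1_mono f ->
  push f u = bd2 e -> exists e', u = bd2 e'.
Proof.
have [[c <-] [c' <-]] := (mchain_surj u, mchain_surj e).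
move=> mono; rewrite -mchain_map1 -mchain_d2 => /ceqP E.
have [|e' /ceqP ->] := mono c; first by exists c'.
by exists (mchain e'); rewrite mchain_d2.
Qed.

Lemma H2_epiP m (A B : group) (f : A -> B) z : H2_mod_Phi_epi m f -> bd2 z = 0 ->
  exists z' w c, [/\ bd2 z' = 0, z = push (fpair f) z' + mchain w + bd3 c,
    bd2 (mchain w) = 0 & supported2 (derived B m) w].
Proof.
have cyc (D : group) (c : chain2 D) : cycle2 c <-> bd2 (mchain c) = 0.
  by rewrite -mchain_d2 -(mchain_nil D); exact: ceqP.
have [c <-] := mchain_surj z.
move=> epi /cyc /epi[z' [/cyc z'0 [w [/cyc w0 [sw [c3 /ceqP]]]]]].
rewrite !mchain_cat mchain_map2 mchain_d3 addrA => e.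
by exists (mchain z'), w, (mchain c3).
Qed.

(** * Extension of 1-cochains with values in W1 modulo W0 *)

Section ExtendCochain.
Variables (A B : group) (f : A -> B) (m : nat) (W : lmodType rat) (W0 W1 : W -> Prop).
Variables (c : B -> B -> W) (g : A -> W).
Let c' (p : B * B) := c p.1 p.2.
Hypotheses (fM : ishom f) (mono : H1_mono f) (epi : H2_mod_Phi_epi m f).
Hypotheses (sW0 : subsp W0) (sW1 : subsp W1) (W01 : forall w, W0 w -> W1 w).
Hypotheses (cW1 : forall x y, W1 (c x y)) (gW1 : forall a, W1 (g a)).
Hypothesis cocycle : forall x y z,
  W0 (c y z - c (x * y)%g z + c x (y * z)%g - c x y).
Hypothesis c_Phi : forall w : chain2 B, bd2 (mchain w) = 0 ->
  supported2 (derived B m) w -> W0 (lin (fun p => c p.1 p.2) (mchain w)).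
Hypothesis c_f : forall a b, W0 (c (f a) (f b) - (g a + g b - g (a * b)%g)).

(* The cocycle [c] kills, modulo [W0], all 2-cycles of [B] since its pullback to [A]
   is the coboundary of [g]; hence the system below is consistent. *)
Lemma extend_cochain : exists h : B -> W, [/\ forall x, W1 (h x),
  forall x y, W0 (h x + h y - h (x * y)%g - c x y) & forall a, W0 (h (f a) - g a)].
Proof.
(* The equations on h: on boundaries it is given by c, on the image of f by g. As [bd2] sends (x, y)
   to x + y - xy, the generators of this relation are the two required families of equations. *)
pose S (u : {malg rat[B]}) (w : W) := exists (q : {malg rat[(B * B)%type]}) (r : {malg rat[A]}),
  u = bd2 q + push f r /\ W0 (w - (lin c' q + lin g r)).
have c_push e : W0 (lin c' (push (fpair f) e) - lin g (bd2 e)).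
  rewrite lin_push lin_bd2 lin_sub; apply: subsp_lin => // p _.
  exact: c_f.
have c_cycle z : bd2 z = 0 -> W0 (lin c' z).
  move=> /(H2_epiP epi)[z' [w [b [z'0 -> w0 sw]]]].
  rewrite !linearD /=; apply: (subspD sW0); first apply: (subspD sW0).
  - by have := c_push z'; rewrite z'0 linear0 subr0.
  - exact: c_Phi.
  - by rewrite lin_bd3; apply: subsp_lin => // p _; apply: cocycle.
(* Consistency: if bd2 q + f(r) = 0, then r bounds some e' by injectivity on H_1, and q + f(e') is a
   2-cycle of B, on which c vanishes. *)
have S0 w : S 0 w -> W0 w.
  move=> [q [r [/esym e ew]]]; apply: (subspBK sW0 ew).
  have : push f r = bd2 (- q) by rewrite linearN; apply/eqP; rewrite -addr_eq0 addrC e.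
  move=> /(H1_monoP mono)[e' er].
  have : bd2 (q + push (fpair f) e') = 0 by rewrite linearD /= bd2_push // -er.
  move=> /c_cycle; rewrite linearD /= => h1.
  have -> : lin c' q + lin g r = lin c' q + lin c' (push (fpair f) e')
      - (lin c' (push (fpair f) e') - lin g (bd2 e')).
    by rewrite er opprB addrACA subrr addr0.
  exact: subspB.
have linS : linear_rel S.
  split; first by exists 0, 0; rewrite !linear0 !addr0 subr0; split=> //; exact: subsp0.
  move=> a v w v' w' [q [r [-> e]]] [q' [r' [-> e']]].
  exists (a *: q + q'), (a *: r + r'); rewrite !linearP; split.
    by rewrite scalerDr addrACA.
  have := subspP sW0 a e e'; congr W0.
  by rewrite scalerBr scalerDr addrACA -opprD addrACA.
have SW u w : S u w -> W1 w.
  move=> [q [r [_ e]]]; apply: (subspBK sW1); first exact: W01 e.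
  by apply: subspD => //; apply: subsp_lin => // x _; rewrite /c'.
have [h [hW1 hS]] := linear_system linS SW.
exists h; split=> // [x y|a].
  apply: S0; rewrite -[h x](linU h) -[h y](linU h) -[h (x * y)%g](linU h) -linearD -linearB.
  apply: hS; exists << (x, y) >>, 0; rewrite !linear0 !addr0 /bd2 !linU; split=> //.
  by rewrite subrr; exact: subsp0.
apply: S0; rewrite -[h _](linU h); apply: hS; exists 0, << a >>.
by rewrite !linear0 !add0r /push !linU subrr; split=> //; exact: subsp0.
Qed.
End ExtendCochain.

Lemma commMgJ (G : groupType) (x y z : G) : [~ x * y, z]%g = ([~ x, z] ^ y * [~ y, z])%g.
Proof. by rewrite /commg /monoid.conjg !invgM !mulgA !mulgK. Qed.

Lemma commVgJ (G : groupType) (x z : G) : [~ x^-1, z]%g = ([~ x, z]^-1 ^ x^-1)%g.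
Proof. by rewrite /commg /monoid.conjg !invgM !invgK !mulgA ?(mulgK, mulgVK). Qed.

Lemma Hall_Witt (G : groupType) (x y z : G) :
  ([~ [~ x, y^-1], z] ^ y * [~ [~ y, z^-1], x] ^ z * [~ [~ z, x^-1], y] ^ x = 1)%g.
Proof.
rewrite /commg /monoid.conjg !invgM !invgK !mulgA.
by rewrite ?(mulgK, mulgVK, mulVg, mulgV, mul1g, mulg1).
Qed.

Lemma expgM_mod (G : groupType) (S C : G -> Prop) x y n :
  subgrp S -> subgrp C -> (forall u v, C u -> S v -> C (u ^ v)%g) ->
  commutators_in S C -> S x -> S y -> C ((x ^+ n * y ^+ n)^-1 * (x * y) ^+ n)%g.
Proof.
move=> sS sC nC SC Sx Sy; have SX u m : S u -> S (u ^+ m)%g.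
  by move=> Su; exact: (subgrp_gz m sS Su).
elim: n => [|n ih]; first by rewrite !expg0 !mulg1 invg1; exact: subgrp1.
have -> : ((x ^+ n.+1 * y ^+ n.+1)^-1 * (x * y) ^+ n.+1 =
   [~ y, x ^+ n] ^ (y ^+ n) * ((x ^+ n * y ^+ n)^-1 * (x * y) ^+ n))%g.
  rewrite !expgS !invgM /commg /monoid.conjg !mulgA.
  by rewrite ?(mulgK, mulgVK, mulVg, mulgV, mul1g, mulg1).
by apply: (subgrpM sC) => //; apply: nC; [apply: SC => //|]; apply: SX.
Qed.

(** * The rational lower central series *)

Section RationalLowerCentral.
Variable A : group.
Local Notation D := (rlcs_aux A).
Local Notation C k := (commsub (fun _ : A => True) (D k)).

Lemma rlcs_auxS k x : D k.+1 x <-> exists2 m : nat, (0 < m)%N & C k (x ^+ m)%g.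
Proof.
by split=> [[m [m0]]|[m m0]]; [exists m => //|exists m; split=> //]; rewrite -?gpowE // gpowE.
Qed.

(** A single induction, since the properties support each other: D_k/[A, D_k] is abelian, so its
    torsion elements form a subgroup, whose preimage is D_(k+1). That D_(k+1) lies in D_k is not
    part of the definition and comes from closure of D_k under roots. *)
Lemma rlcs_aux_facts k : [/\ subgrp (D k), normal_sub (D k),
  forall x m, (0 < m)%N -> D k (x ^+ m)%g -> D k x & forall x, D k.+1 x -> D k x].
Proof.
have CD k' : subgrp (D k') -> normal_sub (D k') -> forall x, C k' x -> D k' x.
  move=> sD nD; apply: (commsub_min sD) => x y _ Dy; rewrite commgEr conjVg.
  by apply: (subgrpM sD) => //; apply: (subgrpV sD); apply: nD.
have dec k' : subgrp (D k') -> normal_sub (D k') ->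
    (forall x m, (0 < m)%N -> D k' (x ^+ m)%g -> D k' x) -> forall x, D k'.+1 x -> D k' x.
  by move=> sD nD iD x /rlcs_auxS[m m0 /(CD _ sD nD)]; exact: iD.
elim: k => [|k [sD nD iD dD]]; first by split=> //; apply: dec.
have sC := commsub_subgrp (fun _ : A => True) (D k).
have nC : normal_sub (C k) by apply: commsub_normal.
have nDS : normal_sub (D k.+1).
  move=> x g /rlcs_auxS[m m0 Cx]; apply/rlcs_auxS; exists m => //.
  by rewrite -conjXg; apply: nC.
have sDS : subgrp (D k.+1).
  split.
  - by apply/rlcs_auxS; exists 1%N => //; rewrite expg1; exact: (subgrp1 sC).
  - move=> x y /[dup] /dD Dx /rlcs_auxS[p p0 Cx] /[dup] /dD Dy /rlcs_auxS[q q0 Cy].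
    apply/rlcs_auxS; exists (p * q)%N; first by rewrite muln_gt0 p0.
    have Cpq : C k (x ^+ (p * q) * y ^+ (p * q))%g.
      apply: (subgrpM sC); first by rewrite expgnA; exact: (subgrp_gz q sC Cx).
      by rewrite mulnC expgnA; exact: (subgrp_gz p sC Cy).
    have := expgM_mod (p * q) sD sC (fun u v Cu _ => nC u v Cu) _ Dx Dy.
    rewrite -{2}[((x * y) ^+ _)%g](mulVKg (x ^+ (p * q) * y ^+ (p * q))%g) => h.
    by apply: (subgrpM sC) => //; apply: h => u v _ Dv; exact: commsub_mem.
  - move=> x /rlcs_auxS[m m0 Cx]; apply/rlcs_auxS; exists m => //.
    by rewrite expVgn; exact: (subgrpV sC).
have iDS x m : (0 < m)%N -> D k.+1 (x ^+ m)%g -> D k.+1 x.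
  move=> m0 /rlcs_auxS[q q0]; rewrite -expgnA => Cx; apply/rlcs_auxS.
  by exists (m * q)%N; rewrite // muln_gt0 m0.
by split=> //; apply: dec.
Qed.

Lemma rlcs_aux_decr k l x : (k <= l)%N -> D l x -> D k x.
Proof.
move=> /subnK <-; elim: (l - k)%N => // d ih; rewrite addSn => Dx; apply: ih.
by have [_ _ _] := rlcs_aux_facts (d + k); apply.
Qed.

Lemma rlcs_aux_comm1 k x y : D k x -> D k.+1 [~ x, y]%g.
Proof.
move=> Dx; apply/rlcs_auxS; exists 1%N => //; rewrite expg1 -invgR.
by apply: (subgrpV (commsub_subgrp _ _)); apply: commsub_mem.
Qed.

(** [D i] is A^r_(i+1), hence the extra 1 in the index. The three subgroups lemma handles x in
    [A, D_(i-1)]; roots of such elements are treated afterwards. *)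
Lemma rlcs_aux_comm i j x z : D i x -> D j z -> D (i + j).+1%N [~ x, z]%g.
Proof.
elim: i j x z => [|i ih] j x z.
  by move=> _ Dz; rewrite -invgR; apply: (subgrpV _ (rlcs_aux_comm1 _ Dz)); case: (rlcs_aux_facts j.+1).
move=> /rlcs_auxS[m m0 Cx] Dz; set S := D (i.+1 + j).+1%N.
have [sS nS _ _] := rlcs_aux_facts (i.+1 + j).+1%N.
have Dinv k u : D k u -> D k u^-1%g by case: (rlcs_aux_facts k) => s _ _ _; exact: subgrpV.
(* Three subgroups lemma: two factors of the Hall-Witt identity lie in S by induction on i, hence so
   does the third. *)
have CS u : C i u -> S [~ u, z]%g.
  have sSz : subgrp (fun u => S [~ u, z]%g).
    split; first by rewrite comm1g; exact: subgrp1.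
      by move=> u1 u2 h1 h2; rewrite commMgJ; apply: (subgrpM sS) => //; apply: nS.
    by move=> u1 h1; rewrite commVgJ; apply: nS; apply: subgrpV.
  apply: (commsub_min sSz) => a y _ Dy.
  have hw := Hall_Witt a y^-1 z; rewrite invgK in hw.
  have h2 : S [~ [~ y^-1, z^-1], a]%g.
    by apply: rlcs_aux_comm1; apply: ih; apply: Dinv.
  have h3 : S [~ [~ z, a^-1], y^-1]%g.
    rewrite -invgR; apply: (Dinv _ _); rewrite /S addSnnS; apply: ih; first exact: Dinv.
    exact: rlcs_aux_comm1.
  rewrite -[X in S X](conjgK y^-1%g _); apply: (nS _ _).
  apply: (subgrpMr sS (y := [~ [~ y^-1, z^-1], a] ^ z)%g); first exact: nS.
  apply: (subgrpMr sS (y := [~ [~ z, a^-1], y^-1] ^ a)%g); first exact: nS.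
  by rewrite hw; exact: subgrp1.
(* Passing to roots, one level s at a time: if [x, z] lies in D_s, it is central modulo D_(s+1), so
   [x, z]^m agrees there with [x^m, z], which lies in S. Closure under roots then puts [x, z] in
   D_(s+1). *)
suff main s : (s <= (i.+1 + j).+1)%N -> D s [~ x, z]%g by exact: main.
elim: s => // s ihs sk; have {ihs}Ds := ihs (ltnW sk).
have [sD nD iD _] := rlcs_aux_facts s.+1.
have sub u : S u -> D s.+1 u by apply: rlcs_aux_decr.
have powr n : D s.+1 ([~ x, z] ^- n * [~ x ^+ n, z])%g.
  elim: n => [|n ihn]; first by rewrite expg0 comm1g mulg1 invg1; exact: subgrp1.
  have -> : ([~ x, z] ^- n.+1 * [~ x ^+ n.+1, z] =
      [~ [~ x, z], x ^+ n] ^ ([~ x, z] ^+ n) * ([~ x, z] ^- n * [~ x ^+ n, z]))%g.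
    rewrite !expgS commMgJ; set c := [~ x, z]%g; rewrite invgM [in RHS]/commg /monoid.conjg.
    by rewrite !mulgA ?(mulgK, mulgVK).
  by apply: (subgrpM sD) => //; apply: nD; exact: rlcs_aux_comm1.
apply: (iD _ m m0); rewrite -[X in D _ X]invgK; apply: (subgrpV sD).
by apply: (subgrpMr sD (sub _ (CS _ Cx))); exact: powr.
Qed.
End RationalLowerCentral.

(** * N-series closed under roots *)

Record nseries (G : groupType) (F : nat -> G -> Prop) : Prop := Nseries {
  ns_top : forall x, F 1 x;
  ns_grp : forall i, subgrp (F i);
  ns_decr : forall i x, F i.+1 x -> F i x;
  ns_comm : forall i j x y, F i x -> F j y -> F (i + j)%N [~ x, y]%g;
  ns_isol : forall i m x, (0 < m)%N -> F i (x ^+ m)%g -> F i x }.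

Lemma rlcs_nseries (A : group) : nseries (rlcs A).
Proof.
split=> [//|i|i x|i j x y|i m x m0]; first by case: (rlcs_aux_facts A i.-1).
- by case: i => // i; have [_ _ _ h] := rlcs_aux_facts A i; exact: h.
- case: i j => [|i] [|j]; rewrite /rlcs //=.
  + by move=> _ /(rlcs_aux_comm (i := 0) (j := j) (x := x) I); apply: rlcs_aux_decr.
  + by move=> /rlcs_aux_comm1 h _; rewrite addn0; apply: rlcs_aux_decr (h y).
  + by rewrite addnS; exact: rlcs_aux_comm.
- by case: (rlcs_aux_facts A i.-1) => _ _ + _; apply.
Qed.

Lemma ns_normal (G : groupType) (F : nat -> G -> Prop) i : nseries F -> normal_sub (F i).
Proof.
move=> nF x g Fx; have -> : (x ^ g = x * [~ x, g])%g by rewrite commgEl mulVKg.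
apply: (subgrpM (ns_grp nF i)) => //.
by apply: (ns_decr nF); rewrite -addn1; apply: (ns_comm nF) => //; exact: (ns_top nF).
Qed.

Lemma ns_le (G : groupType) (F : nat -> G -> Prop) i j x : nseries F -> (i <= j)%N ->
  F j x -> F i x.
Proof. by move=> nF /subnK <-; elim: (j - i)%N => // d ih; rewrite addSn => /(ns_decr nF). Qed.

(** * Finitely generated subgroups of a rational vector space *)

Section IntegralBasis.
Variable V : lmodType rat.

Definition Zspan r (b : 'I_r -> V) (x : V) := exists z : 'I_r -> int, x = \sum_i b i *~ z i.

Lemma Zspan_gen r (b : 'I_r -> V) i : Zspan b (b i).
Proof.
exists (fun j => (j == i)%:Z); rewrite (bigD1 i) //= eqxx mulr1z big1 ?addr0 // => j.
by move=> /negbTE ->.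
Qed.

Lemma ZspanD r (b : 'I_r -> V) x y : Zspan b x -> Zspan b y -> Zspan b (x + y).
Proof.
move=> [z ->] [w ->]; exists (fun i => z i + w i); rewrite -big_split.
by apply: eq_bigr => i _; rewrite mulrzDr.
Qed.

Lemma ZspanM r (b : 'I_r -> V) x a : Zspan b x -> Zspan b (x *~ a).
Proof.
move=> [z ->]; exists (fun i => z i * a).
by rewrite mulrz_suml; apply: eq_bigr => i _; rewrite mulrzA.
Qed.

Lemma Zspan0 r (b : 'I_r -> V) : Zspan b 0.
Proof. by exists (fun=> 0); rewrite big1. Qed.

Lemma Zspan_trans r r' (b : 'I_r -> V) (b' : 'I_r' -> V) x :
  (forall i, Zspan b (b' i)) -> Zspan b' x -> Zspan b x.
Proof.
move=> bb' [z ->]; apply: big_ind => [||i _]; [exact: Zspan0|exact: ZspanD|].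
exact: ZspanM.
Qed.

(* Euclid's algorithm applied to the coefficients of a nontrivial relation. *)
Lemma Zspan_reduce N r (b : 'I_r -> V) (z : 'I_r -> int) i :
  (\sum_k `|z k| <= N)%N -> z i != 0 -> \sum_k b k *~ z k = 0 ->
  exists b' : 'I_r.-1 -> V, (forall k, Zspan b (b' k)) /\ (forall k, Zspan b' (b k)).
Proof.
elim: N b z i => [|N ih] b z i.
  by rewrite leqn0 sum_nat_eq0 => /forallP/(_ i)/=; rewrite absz_eq0 => ->.
move=> zN zi rel.
have [[j [ji zj]]|alone] := pselect (exists j, j != i /\ z j != 0); last first.
  have bi : b i = 0.
    move: rel; rewrite (bigD1 i) //= big1 ?addr0 => [|k ki].
      by move/eqP; rewrite -scaler_int scaler_eq0 intr_eq0 (negbTE zi) => /eqP.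
    case: (eqVneq (z k) 0) => [->//|zk]; case: alone; by exists k.
  case: r b z i {ih zN zi rel alone} bi => [|r] b z i bi; first by case: i {bi}.
  exists (fun k => b (lift i k)); split=> k; first exact: Zspan_gen.
  have [->|ki] := eqVneq k i; first by rewrite bi; exact: Zspan0.
  have [k' ->] : exists k', k = lift i k'.
    by case: (unliftP i k) => [k' ->|e]; [exists k'|rewrite e eqxx in ki].
  exact: (Zspan_gen (fun k => b (lift i k))).
wlog le_ij : i j ji zi zj / (`|z i| <= `|z j|)%N => [wl|].
  have [le|/ltnW le] := leqP `|z i| `|z j|; first exact: (wl i j).
  by apply: (wl j i) => //; rewrite eq_sym.
(* Replacing b_i by b_i + e b_j and z_j by z_j - e z_i keeps the relation and the span; the sign e
   makes |z_j| drop. *)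
have [e he] : exists e : int, (absz (z j - e * z i)%R < absz (z j))%N.
  exists (if (0 < z i) == (0 < z j) then 1 else -1).
  by move: zi zj le_ij; case: (ltrP 0 (z i)) => ?; case: (ltrP 0 (z j)) => ?; rewrite /= ?mul1r ?mulN1r; lia.
pose b2 k := if k == i then b i + b j *~ e else b k.
pose z2 k := if k == j then z j - e * z i else z k.
have b2i : b2 i = b i + b j *~ e by rewrite /b2 eqxx.
have b2n k : k != i -> b2 k = b k by rewrite /b2 => /negbTE ->.
have z2j : z2 j = z j - e * z i by rewrite /z2 eqxx.
have z2n k : k != j -> z2 k = z k by rewrite /z2 => /negbTE ->.
have ij : i != j by rewrite eq_sym.
have [|||b' [b'1 b'2]] := ih b2 z2 i.
- rewrite -ltnS; apply: leq_trans zN; rewrite (bigD1 j) //= [X in (_ < X)%N](bigD1 j) //= z2j.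
  by under eq_bigr => k kj do rewrite z2n //; rewrite ltn_add2r.
- by rewrite z2n.
- rewrite -[RHS]rel (bigD1 j) // (bigD1 i) //= [RHS](bigD1 j) // [in RHS](bigD1 i) //=.
  rewrite z2j z2n // b2i b2n // !addrA; congr (_ + _); last first.
    by apply: eq_bigr => k /andP[kj ki]; rewrite z2n // b2n.
  by rewrite mulrzBr mulrzDl -mulrzA addrACA addNr addr0.
exists b'; split=> k.
  apply: Zspan_trans (b'1 k) => l; have [->|li] := eqVneq l i; last by rewrite b2n //; exact: Zspan_gen.
  by rewrite b2i; apply: ZspanD; [|apply: ZspanM]; exact: Zspan_gen.
apply: (Zspan_trans b'2); have [->|ki] := eqVneq k i; last by rewrite -b2n //; exact: Zspan_gen.
have -> : b i = b2 i + b2 j *~ (- e) by rewrite b2i b2n // mulrNz addrK.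
by apply: ZspanD; [|apply: ZspanM]; exact: Zspan_gen.
Qed.

(** As long as a nontrivial relation exists, [Zspan_reduce] spares one generator; what remains is
    independent over the integers. *)
Lemma Zspan_basis r (b : 'I_r -> V) : exists r' (b' : 'I_r' -> V),
  [/\ forall i, Zspan b (b' i), forall i, Zspan b' (b i) &
      forall z, \sum_i b' i *~ z i = 0 -> forall i, z i = 0].
Proof.
elim: r b => [|r ih] b; first by exists 0%N, b; split=> [[]|[]|z _ []].
have [[z [i [zi rel]]]|indep] := pselect (exists z i, z i != 0 /\ \sum_k b k *~ z k = 0).
  have [b1 [bb1 b1b]] := Zspan_reduce (leqnn _) zi rel.
  have [r' [b' [b1b' b'b1 ind]]] := ih b1; exists r', b'; split=> // k.
    exact: Zspan_trans (b1b' k).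
  exact: Zspan_trans (b1b k).
exists r.+1, b; split=> [i|i|z rel i]; try exact: Zspan_gen.
by case: (eqVneq (z i) 0) => // zi; case: indep; exists z, i.
Qed.
End IntegralBasis.

Definition supported_on (G : groupType) (H : G -> Prop) (u : galg G) :=
  forall x, u@_x != 0 -> H x.

Section SupportedElements.
Variables (G : groupType) (H : G -> Prop).
Implicit Types u v : galg G.

Lemma supported_subsp : subsp (supported_on H).
Proof.
split=> [x|a u v Hu Hv x]; first by rewrite mcoeff0 eqxx.
rewrite mcoeffD mcoeffZ; have [->|/Hu //] := eqVneq u@_x 0.
by rewrite mulr0 add0r => /Hv.
Qed.

Lemma supported_gbase x : H x -> supported_on H (gbase x).
Proof. by move=> Hx y; rewrite mcoeffU; case: (eqVneq x y) => [<-|_] //; rewrite eqxx. Qed.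

Lemma supported_ind (P : galg G -> Prop) u : subsp P -> (forall x, H x -> P (gbase x)) ->
  supported_on H u -> P u.
Proof.
move=> sP Pb Hu; rewrite [u]monalgE big_seq; apply: (subsp_sum sP) => x.
by rewrite -mcoeff_neq0 malgUZ => /Hu Hx; apply: (subspZ sP); exact: Pb.
Qed.

Lemma supported_mul u v : subgrp H -> supported_on H u -> supported_on H v ->
  supported_on H (u * v).
Proof.
move=> sH Hu Hv; have sS := supported_subsp.
apply: (supported_ind (P := fun u => supported_on H (u * v))) Hu => [|x Hx].
  split=> [|a u1 u2 h1 h2]; first by rewrite mul0r; exact: subsp0 sS.
  by rewrite mulrDl -scalerAl; apply: (subspP sS).
apply: (supported_ind (P := fun v => supported_on H (gbase x * v))) Hv => [|y Hy].
  split=> [|a u1 u2 h1 h2]; first by rewrite mulr0; exact: subsp0 sS.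
  by rewrite mulrDr -scalerAr; apply: (subspP sS).
by rewrite -gbaseM; apply: supported_gbase; apply: subgrpM.
Qed.
End SupportedElements.

Lemma supported_sub (G : groupType) (H K : G -> Prop) (u : galg G) :
  (forall x, H x -> K x) -> supported_on H u -> supported_on K u.
Proof. by move=> HK Hu x /Hu/HK. Qed.

(** * Jennings' filtration of a rational group algebra *)

Section DimensionFiltration.
Variables (G : groupType) (F : nat -> G -> Prop).
Hypothesis nF : nseries F.
Implicit Types (u v : galg G) (H M : G -> Prop).

(* Jennings' filtration of Q[H]: a factor [x - 1] has weight [i] when x lies in F_i. *)
Inductive Delta H : nat -> galg G -> Prop :=
| Delta_one : Delta H 0 1
| Delta_step j i u x : Delta H j u -> H x -> F i x -> Delta H (j + i)%N (u * (gbase x - 1))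
| Delta_zero j : Delta H j 0
| Delta_lin j a u v : Delta H j u -> Delta H j v -> Delta H j (a *: u + v)
| Delta_weak j j' u : (j' <= j)%N -> Delta H j u -> Delta H j' u.

Lemma Delta_subsp H j : subsp (Delta H j).
Proof. by split; [exact: Delta_zero|exact: Delta_lin]. Qed.

Lemma Delta_base H i x : H x -> F i x -> Delta H i (gbase x - 1).
Proof. by move=> Hx Fx; rewrite -[gbase x - 1]mul1r -[i]add0n; apply: Delta_step => //; exact: Delta_one. Qed.

Lemma Delta0_base H x : H x -> Delta H 0 (gbase x).
Proof.
move=> Hx; rewrite -[gbase x](subrK 1); apply: (subspD (Delta_subsp H 0)); last exact: Delta_one.
by apply: (Delta_weak (j := 1)) => //; apply: Delta_base => //; exact: (ns_top nF).
Qed.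

Lemma Delta_mul H i j u v : Delta H i u -> Delta H j v -> Delta H (i + j)%N (u * v).
Proof.
move=> Du; elim=> [|j' k v' x _ ih Hx Fx|j'|j' a v1 v2 _ ih1 _ ih2|j1 j2 v' le _ ih].
- by rewrite addn0 mulr1.
- by rewrite addnA mulrA; apply: Delta_step.
- by rewrite mulr0; exact: Delta_zero.
- by rewrite mulrDr -scalerAr; apply: Delta_lin.
- by apply: Delta_weak ih; rewrite leq_add2l.
Qed.

Lemma Delta_supported H j u : subgrp H -> Delta H j u -> supported_on H u.
Proof.
move=> sH; have sS := supported_subsp H; have S1 : supported_on H 1.
  by apply: supported_gbase; exact: subgrp1.
elim=> {j u} [//|j i u x _ ih Hx _|_|j a u v _ hu _ hv|//].
- by apply: supported_mul => //; apply: (subspB sS) => //; exact: supported_gbase.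
- exact: subsp0 sS.
- exact: subspP sS _ _ _ hu hv.
Qed.

Lemma Delta_incl H M j u : (forall x, H x -> M x) -> Delta H j u -> Delta M j u.
Proof.
move=> HM; elim=> {j u} [|j i u x _ ih Hx Fx|j|j a u v _ hu _ hv|j1 j2 u le _ ih].
- exact: Delta_one.
- by apply: Delta_step => //; exact: HM.
- exact: Delta_zero.
- exact: Delta_lin.
- exact: Delta_weak ih.
Qed.

Definition cj (t : G) u := gbase t^-1%g * u * gbase t.

Lemma cjB t x : cj t (gbase x) = gbase (x ^ t)%g.
Proof. by rewrite /cj -!gbaseM /monoid.conjg mulgA. Qed.
Lemma cj_lin t a u v : cj t (a *: u + v) = a *: cj t u + cj t v.
Proof. by rewrite /cj mulrDr mulrDl -scalerAr -scalerAl. Qed.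
Lemma cj0 t : cj t 0 = 0. Proof. by rewrite /cj mulr0 mul0r. Qed.
Lemma cj1 t : cj t 1 = 1. Proof. by rewrite -gbase1 cjB conj1g. Qed.
Lemma cjM t u v : cj t (u * v) = cj t u * cj t v.
Proof.
rewrite /cj !mulrA; congr (_ * _ * _).
by rewrite -[RHS]mulrA -gbaseM mulgV gbase1 mulr1.
Qed.

Lemma Delta_conj M j t u : (forall x, M x -> M (x ^ t)%g) -> Delta M j u -> Delta M j (cj t u).
Proof.
move=> nM; elim=> {j u} [|j i u x _ ih Hx Fx|j|j a u v _ hu _ hv|j1 j2 u le _ ih].
- by rewrite cj1; exact: Delta_one.
- rewrite cjM; apply: (@Delta_mul M j i); first exact: ih.
  rewrite -scaleN1r addrC cj_lin cj1 cjB scaleN1r addrC; apply: Delta_base; first exact: nM.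
  exact: (ns_normal nF).
- by rewrite cj0; exact: Delta_zero.
- by rewrite cj_lin; exact: Delta_lin.
- exact: Delta_weak ih.
Qed.

(** Since x^t = x [x, t] and [x, t] has the weight of x plus w, replacing one factor by its
    conjugate costs a term whose weight is larger by w. *)
Lemma Delta_conj_sub M w j t u : subgrp M -> (forall x, M x -> M (x ^ t)%g) -> F w t ->
  Delta M j u -> Delta M (j + w)%N (cj t u - u).
Proof.
move=> sM nM Ft.
elim=> {j u} [|j i u x Du ih Hx Fx|j|j a u v _ hu _ hv|j1 j2 u le _ ih].
- by rewrite cj1 subrr; exact: Delta_zero.
- have -> : cj t (u * (gbase x - 1)) - u * (gbase x - 1) =
     (cj t u - u) * (gbase (x ^ t)%g - 1) + u * (gbase x * (gbase [~ x, t]%g - 1)).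
    have cjx : cj t (gbase x - 1) = gbase (x ^ t)%g - 1.
      by rewrite -scaleN1r addrC cj_lin cj1 cjB scaleN1r addrC.
    have e1 : gbase x * gbase [~ x, t]%g = gbase (x ^ t)%g by rewrite -gbaseM commgEl mulVKg.
    rewrite cjM cjx mulrBl -addrA; congr (_ + _).
    by rewrite [gbase x * _]mulrBr mulr1 e1 -!mulrN -mulrDr !opprB addrA subrK.
  apply: (subspD (Delta_subsp _ _)).
    rewrite addnAC; apply: Delta_mul => //; apply: Delta_base; first exact: nM.
    exact: (ns_normal nF).
  rewrite -addnA; apply: Delta_mul => //; rewrite -[(i + w)%N]add0n.
  apply: Delta_mul; first exact: Delta0_base.
  apply: Delta_base; last exact: (ns_comm nF).
  by rewrite commgEl; apply: (subgrpM sM); [exact: subgrpV|exact: nM].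
- by rewrite cj0 subr0; exact: Delta_zero.
- by rewrite cj_lin opprD addrACA -scalerBr; apply: Delta_lin.
- by apply: Delta_weak ih; rewrite leq_add2r.
Qed.

(** * One step H = <t> M, with t of infinite order modulo M *)

Section CyclicExtension.
Variables (H M : G -> Prop) (t : G) (w : nat).
Hypotheses (sH : subgrp H) (sM : subgrp M) (MH : forall x, M x -> H x) (Ht : H t).
Hypothesis nM : forall x y, M x -> H y -> M (x ^ y)%g.
Hypothesis cover : forall y, H y -> exists e, M (gz t (- e) * y)%g.
Hypothesis free : forall e, M (gz t e) -> e = 0.
Hypothesis HF : forall y, H y -> F w y.
Hypothesis HFM : forall y, H y -> F w.+1 y -> M y.

(* Moments along <t>: on u = sum_e t^e u_e, u_e in Q[M], the l-th moment is sum_e e^l u_e.  It lowers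
   the filtration by [w * l], and the 0-th moment is a retraction of Q[H] onto Q[M]. *)
Lemma Delta_cyclic j u : Delta H j u -> supported_on M u -> Delta M j u.
Proof.
(* [lam y] is the exponent e for which y lies in t^e M. *)
have [lam lamP] : {lam : G -> int & forall y, H y -> M (gz t (- lam y) * y)%g}.
  apply: (@choice G int (fun y e => H y -> M (gz t (- e) * y)%g)) => y.
  have [/cover[e Me]|nHy] := pselect (H y); first by exists e.
  by exists 0 => /nHy.
have lamE y e : H y -> M (gz t (- e) * y)%g -> lam y = e.
  move=> Hy Me; apply/eqP; rewrite -subr_eq0; apply/eqP/free.
  have := subgrpM sM Me (subgrpV sM (lamP y Hy)).
  by rewrite invgM mulgA mulgK -!gzN -gzD opprK addrC.
have HX y e : H y -> H (y * gz t e)%g by move=> Hy; apply: subgrpM => //; exact: subgrp_gz.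
have red_conj y e : (gz t (- (lam y + e)) * (y * gz t e))%g = ((gz t (- lam y) * y) ^ gz t e)%g.
  by rewrite opprD addrC gzD !gzN /monoid.conjg !mulgA.
have lamM y e : H y -> lam (y * gz t e)%g = lam y + e.
  move=> Hy; apply: lamE; first exact: HX.
  by rewrite red_conj; apply: nM; [exact: lamP|exact: subgrp_gz].
have lamR y x : H y -> M x -> lam (y * x)%g = lam y.
  move=> Hy Mx; apply: lamE; first by apply: subgrpM => //; exact: MH.
  by rewrite mulgA; apply: subgrpM => //; exact: lamP.
pose mu (l : nat) : galg G -> galg G :=
  lin (fun y => (lam y)%:~R ^+ l *: gbase (gz t (- lam y) * y)%g).
have mu_lin l a u1 u2 : mu l (a *: u1 + u2) = a *: mu l u1 + mu l u2 by exact: lin_is_linear.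
have mu0 l : mu l 0 = 0 by exact: linear0.
have muB l x : mu l (gbase x) = (lam x)%:~R ^+ l *: gbase (gz t (- lam x) * x)%g by exact: linU.
have mu_gz l e v : supported_on H v -> mu l (v * gbase (gz t e)) =
    \sum_(i < l.+1) ('C(l, i)%:R * e%:~R ^+ (l - i)) *: cj (gz t e) (mu i v).
  apply: (supported_ind (P := fun v => mu l (v * gbase (gz t e)) =
    \sum_(i < l.+1) ('C(l, i)%:R * e%:~R ^+ (l - i)) *: cj (gz t e) (mu i v))) => [|y Hy].
    split=> [|a u1 u2 h1 h2].
      by rewrite mul0r mu0 big1 // => i _; rewrite mu0 cj0 scaler0.
    rewrite mulrDl -scalerAl mu_lin h1 h2 scaler_sumr -big_split; apply: eq_bigr => i _.
    by rewrite mu_lin cj_lin scalerDr !scalerA mulrC.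
  rewrite -gbaseM muB lamM // red_conj.
  under eq_bigr => i _ do rewrite muB -[_ *: gbase _]addr0 cj_lin cj0 addr0 cjB scalerA.
  rewrite -scaler_suml; congr (_ *: _); rewrite intrD addrC exprDn; apply: eq_bigr => i _.
  by rewrite -mulr_natl mulrA.
have mu_M l x v : M x -> supported_on H v -> mu l (v * gbase x) = mu l v * gbase x.
  move=> Mx; apply: (supported_ind (P := fun v => mu l (v * gbase x) = mu l v * gbase x)) => [|y Hy].
    split=> [|a u1 u2 h1 h2]; first by rewrite mul0r mu0 mul0r.
    by rewrite mulrDl -scalerAl mu_lin h1 h2 mu_lin mulrDl -scalerAl.
  by rewrite -gbaseM !muB lamR // -scalerAl -gbaseM mulgA.
have main k v : Delta H k v -> forall l, Delta M (k - w * l) (mu l v).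
  elim=> {k v} [|k i v x Dv ih Hx Fx|k|k a u1 u2 _ h1 _ h2|k1 k2 v le _ ih] l.
  - rewrite -gbase1 muB sub0n; apply: (subspZ (Delta_subsp M 0)).
    by apply: Delta0_base; apply: lamP; exact: subgrp1.
  - have Hv := Delta_supported sH Dv.
    have mu_sub v1 v2 : mu l (v1 - v2) = mu l v1 - mu l v2 by exact: linearB.
    have conjM e y : M y -> M (y ^ gz t e)%g by move=> My; apply: nM => //; exact: subgrp_gz.
    (* A factor of weight above w already comes from M. Otherwise it is t^e m with m in M, and m
       still has weight at least w because all of H has. *)
    have [iw|wi] := leqP i w; last first.
      have Mx : M x by apply: HFM => //; exact: ns_le nF wi Fx.
      rewrite mulrBr mulr1 mu_sub mu_M // -[X in _ - X]mulr1 -mulrBr.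
      by apply: (Delta_weak (j := (k - w * l + i)%N)); [lia|apply: Delta_mul => //; exact: Delta_base].
    pose e := lam x; have Mm := lamP x Hx; set m := (gz t (- lam x) * x)%g in Mm.
    have ex : x = (gz t e * m)%g by rewrite /m gzN mulVKg.
    have -> : v * (gbase x - 1) = v * gbase (gz t e) * (gbase m - 1) + v * (gbase (gz t e) - 1).
      by rewrite ex gbaseM !mulrBr !mulr1 mulrA addrA subrK.
    rewrite -[_ + _]scale1r scalerDr mu_lin !scale1r; apply: (subspD (Delta_subsp _ _)).
      rewrite mulrBr mulr1 mu_sub (mu_M l m) //; last first.
        by apply: supported_mul => //; exact: (supported_gbase (subgrp_gz e sH Ht)).
      rewrite -[X in _ - X]mulr1 -mulrBr.
      apply: (Delta_weak (j := (k - w * l + w)%N)); first lia.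
      apply: Delta_mul; last by apply: Delta_base => //; apply: HF; exact: MH.
      rewrite mu_gz //; apply: (subsp_sum (Delta_subsp _ _)) => q _.
      apply: (subspZ (Delta_subsp _ _)); apply: Delta_conj; first exact: conjM.
      apply: (Delta_weak _ (ih q)); have := ltn_ord q; rewrite ltnS => ql.
      by rewrite leq_sub2l // leq_mul2l ql orbT.
    (* In the binomial expansion of the moment of v t^e, the terms q < l are lower moments, which
       lose at most w (l - 1). The term q = l is a conjugate of the moment of v, and subtracting
       that moment gains w. *)
    rewrite mulrBr mulr1 mu_sub mu_gz // big_ord_recr /= subnn expr0 binn mulr1 scale1r -addrA.
    apply: (subspD (Delta_subsp _ _)).
      apply: (subsp_sum (Delta_subsp _ _)) => q _; apply: (subspZ (Delta_subsp _ _)).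
      apply: Delta_conj; first exact: conjM.
      apply: (Delta_weak _ (ih q)); have := ltn_ord q; nia.
    apply: (Delta_weak (j := (k - w * l + w)%N)); first lia.
    apply: Delta_conj_sub => //; first exact: conjM.
    by apply: HF; exact: subgrp_gz.
  - by rewrite mu0; exact: Delta_zero.
  - by rewrite mu_lin; exact: Delta_lin.
  - by apply: (Delta_weak _ (ih l)); rewrite leq_sub2r.
move=> /main/(_ 0%N); rewrite muln0 subn0 => Dmu Mu.
suff <- : mu 0%N u = u by [].
apply: (supported_ind (P := fun u => mu 0%N u = u)) Mu => [|y My].
  by split=> [|a u1 u2 h1 h2]; rewrite ?mu0 // mu_lin h1 h2.
have lam0 : lam y = 0 by apply: lamE; [exact: MH|rewrite oppr0 mul1g].
by rewrite muB lam0 expr0 scale1r oppr0 mul1g.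
Qed.
End CyclicExtension.
End DimensionFiltration.

Lemma morph_gz (G : groupType) (V : zmodType) (P : G -> Prop) (phi : G -> V) x z :
  subgrp P -> (forall y y', P y -> P y' -> phi (y * y')%g = phi y + phi y') -> P x ->
  phi (gz x z) = phi x *~ z.
Proof.
move=> sP phiM Px; have phi1 : phi 1%g = 0.
  by apply: (@addrI _ (phi 1%g)); rewrite -phiM ?mulg1 ?addr0 //; exact: subgrp1.
have phiV y : P y -> phi y^-1%g = - phi y.
  by move=> Py; apply: (@addrI _ (phi y)); rewrite -phiM ?mulgV ?subrr //; exact: subgrpV.
have pos (n : nat) : phi (x ^+ n)%g = phi x *~ n.
  elim: n => [|n ih]; first by rewrite expg0 mulr0z.
  by rewrite expgSr phiM // ?ih -?pmulrn ?mulrSr //; exact: (subgrp_gz n sP Px).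
case: z => n; first exact: pos.
by rewrite NegzE mulrNz -pos -phiV //; exact: (subgrp_gz n.+1 sP Px).
Qed.

Section Layer.
Variables (G : groupType) (F : nat -> G -> Prop) (w : nat).
Hypotheses (nF : nseries F) (w0 : (0 < w)%N).

Let sF := ns_grp nF w.
Let sF1 := ns_grp nF w.+1.

Let comm1 : commutators_in (F w) (F w.+1).
Proof.
move=> x y Fx Fy; apply: (ns_le nF _ (ns_comm nF Fx Fy)).
by rewrite -[w.+1]addn1 leq_add2l.
Qed.

Let good (chi : G -> rat) := hom_on (F w) chi /\ forall x, F w.+1 x -> chi x = 0.

(* The image of [x] in the Q-vector space dual to Hom(F_w / F_(w+1), Q). *)
Let v (x : G) : (G -> rat) -> rat^o := fun chi => if pdec (good chi) then chi x else 0.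

Let vM x y : F w x -> F w y -> v (x * y)%g = v x + v y.
Proof.
move=> Fx Fy; apply/funext => chi; rewrite /v addrfctE.
by case: pdecP => [[+ _]|_]; [apply|rewrite addr0].
Qed.

Let v1 x : F w.+1 x -> v x = 0.
Proof. by move=> Fx; apply/funext => chi; rewrite /v; case: pdecP => [[_ +]|_]; [apply|]. Qed.

Let v_eq0 x : F w x -> v x = 0 -> F w.+1 x.
Proof.
move=> Fx vx; have [//|nFx] := pselect (F w.+1 x).
have [|chi [chiM chi0 chi1]] := separating_hom sF sF1 (ns_decr nF (i := w)) comm1 Fx.
  by move=> m m0 /(ns_isol nF m0).
have := congr1 (fun phi => phi chi) vx; rewrite /v; case: pdecP => [_|[]//].
by rewrite chi1 => /eqP; rewrite oner_eq0.
Qed.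

Let vgz x z : F w x -> v (gz x z) = v x *~ z.
Proof. exact: (morph_gz z sF vM). Qed.

(** [Delta] is defined over arbitrary sets for this purpose: membership involves finitely many
    factors, so a single layer F_w/F_(w+1) can be replaced by a finitely generated subgroup, which
    has a finite basis. *)
Lemma Delta_finite j u : Delta F (F w) j u ->
  exists s : seq G, (forall x, x \in s -> F w x) /\ Delta F (fun x => x \in s) j u.
Proof.
elim=> {j u} [|j i u x _ [s [sF' Ds]] Hx Fx|j|j a u u' _ [s [ss Ds]] _ [s' [ss' Ds']]|j1 j2 u le _ [s [ss Ds]]].
- by exists [::]; split=> //; exact: Delta_one.
- exists (x :: s); split=> [y|]; first by rewrite inE => /predU1P[->|/sF'].
  apply: Delta_step Fx; last by rewrite inE eqxx.
  by apply: Delta_incl Ds => y; rewrite inE orbC => ->.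
- by exists [::]; split=> //; exact: Delta_zero.
- exists (s ++ s'); split=> [y|]; first by rewrite mem_cat => /orP[/ss|/ss'].
  by apply: Delta_lin; [apply: Delta_incl Ds => y|apply: Delta_incl Ds' => y];
    rewrite mem_cat => ->; rewrite ?orbT.
- by exists s; split=> //; exact: Delta_weak Ds.
Qed.

Lemma Delta_layer j u : Delta F (F w) j u -> supported_on (F w.+1) u -> Delta F (F w.+1) j u.
Proof.
move=> /Delta_finite[s [sFw Ds]] Fu.
pose b (i : 'I_(size s)) := v (tnth (in_tuple s) i).
have [r [b' [bb' b'b ind]]] := Zspan_basis b.
have lift x : Zspan b x -> exists y, F w y /\ v y = x.
  move=> [z ->]; apply: (big_ind (fun x => exists y, F w y /\ v y = x)).
  - by exists 1%g; split; [exact: subgrp1 sF|by apply: v1; exact: subgrp1 sF1].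
  - move=> _ _ [y [Fy <-]] [y' [Fy' <-]].
    by exists (y * y')%g; split; [exact: subgrpM|exact: vM].
  move=> i _; have Fi : F w (tnth (in_tuple s) i) by apply/sFw/mem_tnth.
  by exists (gz (tnth (in_tuple s) i) (z i)); split; [exact: subgrp_gz|exact: vgz].
have [t tP] : {t : 'I_r -> G & forall i, F w (t i) /\ v (t i) = b' i}.
  by apply: (@choice _ _ (fun i y => F w y /\ v y = b' i)) => i; exact: lift.
(* H_k is the preimage in F_w of the span of the first k basis vectors: H_0 is F_(w+1), H_r contains
   s, and each H_(k+1) is a cyclic extension of H_k, so the basis vectors are removed one by one. *)
pose H (k : nat) y := F w y /\ exists z : 'I_r -> int, v y = \sum_(i : 'I_r | (i < k)%N) b' i *~ z i.
have sH k : subgrp (H k).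
  split.
  - by split; [exact: subgrp1|exists (fun=> 0); rewrite big1 // v1 //; exact: subgrp1].
  - move=> x y [Fx [z ez]] [Fy [z' ez']]; split; first exact: subgrpM.
    exists (fun i => z i + z' i); rewrite vM // ez ez' -big_split.
    by apply: eq_bigr => i _; rewrite mulrzDr.
  - move=> x [Fx [z ez]]; split; first exact: subgrpV.
    exists (fun i => - z i); rewrite -[x]gz1 -gzN vgz // mulrNz mulr1z ez -sumrN.
    by apply: eq_bigr => i _; rewrite mulrNz.
have F1H k x : F w.+1 x -> H k x.
  by move=> Fx; split; [exact: ns_decr Fx|exists (fun=> 0); rewrite big1 // v1].
have descend k : (k <= r)%N -> Delta F (H k) j u -> Delta F (F w.+1) j u.
  elim: k => [|k ih] kr.
    apply: Delta_incl => x [Fx [z]]; rewrite big_pred0 => [|i]; last by rewrite ltn0.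
    exact: v_eq0.
  pose K := Ordinal kr; have [FK vK] := tP K.
  have sumS z : \sum_(i : 'I_r | (i < k.+1)%N) b' i *~ z i =
      b' K *~ z K + \sum_(i : 'I_r | (i < k)%N) b' i *~ z i.
    rewrite (bigD1 K) /=; last exact: ltnSn.
    by congr (_ + _); apply: eq_bigl => i; rewrite ltnS ltn_neqAle andbC -val_eqE.
  move=> Dk; apply: (ih (ltnW kr)); apply: (Delta_cyclic (t := t K) (w := w) nF (sH k.+1) (sH k)) Dk _.
  - move=> x [Fx [z ez]]; split=> //.
    exists (fun i : 'I_r => if (i < k)%N then z i else 0); rewrite sumS /= ltnn mulr0z add0r ez.
    by apply: eq_bigr => i ->.
  - split=> //; exists (fun i : 'I_r => (i == K)%:Z); rewrite sumS eqxx mulr1z big1 ?addr0 // => i ik.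
    by case: eqP ik => [->|//]; rewrite ltnn.
  - move=> x y [Fx [z ez]] [Fy _]; have e : (x ^ y = x * [~ x, y])%g by rewrite commgEl mulVKg.
    split; first by rewrite e; apply: subgrpM => //; apply: (ns_decr nF); exact: comm1.
    exists z; rewrite e vM //; last by apply: (ns_decr nF); exact: comm1.
    by rewrite (v1 (comm1 Fx Fy)) addr0.
  - move=> y [Fy [z ez]]; exists (z K); split.
      by apply: subgrpM => //; exact: subgrp_gz.
    exists z; rewrite vM //; last exact: subgrp_gz.
    by rewrite vgz // ez sumS vK mulrNz addKr.
  - move=> e [_ [z ez]].
    have := ind (fun i : 'I_r => if i == K then - e else if (i < k)%N then z i else 0).
    move=> /(_ _ K); rewrite eqxx => h; apply/eqP; rewrite -oppr_eq0; apply/eqP/h.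
    rewrite (bigD1 K) //= eqxx (bigID (fun i : 'I_r => (i < k)%N)) /=.
    rewrite [X in _ + (_ + X)]big1 => [|i /andP[/negbTE-> /negbTE->] //]; rewrite addr0.
    move: ez; rewrite vgz // vK mulrNz => ->; apply/eqP; rewrite addrC subr_eq0; apply/eqP.
    apply: eq_big => i; first by case: eqP => [->|//]; rewrite ltnn.
    by move=> /andP[/negbTE -> ->].
  - by move=> y [].
  - by move=> y _ /(F1H k).
  - by apply: supported_sub Fu => x; exact: F1H.
apply: (descend r (leqnn r)); apply: Delta_incl Ds => x xs; split; first exact: sFw.
have [i ->] : exists i, x = tnth (in_tuple s) i by apply/tnthP.
have [z ez] := b'b i; exists z; rewrite -/(b i) ez.
by apply: eq_bigl => k; rewrite ltn_ord.
Qed.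
End Layer.

(* Jennings' theorem on rational dimension subgroups. *)
Theorem Delta_dimension (G : groupType) (F : nat -> G -> Prop) k a : nseries F -> (0 < k)%N ->
  Delta F (fun=> True) k.+1 (gbase a - 1) -> F k a -> F k.+1 a.
Proof.
move=> nF k0 D Fa; have Fk_sub w : (w <= k)%N -> supported_on (F w) (gbase a - 1).
  move=> wk; apply: (subspB (supported_subsp _)); apply: supported_gbase.
    exact: ns_le nF wk Fa.
  exact: subgrp1 (ns_grp nF w).
(* The element a - 1 is supported on F_k, so its factors can be pushed down through the layers above
   F_k until they all come from F_k. *)
have down w : (0 < w <= k)%N -> Delta F (F w) k.+1 (gbase a - 1).
  elim: w => // -[_ _|w ih /andP[_ wk]].
    by apply: Delta_incl D => x _; exact: ns_top.
  by apply: Delta_layer => //; [apply: ih; exact: ltnW|exact: Fk_sub].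
have {down}Dk := down k; rewrite k0 leqnn in Dk; have {Dk}D := Dk isT.
have [//|nFa] := pselect (F k.+1 a).
have [|||chi [chiM chi0 chia]] := separating_hom (ns_grp nF k) (ns_grp nF k.+1) _ _ Fa.
- exact: ns_decr nF k.
- move=> x y Fx Fy; apply: (ns_le nF _ (ns_comm nF Fx Fy)).
  by rewrite -[k.+1]addn1 leq_add2l.
- by move=> m m0 /(ns_isol nF m0).
(* L kills products u (x - 1) of total weight above k over F_k, as its value there is aug(u) chi(x):
   either x lies in F_(k+1) and chi(x) = 0, or u has positive weight and augmentation 0. But L(a -
   1) = chi(a) = 1. *)
pose L : galg G -> rat^o := lin (fun x => chi x : rat^o).
have LB x : L (gbase x) = chi x by exact: linU.
have L_lin c u v : L (c *: u + v) = c *: L u + L v by exact: lin_is_linear.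
have L1 : L 1 = 0 by rewrite -gbase1 LB; apply: chi0; exact: subgrp1 (ns_grp nF k.+1).
have L_mul u x : supported_on (F k) u -> F k x -> L (u * (gbase x - 1)) = aug u * chi x :> rat.
  move=> Fu Fx; apply: (supported_ind (P := fun u => L (u * (gbase x - 1)) = aug u * chi x :> rat)) Fu.
    split=> [|c u1 u2 h1 h2]; first by rewrite mul0r /L !linear0 mul0r.
    by rewrite mulrDl -scalerAl L_lin h1 h2 linearP /= !rat_scaleE mulrDl mulrA.
  move=> y Fy; rewrite mulrBr mulr1 -gbaseM /L linearB /= -/L !LB augB mul1r chiM //.
  by rewrite addrC addKr.
have aug0 i v : Delta F (F k) i v -> (0 < i)%N -> aug v = 0.
  elim=> {i v} [//|j i u x _ _ _ _ _|j _|j c u v _ h1 _ h2 j0|j1 j2 v le _ h j2gt].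
  - by rewrite augM linearB /= augB aug1 subrr mulr0.
  - exact: linear0.
  - by rewrite linearP /= h1 // h2 // addr0 rat_scaleE mulr0.
  - by apply: h; exact: leq_trans le.
have kill i v : Delta F (F k) i v -> (k < i)%N -> L v = 0.
  elim=> {i v} [//|j i u x Du _ Fkx Fix ki|j _|j c u v _ h1 _ h2 j0|j1 j2 v le _ h j2gt].
  - rewrite L_mul //; last exact: Delta_supported (ns_grp nF k) Du.
    have [ki'|ik] := ltnP k i; first by rewrite chi0 ?mulr0 //; exact: ns_le nF ki' Fix.
    rewrite (aug0 _ _ Du) ?mul0r //; lia.
  - exact: linear0.
  - by rewrite L_lin h1 // h2 // addr0 rat_scaleE mulr0.
  - by apply: h; exact: leq_trans le.
have := kill _ _ D (ltnSn k); rewrite /L linearB /= -/L LB L1 subr0 chia => /eqP.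
by rewrite oner_eq0.
Qed.

Lemma In_mem (T : eqType) (s : seq T) x : x \in s -> List.In x s.
Proof. by elim: s => //= y s ih; rewrite inE => /predU1P[->|/ih]; [left|right]. Qed.

(* Decides identities that hold in every abelian group, coefficient by coefficient. *)
Ltac malg_abelian := apply/malgP => ?; rewrite !(mcoeffD, mcoeffN); ring.

(** * Extending the tautological representation of A to B *)

Section TruncatedGroupAlgebra.
Variables (A B : group) (beta : B -> galg A) (k : nat).
Local Notation D := (Delta (rlcs A) (fun=> True)).

Let nA := rlcs_nseries A.

Lemma DeltaT0 u : D 0 u.
Proof.
have sD := Delta_subsp (rlcs A) (fun=> True) 0.
elim/galg_ind: u => [x||u v|a u]; [exact: (Delta0_base nA)|exact: Delta_zero|exact: subspD|].
exact: subspZ.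
Qed.

Lemma DeltaT_mulr j u v : D j u -> D j (u * v).
Proof. by move=> Du; rewrite -[j]addn0; apply: (Delta_mul Du); exact: DeltaT0. Qed.

Lemma DeltaT_mull j u v : D j v -> D j (u * v).
Proof. by move=> Dv; rewrite -[j]add0n; apply: (Delta_mul _ Dv); exact: DeltaT0. Qed.

Hypothesis beta_mul : forall x y, D k (beta x * beta y - beta (x * y)%g).
Hypothesis beta_1 : D k (beta 1%g - 1).
Hypothesis beta_aug : forall x, D 1 (beta x - 1).

Let sD j : subsp (D j). Proof. exact: Delta_subsp. Qed.

(** From zy ([y, z] - 1) = (y - 1)(z - 1) - (z - 1)(y - 1), each commutator doubles the weight. The
    minimum with k is there because beta is multiplicative modulo Delta_k only. *)
Lemma derived_Delta j x : derived B j x -> D (minn k (2 ^ j)) (beta x - 1).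
Proof.
elim: j x => [|j ih] x.
  by move=> _; apply: Delta_weak (beta_aug x); rewrite expn0 geq_minr.
set e := minn k (2 ^ j.+1).
have De u : D k u -> D e u by apply: Delta_weak; exact: geq_minl.
have inv y : D k (beta y^-1%g * beta y - 1).
  rewrite -[_ * _](subrK (beta 1%g)) -addrA; apply: (subspD (sD k)) => //.
  by rewrite -(mulVg y); exact: beta_mul.
apply: (commsub_min (S := fun z => D e (beta z - 1))).
  split; first exact: De.
    move=> y z Dy Dz; rewrite -[beta (y * z)%g](subKr (beta y * beta z)).
    have -> : beta y * beta z - (beta y * beta z - beta (y * z)%g) - 1 =
        ((beta y - 1) * beta z + (beta z - 1)) - (beta y * beta z - beta (y * z)%g).
      by rewrite mulrBl mul1r; malg_abelian.
    apply: (subspB (sD e)); last exact/De/beta_mul.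
    by apply: (subspD (sD e)) => //; exact: DeltaT_mulr.
  move=> y Dy; have -> : beta y^-1%g - 1 = (beta y^-1%g * beta y - 1) - beta y^-1%g * (beta y - 1).
    by rewrite mulrBr mulr1; malg_abelian.
  by apply: (subspB (sD e)); [exact: De|exact: DeltaT_mull].
move=> y z /ih Dy /ih Dz; set c := [~ y, z]%g.
set u := beta (z * y)%g.
have Dv : D e (u * (beta c - 1)).
  have -> : u * (beta c - 1) = (u * beta c - beta (z * y * c)%g)
      - (beta y * beta z - beta (y * z)%g) + (beta z * beta y - u)
      + ((beta y - 1) * (beta z - 1) - (beta z - 1) * (beta y - 1)).
    by rewrite -commgC !mulrBl !mulrBr !mulr1 !mul1r; malg_abelian.
  have D2 u1 u2 : D (minn k (2 ^ j)) u1 -> D (minn k (2 ^ j)) u2 -> D e (u1 * u2).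
    move=> D1 D2; apply: Delta_weak (Delta_mul D1 D2).
    by rewrite /e expnS; lia.
  apply: (subspD (sD e)); last by apply: (subspB (sD e)); exact: D2.
  apply: (subspD (sD e)); last exact/De/beta_mul.
  by apply: (subspB (sD e)); exact/De/beta_mul.
have -> : beta c - 1 = beta (z * y)^-1%g * (u * (beta c - 1))
    - (beta (z * y)^-1%g * u - 1) * (beta c - 1).
  by set v := beta c - 1; rewrite mulrBl mul1r mulrA; malg_abelian.
by apply: (subspB (sD e)); [exact: DeltaT_mull|apply/DeltaT_mulr/De/inv].
Qed.
End TruncatedGroupAlgebra.

Section LiftRepresentation.
Variables (A B : group) (f : A -> B) (n : nat).
Hypotheses (n0 : (0 < n)%N) (fM : ishom f) (mono : H1_mono f) (epi : H2_mod_Phi_epi n.-1 f).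
Local Notation D := (Delta (rlcs A) (fun=> True)).

Let nA := rlcs_nseries A.
Let sD j : subsp (D j). Proof. exact: Delta_subsp. Qed.

(* The tautological representation of [A] in Q[A]/Delta_m, m = 2^n, extends to [B]: since elements of
   B^(n-1) act trivially modulo Delta_(m/2), each obstruction cocycle vanishes on Phi^(n-1)(B). *)
Lemma lift_representation k : (0 < k <= 2 ^ n)%N -> exists beta : B -> galg A,
  [/\ forall x y, D k (beta x * beta y - beta (x * y)%g), forall x, D 1 (beta x - 1) &
      forall a, D k (beta (f a) - gbase a)].
Proof.
case/andP; case: k => // k _; elim: k => [|k ih] km.
  exists (fun=> 1); split=> [x y|x|a]; first by rewrite mul1r subrr; exact: Delta_zero.
    by rewrite subrr; exact: Delta_zero.
  by rewrite -opprB; apply: (subspN (sD 1)); apply: Delta_base => //; exact: ns_top.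
have [beta [bM b1 bf]] := ih (ltnW km).
have b_1 : D k.+1 (beta 1%g - 1) by rewrite -(hom1 fM) -gbase1; exact: bf.
(* The corrected map is to be beta + h: c is the multiplicative defect that h must cancel modulo the
   next layer, and g the correction imposed on the image of A. *)
pose c x y := beta (x * y)%g - beta x * beta y.
pose g a := gbase a - beta (f a).
have Dc x y : D k.+1 (c x y) by rewrite /c -opprB; apply: (subspN (sD _)); exact: bM.
have Dg a : D k.+1 (g a) by rewrite /g -opprB; apply: (subspN (sD _)); exact: bf.
have D1 u v : D k.+1 u -> D 1 v -> D k.+2 (u * v).
  by move=> Du Dv; rewrite -[k.+2]addn1; exact: Delta_mul.
have D1' u v : D 1 u -> D k.+1 v -> D k.+2 (u * v).
  by move=> Du Dv; rewrite -[k.+2]add1n; exact: Delta_mul.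
have [|//|//||w wz sw|a b|h [hD hM hf]] := extend_cochain (c := c) (g := g) fM mono epi (sD k.+2) (sD k.+1).
- by move=> u; exact: Delta_weak.
- move=> x y z; have -> : c y z - c (x * y)%g z + c x (y * z)%g - c x y =
      c x y * (beta z - 1) - (beta x - 1) * c y z.
    by rewrite /c -mulgA !mulrBl !mulrBr !mulr1 !mul1r !mulrA; malg_abelian.
  by apply: (subspB (sD _)); [exact: D1|exact: D1'].
(* On a cycle the coboundary of beta - 1 sums to 0; adding it turns c(x, y) into -(beta x - 1)(beta
   y - 1). For x, y in B^(n-1) both factors have weight at least min(k + 1, 2^(n-1)), and k + 2 <=
   2^n makes the product small enough. *)
- have e : lin (fun p => beta p.1 - 1 + (beta p.2 - 1) - (beta (p.1 * p.2)%g - 1)) (mchain w) = 0.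
    by rewrite -(lin_bd2 (fun x => beta x - 1)) wz linear0.
  rewrite -[lin _ _]addr0 -e -lin_add lin_mchain big_seq; apply: (subsp_sum (sD _)) => p /In_mem pw.
  have [/(derived_Delta bM b_1 b1) d1 /(derived_Delta bM b_1 b1) d2] := sw _ pw.
  apply: (subspZ (sD _)); have -> : c p.2.1 p.2.2 + (beta p.2.1 - 1 + (beta p.2.2 - 1)
      - (beta (p.2.1 * p.2.2)%g - 1)) = - ((beta p.2.1 - 1) * (beta p.2.2 - 1)).
    by rewrite /c !mulrBl !mulrBr !mulr1 !mul1r; malg_abelian.
  apply: (subspN (sD _)); apply: Delta_weak (Delta_mul d1 d2).
  have : (2 ^ n = 2 * 2 ^ n.-1)%N by rewrite -expnS prednK.
  lia.
- have -> : c (f a) (f b) - (g a + g b - g (a * b)%g) =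
      (gbase a - 1) * g b + g a * (beta (f b) - 1).
    rewrite /c /g -(homM _ _ fM) gbaseM !mulrBl !mulrBr !mulr1 !mul1r; malg_abelian.
  apply: (subspD (sD _)); last exact: D1.
  by apply: D1' => //; apply: Delta_base => //; exact: ns_top nA a.
exists (fun x => beta x + h x); split=> [x y|x|a].
- have -> : (beta x + h x) * (beta y + h y) - (beta (x * y)%g + h (x * y)%g) =
      (h x + h y - h (x * y)%g - c x y) + (beta x - 1) * h y + h x * (beta y - 1) + h x * h y.
    by rewrite /c !mulrDl !mulrDr !mulNr !mulrN !mul1r !mulr1; malg_abelian.
  have hD1 z : D 1 (h z) by apply: Delta_weak (hD z).
  by do 3 (apply: (subspD (sD _)); last (by [exact: D1|exact: D1'])); exact: hM.
- rewrite addrAC; apply: (subspD (sD _)) => //; exact: Delta_weak (hD x).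
- by have := hf a; rewrite /g opprB addrA [h _ + _]addrC.
Qed.
End LiftRepresentation.

Lemma derived_rlcs (A B : group) (f : A -> B) n a : (0 < n)%N -> ishom f -> H1_mono f ->
  H2_mod_Phi_epi n.-1 f -> derived B n (f a) -> rlcs A (2 ^ n) a.
Proof.
move=> n0 fM mono epi Bfa; have nA := rlcs_nseries A.
have sD j := Delta_subsp (rlcs A) (fun=> True) j.
have [|beta [bM b1 bf]] := lift_representation (k := 2 ^ n) n0 fM mono epi.
  by rewrite leqnn expn_gt0.
have b_1 : Delta (rlcs A) (fun=> True) (2 ^ n) (beta 1%g - 1).
  by rewrite -(hom1 fM) -gbase1; exact: bf.
have Da : Delta (rlcs A) (fun=> True) (2 ^ n) (gbase a - 1).
  have := derived_Delta bM b_1 b1 Bfa; rewrite minnn => h.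
  have -> : gbase a - 1 = (beta (f a) - 1) - (beta (f a) - gbase a) by malg_abelian.
  exact: subspB.
suff main k : (0 < k <= 2 ^ n)%N -> rlcs A k a by apply: main; rewrite leqnn expn_gt0.
elim: k => // -[_ _|k ih /andP[_ km]]; first exact: ns_top nA a.
apply: (Delta_dimension nA) => //; last by apply: ih; exact: ltnW.
exact: Delta_weak Da.
Qed.

Lemma lin_gbase (G : groupType) (W : lmodType rat) (F : G -> W) x : lin F (gbase x) = F x.
Proof. exact: linU. Qed.

Lemma eq_linQ (X : choiceType) (F F' : X -> rat^o) (u : {malg rat[X]}) :
  (forall x, x \in msupp u -> F x = F' x) -> lin F u = lin F' u :> rat.
Proof. exact: eq_lin. Qed.

Lemma aug_sum (G : groupType) (I : Type) (r : seq I) (Q : pred I) (F : I -> galg G) :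
  aug (\sum_(i <- r | Q i) F i) = \sum_(i <- r | Q i) (aug (F i) : rat) :> rat.
Proof. exact: linear_sum. Qed.

(** A series from G down to 1 with torsion-free abelian quotients, exhibiting G as
    poly-(torsion-free abelian); normality of each term in the previous one is implied by
    [tf_comm]. *)
Record tfchain (G : groupType) (k : nat) (P : nat -> G -> Prop) : Prop := TFchain {
  tf_top : forall x, P 0 x;
  tf_bot : forall x, P k x -> x = 1%g;
  tf_grp : forall i, (i <= k)%N -> subgrp (P i);
  tf_decr : forall i, (i < k)%N -> forall x, P i.+1 x -> P i x;
  tf_comm : forall i, (i < k)%N -> commutators_in (P i) (P i.+1);
  tf_isol : forall i, (i < k)%N -> forall m x, (0 < m)%N -> P i x -> P i.+1 (x ^+ m)%g ->
    P i.+1 x }.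

(** * Group algebras of poly-(torsion-free abelian) groups *)

Section CosetSums.
Variables (G : groupType) (H : G -> Prop).
Hypothesis sH : subgrp H.
Implicit Types (u v : galg G) (q : G -> rat).

Definition coset_pairing q (g : G) : galg G -> rat^o :=
  lin (fun h => (if pdec (H (h * g^-1)%g) then q (h * g^-1)%g else 0) : rat^o).
HB.instance Definition _ q g := GRing.Linear.on (coset_pairing q g).

(** The coefficient of the right coset H g in the image of an element in Q[H\G]. *)
Definition coset_sum g := coset_pairing (fun=> 1) g.
Definition coset_null u := forall g, coset_sum g u = 0.

Lemma coset_pairing_right q g u x : coset_pairing q g (u * gbase x) = coset_pairing q (g * x^-1)%g u.
Proof. by rewrite /coset_pairing lin_right; apply: eq_lin => h _; rewrite invgM invgK mulgA. Qed.

Lemma coset_rep : exists rep : G -> G, (forall x, H (rep x * x^-1)%g) /\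
  forall x y, H (x * y^-1)%g <-> rep x = rep y.
Proof.
pose cl (x : G) := (fun y => H (y * x^-1)%g) : G -> Prop.
have [rep repP] : {rep : (G -> Prop) -> G & forall Q : G -> Prop, (exists y, Q y) -> Q (rep Q)}.
  apply: (@choice (G -> Prop) G (fun Q y => (exists y, Q y) -> Q y)) => Q.
  by have [[y Qy]|nQ] := pselect (exists y, Q y); [exists y|exists 1%g => /nQ].
exists (fun x => rep (cl x)).
have h1 x : H (rep (cl x) * x^-1)%g.
  by apply: (repP (cl x)); exists x; rewrite /cl mulgV; exact: subgrp1.
split=> // x y; split=> [Hxy|e].
  congr rep; apply/funext => z; apply/propext; rewrite /cl; split=> Hz.
    by have := subgrpM sH Hz Hxy; rewrite mulgA mulgVK.
  by have := subgrpM sH Hz (subgrpV sH Hxy); rewrite invgM invgK mulgA mulgVK.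
have := subgrpM sH (subgrpV sH (h1 x)) (h1 y).
by rewrite -e invgM invgK mulgA mulgVK.
Qed.

(** A function constant on the right cosets of H induces a functional on Q[H\G], where u becomes 0;
    the proof moves u to chosen representatives. *)
Lemma coset_null_pairing (F : G -> rat) u : coset_null u ->
  (forall x y, H x -> F (x * y)%g = F y) -> lin (F : G -> rat^o) u = 0.
Proof.
move=> u0 FH; have [rep [rep1 repP]] := coset_rep.
have rep2 x : rep (rep x) = rep x by apply/repP.
have Frep x : F (rep x) = F x by rewrite -[rep x](mulgVK x) FH.
have pu0 : lin (fun h => gbase (rep h)) u = 0.
  apply/malgP => s; rewrite mcoeff0 malg_coefE (lin_comp (lin _)).
  rewrite (eq_lin (G := fun h => (rep h == s)%:R : rat^o)); last by move=> x _; rewrite /= lin_gbase.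
  have [es|ns] := eqVneq (rep s) s; last first.
    rewrite /lin big1 // => h _; case: eqP => [e|_]; last by rewrite scaler0.
    by rewrite -e rep2 eqxx in ns.
  rewrite -[RHS](u0 s) /coset_sum /coset_pairing; apply: eq_linQ => h _; rewrite -{1}es.
  by case: pdecP => [/repP ->|nh]; [rewrite eqxx|case: eqP => // /repP].
transitivity (lin (F : G -> rat^o) (lin (fun h => gbase (rep h)) u)).
  by rewrite (lin_comp (lin _)); apply: eq_lin => x _; rewrite /= lin_gbase Frep.
by rewrite pu0 linear0.
Qed.
End CosetSums.

Section PolynomialFunctions.
Variables (G : groupType) (H : G -> Prop).
Hypothesis sH : subgrp H.
Implicit Types (q : G -> rat).

(* Polynomial functions of degree < d on [H]. *)
Fixpoint poly_on (d : nat) q : Prop :=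
  match d with
  | 0 => forall h, H h -> q h = 0
  | d'.+1 => forall t, H t -> poly_on d' (fun h => q (h * t)%g - q h)
  end.

Lemma poly_ext d q q' : (forall h, H h -> q h = q' h) -> poly_on d q -> poly_on d q'.
Proof.
elim: d q q' => [|d ih] q q' e /= Pq; first by move=> h Hh; rewrite -e // Pq.
move=> t Ht; apply: ih (Pq t Ht) => h Hh; rewrite !e //; exact: subgrpM.
Qed.

Lemma poly_lin d a q q' : poly_on d q -> poly_on d q' -> poly_on d (fun h => a * q h + q' h).
Proof.
elim: d q q' => [|d ih] q q' /= Pq Pq'; first by move=> h Hh; rewrite Pq // Pq' // mulr0 addr0.
move=> t Ht; apply: poly_ext (ih _ _ (Pq t Ht) (Pq' t Ht)) => h Hh; ring.
Qed.

Lemma poly_weak d q : poly_on d q -> poly_on d.+1 q.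
Proof.
elim: d q => [|d ih] q Pq t Ht; last by apply: ih; exact: Pq.
by move=> h Hh; rewrite !Pq ?subr0 //; exact: subgrpM.
Qed.

Lemma poly_mul_affine d q lam c : hom_on H lam -> poly_on d q ->
  poly_on d.+1 (fun h => q h * (lam h + c)).
Proof.
move=> hlam; elim: d q => [|d ih] q Pq.
  by apply: poly_weak => h Hh; rewrite Pq // mul0r.
move=> t Ht; have Dq := Pq t Ht.
have Pqt : poly_on d.+1 (fun h => q (h * t)%g).
  by apply: poly_ext (poly_lin 1 (poly_weak Dq) Pq) => h _; rewrite mul1r subrK.
apply: poly_ext (poly_lin (lam t) Pqt (ih _ Dq)) => h Hh.
rewrite hlam //; ring.
Qed.
End PolynomialFunctions.

(** * Strebel's lemma *)

Section StrebelStep.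
Variables (G : groupType) (H K : G -> Prop).
Hypotheses (sH : subgrp H) (sK : subgrp K) (KH : forall x, K x -> H x).
Hypothesis HK : commutators_in H K.
Hypothesis isoK : forall m x, (0 < m)%N -> H x -> K (x ^+ m)%g -> K x.

Let invariant (q : G -> rat) := forall x h, K x -> H h -> q (x * h)%g = q h.

(** A product of affine functions lam - 1, one for each x in s, where lam is a homomorphism to Q
    trivial on K with lam(x) = 1. Each factor is -1 at the identity. *)
Lemma poly_separating (s : seq G) : (forall x, x \in s -> H x /\ ~ K x) ->
  exists d q, [/\ poly_on H d q, invariant q, q 1%g != 0 & forall x, x \in s -> q x = 0].
Proof.
elim: s => [|x s ih] sP.
  by exists 1%N, (fun=> 1); split.
have [|d [q [Pq Iq q1 qs]]] := ih; first by move=> y ys; apply: sP; rewrite inE ys orbT.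
have [Hx nKx] := sP x (mem_head _ _).
have [|lam [hlam lam0 lamx]] := separating_hom sH sK KH HK Hx.
  by move=> m m0 /(isoK m0 Hx).
have lam1 : lam 1%g = 0 by apply: lam0; exact: subgrp1.
exists d.+1, (fun h => q h * (lam h + -1)); split.
- exact: poly_mul_affine.
- by move=> y h Ky Hh; rewrite Iq // (hlam _ _ (KH Ky) Hh) (lam0 _ Ky) add0r.
- by rewrite lam1 add0r mulf_neq0 // oppr_eq0 oner_eq0.
- by move=> y; rewrite inE => /predU1P[->|/qs ->]; rewrite ?lamx ?subrr ?mulr0 ?mul0r.
Qed.

Variables (I J : finType) (M : I -> J -> galg G).

Definition injective_mod (K : G -> Prop) := forall u : I -> galg G,
  (forall j, coset_null K (\sum_i u i * M i j)) -> forall i, coset_null K (u i).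

(* Strebel's lemma.  All polynomial moments of a kernel vector along the cosets of [H] vanish, by
   induction on the degree: the moments of lowest degree form a kernel vector modulo [H]. *)
Lemma injective_mod_step : injective_mod H -> injective_mod K.
Proof.
move=> injH u uM.
have [rep [rep1 repP]] := coset_rep sH.
have pairM q g j (v : I -> galg G) : coset_pairing H q g (\sum_i v i * M i j) =
    \sum_i lin (fun x => coset_pairing H q (g * x^-1)%g (v i)) (M i j).
  rewrite linear_sum; apply: eq_bigr => i _; rewrite /= {1}/coset_pairing lin_mul.
  by apply: eq_lin => x _; exact: coset_pairing_right.
have moments d q : poly_on H d q -> invariant q -> forall i g, coset_pairing H q g (u i) = 0.
  elim: d q => [|d ih] q Pq Iq.
    move=> i g; rewrite /coset_pairing /lin big1 // => h _.
    by case: pdecP => [/Pq ->|_]; rewrite scaler0.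
  pose w i g := coset_pairing H q g (u i) : rat.
  (* Translating by t changes the moment by that of q(h t^-1) - q(h), which has lower degree and so
     is 0 by induction. Hence w_i is constant on right cosets of H. *)
  have wH i t g : H t -> w i (t * g)%g = w i g.
    move=> Ht; have Ht' := subgrpV sH Ht.
    have <- : coset_pairing H (fun h => q (h * t^-1)%g - q h) g (u i) + w i g = w i (t * g)%g.
      rewrite /w /coset_pairing -lin_add; apply: eq_lin => h _.
      rewrite invgM !mulgA; case: pdecP => [Hh|nHh]; case: pdecP => [Hht|nHht].
      - by rewrite subrK.
      - by case: nHht; apply: subgrpM.
      - by case: nHh; exact: subgrpMr sH Ht' Hht.
      - by rewrite addr0.
    rewrite ih ?add0r //; first exact: Pq.
    by move=> x h Kx Hh; rewrite -mulgA (Iq _ _ Kx (subgrpM sH Hh Ht')) (Iq _ _ Kx Hh).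
  (* v_i places the moments of u_i at representatives of the cosets of H. Since the moments of the
     products with M vanish, v is a kernel vector modulo H. *)
  pose v i := lin (fun h => q (h * (rep h)^-1)%g *: gbase (rep h)) (u i).
  have vw i g : coset_sum H g (v i) = w i g.
    rewrite -(wH i _ _ (rep1 g)) mulgVK /coset_sum /coset_pairing /v (lin_comp (lin _)) /w /coset_pairing.
    apply: eq_lin => h _; rewrite linearZ /= lin_gbase.
    have rg : H (rep h * g^-1)%g <-> H (h * (rep g)^-1)%g.
      have e1 := repP (rep h) g; have e2 := repP h (rep g).
      have r2 x : rep (rep x) = rep x by apply/repP.
      by rewrite r2 in e1; rewrite r2 in e2; tauto.
    case: pdecP => h1; case: pdecP => h2; [|tauto|tauto|by rewrite scaler0].
    rewrite rat_scaleE mulr1; congr (q (_ * _^-1)%g).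
    by have /repP := h2; have -> : rep (rep g) = rep g by apply/repP.
  move=> i g; have := injH v _ i g; rewrite vw; apply=> j {i} {}g.
  rewrite /coset_sum pairM.
  transitivity (coset_pairing H q g (\sum_i u i * M i j)).
    rewrite pairM; apply: eq_bigr => i _; apply: eq_lin => x _.
    exact: vw.
  apply: (coset_null_pairing sK (F := fun h => if pdec (H (h * g^-1)%g) then q (h * g^-1)%g else 0)) => //.
  move=> x y Kx; rewrite -mulgA; case: pdecP => h1; case: pdecP => h2 //.
  - exact: Iq.
  - by case: h2; exact: subgrpMl sH (KH Kx) h1.
  - by case: h1; apply: subgrpM => //; exact: KH.
move=> i g.
(* A polynomial vanishing on the part of the support of u_i in H g outside K g reduces the moment to
   q(1) times the coset sum over K g. *)
pose s := [seq y <- [seq (h * g^-1)%g | h <- msupp (u i)] | pdec (H y /\ ~ K y)].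
have [|d [q [Pq Iq q1 qs]]] := poly_separating (s := s).
  by move=> y; rewrite mem_filter => /andP[/pdecP].
have := moments d q Pq Iq i g.
have -> : coset_pairing H q g (u i) = q 1%g *: coset_sum K g (u i).
  rewrite /coset_sum /coset_pairing -lin_scale; apply: eq_lin => h hu.
  case: pdecP => Hh; case: pdecP => Kh; rewrite ?rat_scaleE ?mulr1 ?mulr0 //.
  - by rewrite -[X in q X]mulg1 Iq //; exact: subgrp1.
  - apply: qs; rewrite mem_filter; apply/andP; split; first exact/pdecP.
    by apply/mapP; exists h.
  - by case: Hh; exact: KH.
by move/eqP; rewrite rat_scaleE mulf_eq0 (negbTE q1) => /eqP.
Qed.
End StrebelStep.

(** Injectivity modulo P_0 = G follows from that of the augmentation, and modulo the trivial group
    P_k it is injectivity itself; [injective_mod_step] descends the series. *)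
Lemma strebel (G : groupType) k (P : nat -> G -> Prop) (I J : finType) (M : I -> J -> galg G) : tfchain k P ->
  (forall v : I -> rat, (forall j, \sum_i v i * aug (M i j) = 0) -> forall i, v i = 0) ->
  forall v : I -> galg G, (forall j, \sum_i v i * M i j = 0) -> forall i, v i = 0.
Proof.
move=> tP augI v vM.
have main i : (i <= k)%N -> injective_mod M (P i).
  elim: i => [_ u uM i g|i ih ik].
    have cs g' u' : coset_sum (P 0) g' u' = aug u'.
      by apply: eq_lin => h _; case: pdecP => // -[]; exact: (tf_top tP).
    rewrite cs; apply: (augI (fun i => aug (u i))) => j; have := uM j g.
    by rewrite cs aug_sum => h; rewrite -[RHS]h; apply: eq_bigr => i' _; rewrite augM.
  apply: injective_mod_step (ih (ltnW ik)); first exact: tf_grp tP _ (ltnW ik).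
  - exact: tf_grp tP _ ik.
  - exact: tf_decr tP _ ik.
  - exact: tf_comm tP _ ik.
  - exact: tf_isol tP _ ik.
move=> i; apply/malgP => g; rewrite mcoeff0.
have <- : coset_sum (P k) g (v i) = 0.
  by apply: (main k (leqnn k)) => j g'; rewrite vM /coset_sum linear0.
rewrite malg_coefE; apply: eq_linQ => h _.
case: pdecP => [/(tf_bot tP)/divg1_eq ->|nh]; first by rewrite eqxx.
by case: eqP nh => // -> []; rewrite mulgV; exact: subgrp1 (tf_grp tP (leqnn k)).
Qed.

(** * Unique products and zero divisors *)

Lemma seq_argmax (T : eqType) (s : seq T) (lam : T -> rat) x0 : x0 \in s ->
  exists2 x, x \in s & forall y, y \in s -> lam y <= lam x.
Proof.
elim: s x0 => // a s ih x0 _; case: s ih => [_|b s ih].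
  by exists a; rewrite ?mem_head // => y; rewrite inE => /eqP ->.
have [x xs xmax] := ih b (mem_head _ _).
have [le|lt] := lerP (lam x) (lam a).
  exists a; first exact: mem_head.
  by move=> y; rewrite inE => /predU1P[->//|/xmax ly]; exact: le_trans le.
exists x; first by rewrite inE xs orbT.
by move=> y; rewrite inE => /predU1P[->|/xmax //]; exact: ltW.
Qed.

Definition unique_products (G : groupType) (H : G -> Prop) := forall (X Y : seq G) x0 y0,
  x0 \in X -> y0 \in Y -> (forall x, x \in X -> H x) -> (forall y, y \in Y -> H y) ->
  exists x y, [/\ x \in X, y \in Y & forall x' y', x' \in X -> y' \in Y ->
    (x' * y' = x * y)%g -> x' = x /\ y' = y].

(** If some homomorphism to Q is nonconstant on X or Y, a unique product of the parts where it is
    maximal is one for X and Y, and the sizes drop. Otherwise X lies in x0 K and Y in K y0, and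
    translation reduces to K. *)
Lemma unique_products_step (G : groupType) (H K : G -> Prop) :
  subgrp H -> subgrp K -> (forall x, K x -> H x) -> commutators_in H K ->
  (forall m x, (0 < m)%N -> H x -> K (x ^+ m)%g -> K x) ->
  unique_products K -> unique_products H.
Proof.
move=> sH sK KH HK isoK upK X Y.
have [n] := ubnP (size X + size Y)%N; elim: n X Y => // n ih X Y szn x0 y0 x0X y0Y XH YH.
have sep z : H z -> ~ K z -> exists lam, hom_on H lam /\ lam z = 1.
  move=> Hz nKz; have [|lam [h1 _ h2]] := separating_hom sH sK KH HK Hz.
    by move=> m m0 /(isoK m z m0 Hz).
  by exists lam.
have [[lam [hlam nonconst]]|const] := pselect (exists lam, hom_on H lam /\
    ((exists x, x \in X /\ lam x <> lam x0) \/ (exists y, y \in Y /\ lam y <> lam y0))).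
  have [xm xmX xmax] := seq_argmax lam x0X.
  have [ym ymY ymax] := seq_argmax lam y0Y.
  pose X' := [seq x <- X | lam x == lam xm]; pose Y' := [seq y <- Y | lam y == lam ym].
  have strict (Z : seq G) z0 z zm : z0 \in Z -> z \in Z -> lam z <> lam z0 ->
      (size [seq x <- Z | lam x == lam zm] < size Z)%N.
    move=> z0Z zZ ne; rewrite size_filter -(count_predC (fun x => lam x == lam zm) Z).
    rewrite -[X in (X < _)%N]addn0 ltn_add2l -has_count.
    case: (eqVneq (lam z) (lam zm)) => [e|e]; apply/hasP; last by exists z.
    by exists z0 => //=; apply/eqP => e0; apply: ne; rewrite e e0.
  have le (Z : seq G) zm : (size [seq x <- Z | lam x == lam zm] <= size Z)%N.
    by rewrite size_filter count_size.
  have sz : (size X' + size Y' < n)%N.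
    rewrite ltnS in szn; apply: leq_trans szn.
    case: nonconst => [[x [xX ne]]|[y [yY ne]]].
      by rewrite -addSn; apply: leq_add; [exact: strict x0X xX ne|exact: le].
    by rewrite -addnS; apply: leq_add; [exact: le|exact: strict y0Y yY ne].
  have [||||x [y [xX' yY' uniq_xy]]] := ih X' Y' sz xm ym.
  - by rewrite mem_filter eqxx.
  - by rewrite mem_filter eqxx.
  - by move=> x; rewrite mem_filter => /andP[_ /XH].
  - by move=> y; rewrite mem_filter => /andP[_ /YH].
  move: xX' yY'; rewrite !mem_filter => /andP[/eqP lx xX] /andP[/eqP ly yY].
  exists x, y; split=> // x' y' x'X y'Y e.
  have := congr1 lam e; rewrite !hlam ?lx ?ly; [|exact: XH|exact: YH|exact: XH|exact: YH].
  have := xmax _ x'X; have := ymax _ y'Y => ly' lx' e'.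
  by apply: uniq_xy => //; rewrite mem_filter ?x'X ?y'Y andbT; apply/eqP; lra.
have hdiff lam z w : hom_on H lam -> H z -> H w -> lam (z^-1 * w)%g = lam w - lam z.
  by move=> hlam Hz Hw; rewrite -{2}[w](mulVKg z) [X in X - _]hlam ?[lam z + _]addrC ?addrK //;
    apply: subgrpM => //; exact: subgrpV.
have XK x : x \in X -> K (x0^-1 * x)%g.
  move=> xX; have [//|nK] := pselect (K (x0^-1 * x)%g); case: const.
  have [lam [hlam l1]] := sep _ (subgrpM sH (subgrpV sH (XH _ x0X)) (XH _ xX)) nK.
  exists lam; split=> //; left; exists x; split=> // e.
  by move: l1; rewrite hdiff ?e ?subrr //; try exact: XH; move/esym/eqP; rewrite oner_eq0.
have YK y : y \in Y -> K (y * y0^-1)%g.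
  move=> yY; have [//|nK] := pselect (K (y * y0^-1)%g); case: const.
  have [lam [hlam l1]] := sep _ (subgrpM sH (YH _ yY) (subgrpV sH (YH _ y0Y))) nK.
  exists lam; split=> //; right; exists y; split=> // e.
  have := hlam (y * y0^-1)%g y0; rewrite mulgVK l1 e => h.
  have := h (subgrpM sH (YH _ yY) (subgrpV sH (YH _ y0Y))) (YH _ y0Y); lra.
have [|||| _ [_ [/mapP[x xX ->] /mapP[y yY ->] uniq_xy]]] :=
  upK [seq (x0^-1 * x)%g | x <- X] [seq (y * y0^-1)%g | y <- Y] 1%g 1%g.
- by apply/mapP; exists x0; rewrite ?mulVg.
- by apply/mapP; exists y0; rewrite ?mulgV.
- by move=> _ /mapP[x /XK h ->].
- by move=> _ /mapP[y /YK h ->].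
exists x, y; split=> // x' y' x'X y'Y e.
have [|||/mulgI -> /mulIg -> //] := uniq_xy (x0^-1 * x')%g (y' * y0^-1)%g.
- by apply/mapP; exists x'.
- by apply/mapP; exists y'.
by rewrite -!mulgA [(x' * _)%g]mulgA e !mulgA.
Qed.

Lemma tf_unique_products (G : groupType) k (P : nat -> G -> Prop) : tfchain k P ->
  unique_products (fun _ : G => True).
Proof.
move=> tP; suff main i : (i <= k)%N -> unique_products (P (k - i)%N).
  have := main k (leqnn k); rewrite subnn => h X Y x0 y0 xX yY _ _.
  by apply: (h X Y x0 y0) => // x _; exact: tf_top tP x.
elim: i => [_|i ih ik].
  rewrite subn0 => X Y x0 y0 xX yY XP YP; exists x0, y0; split=> // x' y' x'X y'Y _.
  by rewrite (tf_bot tP (XP _ x'X)) (tf_bot tP (XP _ xX)) (tf_bot tP (YP _ y'Y)) (tf_bot tP (YP _ yY)).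
have e : (k - i)%N = (k - i.+1).+1 by lia.
have lt : (k - i.+1 < k)%N by lia.
have {}ih := ih (ltnW ik); rewrite e in ih.
apply: unique_products_step ih.
- exact: tf_grp tP _ (ltnW lt).
- exact: tf_grp tP _ lt.
- exact: tf_decr tP _ lt.
- exact: tf_comm tP _ lt.
- exact: tf_isol tP _ lt.
Qed.

Lemma galg_domain (G : groupType) (u v : galg G) : unique_products (fun _ : G => True) ->
  u != 0 -> v != 0 -> u * v != 0.
Proof.
move=> up u0 v0.
have ne (w : galg G) : w != 0 -> exists x : G, x \in (msupp w : seq G).
  move=> w0; have [[x xw]|no] := pselect (exists x, x \in (msupp w : seq G)); first by exists x.
  case/eqP: w0; apply/malgP => x; rewrite mcoeff0; apply/mcoeff_outdom.
  by apply/negP => xw; apply: no; exists x.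
have [x0 x0u] := ne u u0; have [y0 y0v] := ne v v0.
have [x [y [xu yv uxy]]] := up (msupp u) (msupp v) x0 y0 x0u y0v (fun _ _ => I) (fun _ _ => I).
have galgE (w : galg G) : w = \sum_(z <- msupp w) w@_z *: gbase z.
  by rewrite {1}[w]monalgE; apply: eq_bigr => z _; rewrite malgUZ.
have cU a b (x' y' : G) : ((a *: gbase x') * (b *: gbase y'))@_(x * y)%g =
    a * b *+ (x' * y' == x * y)%g.
  by rewrite -scalerAl -scalerAr !mcoeffZ -gbaseM mcoeffU mulrA mulrnAr mulr1.
have coefE : (u * v)@_(x * y)%g = u@_x * v@_y.
  rewrite {1}[u]galgE {1}[v]galgE mulr_suml raddf_sum /= (bigD1_seq x) ?fset_uniq //=.
  rewrite mulr_sumr raddf_sum /= (bigD1_seq y) ?fset_uniq //=.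
  rewrite cU eqxx mulr1n; rewrite big_seq_cond big1 ?addr0 => [|y' /andP[y'v ne1]].
    rewrite big_seq_cond big1 ?addr0 // => x' /andP[x'u ne1].
    rewrite mulr_sumr raddf_sum /= big_seq big1 // => y' y'v; rewrite cU.
    by case: eqP => // /(uxy _ _ x'u y'v)[e _]; rewrite e eqxx in ne1.
  by rewrite cU; case: eqP => // /(uxy _ _ xu y'v)[_ e]; rewrite e eqxx in ne1.
apply: contraTneq isT => uv0; move: coefE; rewrite uv0 mcoeff0 => /esym/eqP.
by rewrite mulf_eq0 !mcoeff_eq0 xu yv.
Qed.

(** * Linear dependence by means of Folner sets *)

Lemma exp_dominates_poly (c n : nat) : exists L, (c ^ L * L.+1 ^ n < c.+1 ^ L)%N.
Proof.
case: c => [|c]; first by exists 1%N; rewrite mul0n.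
(* For L = d 2^j, Bernoulli's bound 2 d^d <= (d+1)^d gives (d+1)^L >= d^L 2^(2^j), while (L+1)^n <=
   2^(n (d+j)). The choice j = 3q ensures n (d+j) <= 4 q^2 < 2^j. *)
set d := c.+1; set q := (n + d + 2)%N; set j := (3 * q)%N; exists (d * 2 ^ j)%N.
have bern : (2 * d ^ d <= d.+1 ^ d)%N.
  have bern' m : (d ^ m + m * d ^ m.-1 <= d.+1 ^ m)%N.
    elim: m => [|m ih]; first by rewrite mul0n.
    apply: (@leq_trans (d.+1 * (d ^ m + m * d ^ m.-1))); last by rewrite expnS leq_mul2l ih orbT.
    case: m {ih} => [|m]; first by rewrite !expn0 expn1 mul0n mul1n; lia.
    by rewrite /= !expnS; nia.
  by apply: leq_trans (bern' d); rewrite /d /= -expnS mul2n addnn.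
have qq : (q * (4 * q) < 2 ^ j)%N.
  have q2 : (q < 2 ^ q)%N by exact: ltn_expl.
  have q4 : (4 <= 2 ^ q)%N by rewrite -[4%N]/(2 ^ 2)%N leq_exp2l // /q; lia.
  rewrite /j [(3 * q)%N]mulnC expnM !expnS expn0 muln1; move: (2 ^ q)%N q2 q4 => x q2 q4.
  have qx : (q * q < x * x)%N by nia.
  have -> : (q * (4 * q) = 4 * (q * q))%N by lia.
  by move: (q * q)%N (x * x)%N qx => y z qx; nia.
have step : ((d * 2 ^ j).+1 ^ n < 2 ^ (2 ^ j))%N.
  have le1 : ((d * 2 ^ j).+1 <= 2 ^ (d + j))%N.
    rewrite expnD; have := ltn_expl d (ltnSn 1); have : (0 < 2 ^ j)%N by rewrite expn_gt0.
    nia.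
  apply: (@leq_ltn_trans ((2 ^ (d + j)) ^ n)); first by case: (n) => // m; rewrite leq_exp2r.
  rewrite -expnM ltn_exp2l //; apply: leq_ltn_trans qq; rewrite /j /q; nia.
rewrite expnM [(d.+1 ^ _)%N]expnM.
apply: (@leq_trans ((d ^ d) ^ (2 ^ j) * 2 ^ (2 ^ j))).
  by rewrite ltn_pmul2l // !expn_gt0.
by rewrite -expnMn mulnC leq_exp2r ?expn_gt0.
Qed.

Section Folner.
Variables (G : groupType) (H K : G -> Prop) (rep : G -> G).
Hypotheses (sH : subgrp H) (sK : subgrp K) (KH : forall x, K x -> H x).
Hypothesis HK : commutators_in H K.
Hypothesis repP : forall x y, K (x * y^-1)%g <-> rep x = rep y.

Fixpoint box (L : nat) (s : seq G) : seq G :=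
  if s is x :: s' then [seq (x ^+ e * y)%g | e <- iota 0 L, y <- box L s'] else [:: 1%g].

Lemma mem_box L x s z : z \in box L (x :: s) <->
  exists e y, [/\ (e < L)%N, y \in box L s & z = (x ^+ e * y)%g].
Proof.
split=> [/allpairsP[[e y] /= [eL yb ->]]|[e [y [eL yb ->]]]].
  by exists e, y; split=> //; rewrite mem_iota in eL.
by apply/allpairsP; exists (e, y); split; rewrite //= mem_iota.
Qed.

Definition box_reps L s := undup [seq rep y | y <- box L s].

Lemma size_box_reps L s : (size (box_reps L s) <= L ^ size s)%N.
Proof.
apply: leq_trans (size_undup _) _; rewrite size_map.
elim: s => //= x s ih; rewrite size_allpairs size_iota expnS leq_mul2l ih orbT //.
Qed.

Lemma box_sub L s y : (forall x, x \in s -> H x) -> y \in box L s -> H y.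
Proof.
elim: s y => [|x s ih] y sH'; first by rewrite inE => /eqP ->; exact: subgrp1.
move=> /mem_box[e [z [_ zs ->]]]; apply: (subgrpM sH).
  by apply: (subgrp_gz e sH); apply: sH'; exact: mem_head.
by apply: ih zs => w ws; apply: sH'; rewrite inE ws orbT.
Qed.

Lemma box_mono L s y : y \in box L s -> y \in box L.+1 s.
Proof.
elim: s y => // x s ih y /mem_box[e [z [eL zs ->]]].
by apply/mem_box; exists e, z; split=> //; [exact: ltnW|exact: ih].
Qed.

Lemma box_mul L s y x : (forall x, x \in s -> H x) -> y \in box L s -> x \in s ->
  exists2 z, z \in box L.+1 s & rep (y * x)%g = rep z.
Proof.
elim: s y => // a s ih y sH' /mem_box[e [z [eL zs ->]]].
have Ha : H a by apply: sH'; exact: mem_head.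
have sHs w : w \in s -> H w by move=> ws; apply: sH'; rewrite inE ws orbT.
have Hz := box_sub sHs zs.
have Hae : H (a ^+ e)%g by exact: (subgrp_gz e sH Ha).
rewrite inE => /predU1P[->|xs].
  exists (a ^+ e.+1 * z)%g.
    by apply/mem_box; exists e.+1, z; split=> //; exact: box_mono.
  apply/repP; have -> : (a ^+ e * z * a * (a ^+ e.+1 * z)^-1 =
      [~ z^-1, a^-1] ^ (a ^+ e)^-1)%g.
    rewrite expgSr /commg /monoid.conjg !invgM !invgK !mulgA.
    by rewrite ?(mulgK, mulgVK).
  have HaV := subgrpV sH Hae.
  have c1 := HK (subgrpV sH Hz) (subgrpV sH Ha).
  rewrite -[X in K X](mulVKg [~ z^-1, a^-1]%g); apply: (subgrpM sK c1).
  by rewrite -commgEl; apply: HK => //; exact: KH.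
have [w wL /repP kw] := ih z sHs zs xs.
exists (a ^+ e * w)%g.
  by apply/mem_box; exists e, w; split=> //; exact: ltnW.
apply/repP; have -> : (a ^+ e * z * x * (a ^+ e * w)^-1 = (z * x * w^-1) ^ (a ^+ e)^-1)%g.
  by rewrite /monoid.conjg !invgM invgK !mulgA.
rewrite -[X in K X](mulVKg (z * x * w^-1)%g); apply: (subgrpM sK kw).
by rewrite -commgEl; apply: HK; [exact: KH|exact: subgrpV].
Qed.

(** Otherwise the boxes modulo K would grow by the factor (c+1)/c at each step, hence exponentially,
    whereas in the abelian group H/K their size is at most L to the power [size s]. *)
Lemma folner (c : nat) (s : seq G) :
  exists L, (c * size (box_reps L.+1 s) < c.+1 * size (box_reps L s))%N.
Proof.
have [//|no] := pselect (exists L, (c * size (box_reps L.+1 s) < c.+1 * size (box_reps L s))%N).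
have grow L : (c.+1 ^ L * size (box_reps 1 s) <= c ^ L * size (box_reps L.+1 s))%N.
  elim: L => [|L ih]; first by rewrite !expn0.
  have h : (c.+1 * size (box_reps L.+1 s) <= c * size (box_reps L.+2 s))%N.
    by rewrite leqNgt; apply/negP => lt; apply: no; exists L.+1.
  rewrite !expnS -!mulnA; apply: (@leq_trans (c.+1 * (c ^ L * size (box_reps L.+1 s)))).
    by rewrite leq_mul2l ih orbT.
  by rewrite mulnCA [leqRHS]mulnCA leq_mul2l h orbT.
have b1 : (0 < size (box_reps 1 s))%N.
  have : rep (foldr (fun x y => x ^+ 0 * y)%g 1%g s) \in box_reps 1 s.
    rewrite mem_undup; apply: map_f; elim: s {no grow} => [|x s ih]; first exact: mem_head.
    by apply/mem_box; exists 0%N, (foldr (fun x y => x ^+ 0 * y)%g 1%g s).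
  by case: (box_reps 1 s).
have [L lt] := exp_dominates_poly c (size s).
have := size_box_reps L.+1 s; have := grow L; nia.
Qed.

Definition dependent_on (Q : G -> Prop) := forall (I J : finType) (M : I -> J -> galg G),
  (#|J| < #|I|)%N -> (forall i j, supported_on Q (M i j)) ->
  exists v : I -> galg G, [/\ forall i, supported_on Q (v i), exists i, v i != 0 &
    forall j, \sum_i v i * M i j = 0].

Hypothesis rep1 : forall x, K (rep x * x^-1)%g.

(* Over the Folner sets of representatives [E], [E'] with E S < K E', a system of |J| equations in
   |I| unknowns over Q[H] becomes a system of |E'||J| < |E||I| equations over Q[K]. *)
Lemma dependent_step : dependent_on K -> dependent_on H.
Proof.
move=> depK I J M ltJI MH.
pose s := flatten [seq (msupp (M p.1 p.2) : seq G) | p : I * J].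
have sP i j h : h \in msupp (M i j) -> h \in s.
  by move=> hM; apply/flattenP; exists (msupp (M i j) : seq G) => //; apply/imageP; exists (i, j).
have sHs x : x \in s -> H x.
  by case/flattenP => _ /imageP[[i j] _ ->] /=; rewrite -mcoeff_neq0 => /MH.
have [L ltL] := folner #|J| s.
set E := box_reps L s in ltL; set E' := box_reps L.+1 s in ltL.
have rep2 x : rep (rep x) = rep x by apply/repP.
have repE (l : nat) x : x \in box_reps l s -> rep x = x /\ H x.
  rewrite mem_undup => /mapP[y ys ->]; split=> //.
  have := subgrpM sH (KH (rep1 y)) (box_sub sHs ys); by rewrite mulgVK.
pose e (i : 'I_(size E)) := tnth (in_tuple E) i.
pose e' (i : 'I_(size E')) := tnth (in_tuple E') i.
have eE i : e i \in E by exact: mem_tnth.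
have e'E i : e' i \in E' by exact: mem_tnth.
have e_inj : injective e by apply/tuple_uniqP; exact: undup_uniq.
have e'_inj : injective e' by apply/tuple_uniqP; exact: undup_uniq.
have e'_ex i h : h \in s -> exists i', e' i' = rep (e i * h)%g.
  move=> hs; have := eE i; rewrite mem_undup => /mapP[y ys ey].
  have [z zL ez] := box_mul sHs ys hs.
  have : rep (e i * h)%g \in E'.
    rewrite mem_undup ey; apply/mapP; exists z => //; rewrite -ez; apply/repP.
    by rewrite invgM mulgA mulgK.
  by case/(tnthP (in_tuple E')) => i' ->; exists i'.
(* The blocks of M over K: e_a M_ij = sum_b N_ab e'_b, each term e_a h being split as an element of
   K times the representative of its coset. *)
pose N (a : 'I_(size E) * I) (b : 'I_(size E') * J) : galg G :=
  lin (fun h => if rep (e a.1 * h)%g == e' b.1 then gbase (e a.1 * h * (e' b.1)^-1)%g else 0)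
    (M a.2 b.2).
have NK a b : supported_on K (N a b).
  apply: subsp_lin => [|h _]; first exact: supported_subsp.
  case: eqP => [er|_]; last exact: subsp0 (supported_subsp _).
  by apply: supported_gbase; apply/repP; rewrite er; case: (repE _ _ (e'E b.1)).
have Nsum a j : \sum_b1 N a (b1, j) * gbase (e' b1) = gbase (e a.1) * M a.2 j.
  have -> : gbase (e a.1) * M a.2 j = lin (fun h => gbase (e a.1 * h)%g) (M a.2 j).
    by rewrite -[LHS]lin_id lin_left.
  have Nr b1 : N a (b1, j) * gbase (e' b1) =
      lin (fun h => if rep (e a.1 * h)%g == e' b1 then gbase (e a.1 * h)%g else 0) (M a.2 j).
    rewrite -[LHS]lin_id lin_right /N lin_comp; apply: eq_lin => h _ /=.
    by case: eqP => _; rewrite ?linear0 // lin_gbase mulgVK.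
  under eq_bigr do rewrite Nr.
  rewrite /lin exchange_big /=; apply: eq_big_seq => h hM.
  have [i' ei'] := e'_ex a.1 h (sP _ _ _ hM).
  rewrite (bigD1 i') //= ei' eqxx big1 ?addr0 // => b1 ne.
  by case: eqP => [er|_]; rewrite ?scaler0 //; case/eqP: ne; apply: e'_inj; rewrite ei'.
have [|v [vK [[i1 i] vi] vN]] := depK _ _ N _ NK.
  by rewrite !card_prod !card_ord mulnC [ltnRHS]mulnC; apply: leq_trans ltL _; rewrite leq_mul2r ltJI orbT.
pose V (i : I) := \sum_i1 v (i1, i) * gbase (e i1).
exists V; split.
- move=> i0; apply: subsp_sum => [|i2 _]; first exact: supported_subsp.
  apply: (supported_mul sH); first exact: supported_sub (vK _).
  by apply: supported_gbase; case: (repE _ _ (eE i2)).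
- exists i; have [k vk] : exists k, (v (i1, i))@_k != 0.
    have [//|no] := pselect (exists k, (v (i1, i))@_k != 0); case/eqP: vi; apply/malgP => k.
    by rewrite mcoeff0; case: (eqVneq (v (i1, i))@_k 0) => // h; case: no; exists k.
  (* The e_i lie in distinct cosets of K, so the coefficient of V at k e_i1 comes from the summand
     i1 alone. *)
  apply: contraNneq (vk) => /(congr1 (mcoeff (k * e i1)%g)).
  have cr (u : galg G) x y : (u * gbase x)@_y = u@_(y * x^-1)%g.
    by rewrite !malg_coefE lin_right; apply: eq_linQ => z _; rewrite -divg_eq invgK.
  rewrite mcoeff0 raddf_sum /= (bigD1 i1) //= cr mulgK big1 ?addr0 => [->//|i2 ne].
  rewrite cr; apply/eqP; apply: contraNT ne => /(vK _) kk.
  have kk1 := vK _ _ vk.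
  have er i' : rep (e i') = e i' by case: (repE _ _ (eE i')).
  apply/eqP/e_inj; rewrite -(er i2) -(er i1); apply/esym/repP.
  by apply: (subgrpMl sK kk1); rewrite mulgA.
move=> j; rewrite /V.
transitivity (\sum_b1 (\sum_a v a * N a (b1, j)) * gbase (e' b1)); last first.
  by rewrite big1 // => b1 _; rewrite vN mul0r.
under [RHS]eq_bigr do rewrite mulr_suml; rewrite exchange_big /=.
transitivity (\sum_(a : 'I_(size E) * I) v a * (gbase (e a.1) * M a.2 j)); last first.
  by apply: eq_bigr => a _; rewrite -Nsum mulr_sumr; apply: eq_bigr => b1 _; rewrite mulrA.
under eq_bigr do rewrite mulr_suml; rewrite exchange_big pair_big /=.
by apply: eq_bigr => -[a1 a2] _ /=; rewrite mulrA.
Qed.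
End Folner.

Lemma dependent_trivial (G : groupType) (K : G -> Prop) :
  K 1%g -> (forall x, K x -> x = 1%g) -> dependent_on K.
Proof.
move=> K_1 K1 I J M lt MK.
have Mc i j : M i j = (aug (M i j) : rat) *: 1.
  apply: (supported_ind (P := fun u => u = (aug u : rat) *: 1)) (MK i j) => [|x /K1 ->].
    split=> [|a u v hu hv]; first by rewrite linear0 scale0r.
    by rewrite linearP /= scalerDl rat_scaleE -scalerA -hu -hv.
  by rewrite gbase1 aug1 scale1r.
pose A := \matrix_(i < #|I|, j < #|J|) (aug (M (enum_val i) (enum_val j)) : rat).
have : kermx A != 0.
  by rewrite -mxrank_eq0 mxrank_ker subn_eq0 -ltnNge (leq_ltn_trans (rank_leq_col A)).
case/rowV0Pn => w /sub_kermxP wA w0.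
have [k wk] : exists k, w 0 k != 0.
  have [//|no] := pselect (exists k, w 0 k != 0); case/eqP: w0; apply/rowP => k.
  by rewrite mxE; case: (eqVneq (w 0 k) 0) => // h; case: no; exists k.
exists (fun i => w 0 (enum_rank i) *: 1); split.
- by move=> i; apply: (subspZ (supported_subsp K)); exact: supported_gbase.
- by exists (enum_val k); rewrite enum_valK scaler_eq0 (negbTE wk) gbase_neq0.
move=> j; transitivity ((\sum_i w 0 (enum_rank i) * (aug (M i j) : rat)) *: (1 : galg G)).
  rewrite scaler_suml; apply: eq_bigr => i _.
  by rewrite {1}[M i j]Mc -scalerAl mul1r scalerA.
have := congr1 (fun B : 'M_(_, _) => B 0 (enum_rank j)) wA; rewrite !mxE => e.
rewrite (reindex _ (onW_bij _ (@enum_val_bij I))) /=.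
rewrite -[RHS](scale0r (1 : galg G)); congr (_ *: _); rewrite -[RHS]e.
by apply: eq_bigr => i _; rewrite enum_valK mxE enum_rankK.
Qed.

Lemma tf_dependent (G : groupType) k (P : nat -> G -> Prop) : tfchain k P ->
  dependent_on (fun _ : G => True).
Proof.
move=> tP; suff main i : (i <= k)%N -> dependent_on (P (k - i)%N).
  have := main k (leqnn k); rewrite subnn => h I J M lt MT.
  have [|v [_ v1 v2]] := h I J M lt; first by move=> i j x _; exact: tf_top tP x.
  by exists v.
elim: i => [_|i ih ik].
  rewrite subn0; apply: dependent_trivial; last exact: tf_bot tP.
  exact: subgrp1 (tf_grp tP (leqnn k)).
have e : (k - i)%N = (k - i.+1).+1 by lia.
have lt : (k - i.+1 < k)%N by lia.
have {}ih := ih (ltnW ik); rewrite e in ih.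
have [rep [rep1 repP]] := coset_rep (tf_grp tP lt).
apply: (dependent_step (K := P (k - i.+1).+1%N) (rep := rep)) => //.
- exact: tf_grp tP _ (ltnW lt).
- exact: tf_grp tP _ lt.
- exact: tf_decr tP _ lt.
- exact: tf_comm tP _ lt.
Qed.

(** * Fox calculus *)

Definition letter (D : group) (gens : seq D) (e : nat * bool) : D :=
  if e.2 then nth 1%g gens e.1 else (nth 1%g gens e.1)^-1%g.

Lemma evalw_nil (D : group) (gens : seq D) : evalw gens [::] = 1%g. Proof. by []. Qed.

Lemma evalw_cons (D : group) (gens : seq D) e w :
  evalw gens (e :: w) = (letter gens e * evalw gens w)%g.
Proof. by []. Qed.

Lemma evalw_cat (D : group) (gens : seq D) u v :
  evalw gens (u ++ v) = (evalw gens u * evalw gens v)%g.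
Proof. by elim: u => [|e u ih]; rewrite /= ?mul1g // !evalw_cons ih mulgA. Qed.

Definition inv_word (w : word) : word := rev [seq (e.1, ~~ e.2) | e <- w].

Lemma inv_word_cons e w : inv_word (e :: w) = inv_word w ++ [:: (e.1, ~~ e.2)].
Proof. by rewrite /inv_word /= rev_cons -cats1. Qed.

Lemma evalw_inv (D : group) (gens : seq D) w : evalw gens (inv_word w) = (evalw gens w)^-1%g.
Proof.
elim: w => [|e w ih]; first by rewrite invg1.
rewrite inv_word_cons evalw_cat !evalw_cons evalw_nil ih invgM mulg1; congr (_ * _)%g.
by rewrite /letter /=; case: e.2; rewrite /= ?invgK.
Qed.

Lemma wf_cat n u v : wf_word n u -> wf_word n v -> wf_word n (u ++ v).
Proof. by move=> hu hv e he; case: (In_cat he) => [/hu|/hv]. Qed.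

Lemma wf_cons n e w : wf_word n (e :: w) -> (e.1 < n)%N /\ wf_word n w.
Proof. by move=> h; split=> [|e' e'w]; apply: h; [left|right]. Qed.

Lemma wf_inv n w : wf_word n w -> wf_word n (inv_word w).
Proof.
elim: w => // e w ih /wf_cons[en wn]; rewrite inv_word_cons; apply: wf_cat; first exact: ih.
by move=> e' [<-|[]].
Qed.

Section FoxCalculus.
Variables (D : group) (Gam : groupType) (psi : D -> Gam) (gens : seq D).
Hypothesis psiM : forall x y, psi (x * y)%g = (psi x * psi y)%g.
Local Notation R := (galg Gam).
Local Notation n := (size gens).

Lemma psi1 : psi 1%g = 1%g.
Proof. by apply: (@mulgI _ (psi 1%g)); rewrite -psiM !mulg1. Qed.
Lemma psiV x : psi x^-1%g = (psi x)^-1%g.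
Proof. by apply/esym/mulg1_eq; rewrite -psiM mulgV psi1. Qed.

Definition fox_letter (e : nat * bool) : 'rV[R]_n :=
  (if e.2 then 1 else - gbase (psi (letter gens e))) *: \row_(j < n) (e.1 == j)%:R.

Fixpoint fox (w : word) : 'rV[R]_n :=
  if w is e :: w' then fox_letter e + gbase (psi (letter gens e)) *: fox w' else 0.

Lemma fox_cat u v : fox (u ++ v) = fox u + gbase (psi (evalw gens u)) *: fox v.
Proof.
elim: u => [|e u ih] /=; first by rewrite evalw_nil psi1 gbase1 scale1r add0r.
by rewrite ih scalerDr scalerA -gbaseM -psiM addrA.
Qed.

Lemma fox_letter_cancel i b :
  fox_letter (i, b) + gbase (psi (letter gens (i, b))) *: fox_letter (i, ~~ b) = 0.
Proof.
rewrite /fox_letter scalerA -scalerDl; case: b => /=; rewrite /letter /=.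
  by rewrite mulrN -gbaseM psiV mulgV gbase1 subrr scale0r.
by rewrite mulr1 addNr scale0r.
Qed.

Lemma fox_inv w : fox (inv_word w) = - (gbase (psi (evalw gens w)^-1%g) *: fox w).
Proof.
elim: w => [|[i b] w ih]; first by rewrite scaler0 oppr0.
rewrite inv_word_cons fox_cat ih evalw_inv evalw_cons invgM /= scaler0 addr0.
set l := letter gens (i, b); set ew := (evalw gens w)^-1%g.
have e1 : gbase (psi (ew * l^-1)%g) * gbase (psi l) = gbase (psi ew).
  by rewrite -gbaseM -psiM mulgVK.
have /eqP := fox_letter_cancel i b; rewrite addr_eq0 => /eqP ->.
by rewrite scalerDr scalerN !scalerA e1 opprD opprK addrC.
Qed.

(* A derivation Gam x D -> Q, i.e. a derivation of [D] into the coinduced module of functions on Gam. *)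
Definition derivation (u : Gam -> D -> rat) :=
  forall g a b, u g (a * b)%g = u g a + u (g * psi a)%g b.

Definition pair_der (u : Gam -> D -> rat) (y : 'rV[R]_n) : rat :=
  \sum_(j < n) lin (fun g => u g (nth 1%g gens j) : rat^o) (y 0 j).

(* [y] stands for the element sum_j y_j [d_j] of Q[Gam] (x) I_D; it vanishes iff every
   derivation kills it. *)
Definition null (y : 'rV[R]_n) := forall u, derivation u -> pair_der u y = 0.

Lemma derivation1 u g : derivation u -> u g 1%g = 0.
Proof.
by move=> du; have := du g 1%g 1%g; rewrite psi1 !mulg1; lra.
Qed.

Lemma pair_derD u y y' : pair_der u (y + y') = pair_der u y + pair_der u y'.
Proof.
rewrite /pair_der -big_split; apply: eq_bigr => j _.
by rewrite mxE linearD.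
Qed.

Lemma pair_der_gbase u h y : pair_der u (gbase h *: y) = pair_der (fun g => u (h * g)%g) y.
Proof. by apply: eq_bigr => j _; rewrite mxE lin_left. Qed.

Lemma pair_derZ u a y : pair_der u ((a *: 1) *: y) = a * pair_der u y.
Proof.
rewrite /pair_der mulr_sumr; apply: eq_bigr => j _.
by rewrite mxE -scalerAl mul1r linearZ.
Qed.

Lemma derivation_shift u h : derivation u -> derivation (fun g => u (h * g)%g).
Proof. by move=> du g a b; rewrite mulgA -du. Qed.

Lemma null0 : null 0.
Proof. by move=> u _; rewrite /pair_der big1 // => j _; rewrite mxE linear0. Qed.

Lemma nullD y y' : null y -> null y' -> null (y + y').
Proof. by move=> ny ny' u du; rewrite pair_derD ny // ny' // addr0. Qed.

Lemma nullZ r y : null y -> null (r *: y).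
Proof.
move=> ny; elim/galg_ind: r => [h u du||r r' hr hr'|a r hr].
- by rewrite pair_der_gbase; apply: ny; exact: derivation_shift.
- by rewrite scale0r; exact: null0.
- by rewrite scalerDl; exact: nullD.
- by move=> u du; rewrite -[r]mul1r scalerAl -scalerA pair_derZ hr // mulr0.
Qed.

Lemma pair_fox u w : derivation u -> wf_word n w -> pair_der u (fox w) = u 1%g (evalw gens w).
Proof.
suff main g : derivation u -> wf_word n w -> pair_der u (gbase g *: fox w) = u g (evalw gens w).
  by move=> du wn; rewrite -main // gbase1 scale1r.
move=> du; elim: w g => [|[i b] w ih] g.
  by move=> _; rewrite scaler0 null0 // derivation1.
move=> /wf_cons[/= ni wn]; rewrite scalerDr pair_derD scalerA -gbaseM ih // evalw_cons du.
congr (_ + _); rewrite /fox_letter scalerA.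
have pd h : pair_der u (gbase h *: \row_(j < n) (i == j)%:R) = u h (nth 1%g gens i).
  rewrite /pair_der (bigD1 (Ordinal ni)) //= !mxE eqxx mulr1 lin_gbase big1 ?addr0 // => j ji.
  rewrite !mxE; have [e|_] := eqVneq i (j : nat); last by rewrite mulr0 linear0.
  by case/eqP: ji; exact/val_inj.
have pdN y : pair_der u (- y) = - pair_der u y.
  by rewrite /pair_der -sumrN; apply: eq_bigr => j _; rewrite mxE linearN.
case: b => /=; first by rewrite mulr1 pd.
rewrite mulrN scaleNr -gbaseM pdN pd /letter /= psiV.
have := du g (nth 1%g gens i)^-1%g (nth 1%g gens i).
by rewrite mulVg derivation1 // psiV => /esym/eqP; rewrite addr_eq0 => /eqP ->.
Qed.
End FoxCalculus.

Ltac row_abelian := apply/rowP => ?; rewrite !mxE; malg_abelian.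

Lemma In_nth_ex (T : Type) (s : seq T) d x : List.In x s -> exists2 i, (i < size s)%N & nth d s i = x.
Proof. by elim: s => //= a s ih [->|/ih[i lt e]]; [exists 0%N|exists i.+1]. Qed.

Lemma augD (G : groupType) (u v : galg G) : aug (u + v) = aug u + aug v :> rat.
Proof. exact: linearD. Qed.
Lemma aug0 (G : groupType) : aug (0 : galg G) = 0 :> rat.
Proof. exact: linear0. Qed.
Lemma augN (G : groupType) (u : galg G) : aug (- u) = - aug u :> rat.
Proof. exact: linearN. Qed.
Lemma augZ (G : groupType) a (u : galg G) : aug (a *: u) = a * aug u :> rat.
Proof. exact: linearZ. Qed.

(** * Presentations and functionals on relators *)

Section AugmentedPairing.
Variables (Gam : groupType) (c : nat) (h : 'I_c -> rat).
Local Notation R := (galg Gam).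
Implicit Types p q : 'rV[R]_c.

Definition augpair p : rat := \sum_i (aug (p 0 i) : rat) * h i.

Lemma augpairD p q : augpair (p + q) = augpair p + augpair q.
Proof.
rewrite /augpair -big_split; apply: eq_bigr => i _.
by rewrite mxE augD mulrDl.
Qed.

Lemma augpairZ r p : augpair (r *: p) = aug r * augpair p.
Proof.
rewrite /augpair mulr_sumr; apply: eq_bigr => i _.
by rewrite mxE augM mulrA.
Qed.

Lemma augpair_gbase g p : augpair (gbase g *: p) = augpair p.
Proof. by rewrite augpairZ augB mul1r. Qed.

Lemma augpairN p : augpair (- p) = - augpair p.
Proof. by rewrite -scaleN1r augpairZ augN aug1 mulN1r. Qed.

Lemma augpair_delta i : augpair (delta_mx 0 i) = h i.
Proof.
rewrite /augpair (bigD1 i) //= mxE !eqxx big1 ?addr0 => [|j ji].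
  by rewrite [aug _]augB mul1r.
by rewrite mxE (negbTE ji) andbF aug0 mul0r.
Qed.
End AugmentedPairing.

Section Presentation.
Variables (B : group) (Gam : groupType) (pi : B -> Gam) (gens : seq B) (rels : seq word).
Hypothesis piM : forall x y, pi (x * y)%g = (pi x * pi y)%g.
Hypothesis gensP : forall x, exists w, wf_word (size gens) w /\ evalw gens w = x.
Hypothesis relsP : forall r, List.In r rels -> wf_word (size gens) r /\ evalw gens r = gone B.
Hypothesis presP : forall w, wf_word (size gens) w -> evalw gens w = gone B ->
  releq (size gens) rels w [::].
Local Notation R := (galg Gam).
Local Notation n := (size gens).
Local Notation c := (size rels).
Local Notation fox := (fox pi gens).

Definition fox_rels : 'M[R]_(c, n) := \matrix_(i < c) fox (nth [::] rels i).

Definition rel_span (t : 'rV[R]_n) := exists z : 'rV[R]_c, t = z *m fox_rels.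

Lemma rel_span0 : rel_span 0. Proof. by exists 0; rewrite mul0mx. Qed.
Lemma rel_spanD t t' : rel_span t -> rel_span t' -> rel_span (t + t').
Proof. by move=> [z ->] [z' ->]; exists (z + z'); rewrite mulmxDl. Qed.
Lemma rel_spanZ r t : rel_span t -> rel_span (r *: t).
Proof. by move=> [z ->]; exists (r *: z); rewrite scalemxAl. Qed.
Lemma rel_spanN t : rel_span t -> rel_span (- t).
Proof. by rewrite -scaleN1r; exact: rel_spanZ. Qed.
Lemma rel_spanB t t' : rel_span t -> rel_span t' -> rel_span (t - t').
Proof. by move=> ? /rel_spanN; exact: rel_spanD. Qed.

Lemma rel_span_rel r : List.In r rels -> rel_span (fox r).
Proof.
move=> /(In_nth_ex [::])[i ic <-]; exists (delta_mx 0 (Ordinal ic)).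
by rewrite -rowE rowK.
Qed.

Lemma releq_fox u v : releq n rels u v -> rel_span (fox u - fox v).
Proof.
elim=> {u v} [w|u v _ ih|u v w _ ih1 _ ih2|u v i b _|u v r rR].
- by rewrite subrr; exact: rel_span0.
- by rewrite -opprB; exact: rel_spanN.
- have -> : fox u - fox w = (fox u - fox v) + (fox v - fox w) by rewrite addrA subrK.
  exact: rel_spanD.
- have fc e w : fox (e :: w) = fox_letter pi gens e + gbase (pi (letter gens e)) *: fox w by [].
  have e : fox ((i, b) :: (i, ~~ b) :: v) = fox v.
    rewrite !fc scalerDr scalerA -gbaseM -piM addrA fox_letter_cancel // add0r.
    have -> : (letter gens (i, b) * letter gens (i, ~~ b) = 1)%g.
      by rewrite /letter; case: b => /=; rewrite ?mulgV ?mulVg.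
    by rewrite psi1 // gbase1 scale1r.
  by rewrite !fox_cat // e subrr; exact: rel_span0.
- rewrite !fox_cat // (proj2 (relsP rR)) psi1 // gbase1 scale1r scalerDr.
  set a := fox u; set b := _ *: fox r; set d := _ *: fox v.
  have -> : a + d - (a + (b + d)) = - b by row_abelian.
  by apply: rel_spanN; apply: rel_spanZ; exact: rel_span_rel.
Qed.

Lemma fox_eq u v : wf_word n u -> wf_word n v -> evalw gens u = evalw gens v ->
  rel_span (fox u - fox v).
Proof.
move=> wu wv e; have wi := wf_cat wu (wf_inv wv).
have := releq_fox (presP wi _); rewrite evalw_cat evalw_inv e mulgV => /(_ erefl).
rewrite fox_cat // fox_inv // scalerN scalerA -gbaseM -piM e mulgV psi1 // gbase1 scale1r.
by rewrite subr0.
Qed.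

Lemma word_choice : {W : B -> word | forall x, wf_word n (W x) /\ evalw gens (W x) = x}.
Proof.
have [W WP] := @choice B word (fun x w => wf_word n w /\ evalw gens w = x) gensP.
by exists W.
Qed.

(** Stands for x - 1 in R (x) I_B, presented as R^n modulo the rows of the relators; modulo
    [rel_span] the choice of the word is immaterial. *)
Definition fox_of (x : B) : 'rV[R]_n := fox (projT1 word_choice x).
Local Notation Z := fox_of.

Lemma fox_ofP w : wf_word n w -> rel_span (fox w - Z (evalw gens w)).
Proof. by move=> wn; have [w1 w2] := projT2 word_choice (evalw gens w); apply: fox_eq. Qed.

Lemma fox_of1 : rel_span (Z 1%g).
Proof. by rewrite -[Z _]opprK -[- Z _]add0r; apply/rel_spanN/(fox_ofP (w := [::])). Qed.

(** The coboundary of [fox_of] in R^n; its values lie in the span of the relators, where it need not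
    be a coboundary. *)
Definition fox_defect x y := Z x + gbase (pi x) *: Z y - Z (x * y)%g.

Lemma fox_defectP x y : rel_span (fox_defect x y).
Proof.
have [wx ex] := projT2 word_choice x; have [wy ey] := projT2 word_choice y.
have := fox_ofP (wf_cat wx wy); rewrite fox_cat // evalw_cat ex ey; exact.
Qed.

Section Functional.
Variable phi : 'I_c -> rat.
Hypothesis phi_ker : forall z, z *m fox_rels = 0 -> augpair phi z = 0.

(** The functional phi carried over to the span of the relator rows; [phi_ker] makes it independent
    of the coefficients chosen, and outside the span 0 is a default value. *)
Definition rel_val (t : 'rV[R]_n) : rat :=
  if pselect (rel_span t) is left h then augpair phi (projT1 (cid h)) else 0.

Lemma rel_valE z : rel_val (z *m fox_rels) = augpair phi z.
Proof.
rewrite /rel_val; case: pselect => [h|[]]; last by exists z.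
have e := projT2 (cid h); apply/eqP; rewrite -subr_eq0 -augpairN -augpairD.
by apply/eqP/phi_ker; rewrite mulmxBl -e subrr.
Qed.

Lemma rel_valD t t' : rel_span t -> rel_span t' -> rel_val (t + t') = rel_val t + rel_val t'.
Proof. by move=> [z ->] [z' ->]; rewrite -mulmxDl !rel_valE augpairD. Qed.

Lemma rel_valZ r t : rel_span t -> rel_val (r *: t) = aug r * rel_val t.
Proof. by move=> [z ->]; rewrite scalemxAl !rel_valE augpairZ. Qed.

Lemma rel_valN t : rel_span t -> rel_val (- t) = - rel_val t.
Proof. by move=> [z ->]; rewrite -mulNmx !rel_valE augpairN. Qed.

Lemma rel_valB t t' : rel_span t -> rel_span t' -> rel_val (t - t') = rel_val t - rel_val t'.
Proof. by move=> st st'; rewrite rel_valD ?rel_valN //; exact: rel_spanN. Qed.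

Lemma rel_val0 : rel_val 0 = 0.
Proof. by rewrite -(mul0mx _ fox_rels) rel_valE /augpair big1 // => i _; rewrite mxE aug0 mul0r. Qed.

Lemma rel_val_sum (I : Type) (s : seq I) (a : I -> R) (t : I -> 'rV[R]_n) :
  (forall i, rel_span (t i)) ->
  rel_val (\sum_(i <- s) a i *: t i) = \sum_(i <- s) aug (a i) * rel_val (t i).
Proof.
move=> st; have : rel_span (\sum_(i <- s) a i *: t i) /\
    rel_val (\sum_(i <- s) a i *: t i) = \sum_(i <- s) aug (a i) * rel_val (t i).
  elim: s => [|i s [ih1 ih2]]; first by rewrite !big_nil rel_val0; split=> //; exact: rel_span0.
  rewrite !big_cons; split; first by apply: rel_spanD => //; exact: rel_spanZ.
  by rewrite rel_valD ?rel_valZ ?ih2 //; exact: rel_spanZ.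
by case.
Qed.
End Functional.
End Presentation.

Section RelatorFunctional.
Variables (A B : group) (f : A -> B) (m : nat) (Gam : groupType) (pi : B -> Gam).
Variables (gensA : seq A) (gens : seq B) (rels : seq word).
Hypotheses (fM : ishom f) (mono : H1_mono f) (epi : H2_mod_Phi_epi m f).
Hypothesis piM : forall x y, pi (x * y)%g = (pi x * pi y)%g.
Hypothesis pi_derived : forall x, derived B m x -> pi x = 1%g.
Hypothesis gensAP : forall x, exists w, wf_word (size gensA) w /\ evalw gensA w = x.
Hypothesis gensP : forall x, exists w, wf_word (size gens) w /\ evalw gens w = x.
Hypothesis relsP : forall r, List.In r rels -> wf_word (size gens) r /\ evalw gens r = gone B.
Hypothesis presP : forall w, wf_word (size gens) w -> evalw gens w = gone B ->
  releq (size gens) rels w [::].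
Local Notation R := (galg Gam).
Local Notation n := (size gens).
Local Notation l := (size gensA).
Local Notation c := (size rels).
Local Notation psi := (fun a : A => pi (f a)).
Local Notation foxA := (fox psi gensA).
Local Notation fox := (fox pi gens).
Local Notation Z := (fox_of pi gensP).
Local Notation Y := (fox_of psi gensAP).
Local Notation dR := (fox_rels pi gens rels).
Local Notation span := (@rel_span B Gam pi gens rels).
Local Notation null := (@null A Gam psi gensA).

Lemma psiM a b : psi (a * b)%g = (psi a * psi b)%g.
Proof. by rewrite /= (homM _ _ fM) piM. Qed.

Definition fox_gens : 'M[R]_(l, n) := \matrix_(j < l) Z (f (nth 1%g gensA j)).
Local Notation dA := fox_gens.

Let span_defect x y : span (fox_defect pi gensP x y).
Proof. exact: fox_defectP. Qed.

Let nth_In_rels (i : 'I_c) : List.In (nth [::] rels i) rels.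
Proof. by apply: In_mem; exact: mem_nth. Qed.

Let span1 : span (Z 1%g).
Proof. exact: fox_of1. Qed.

Lemma span_inv x : span (Z x^-1%g + gbase (pi x^-1%g) *: Z x).
Proof.
have := rel_spanD (span_defect x^-1%g x) span1.
by rewrite /fox_defect mulVg subrK.
Qed.

(** The chain rule of the Fox calculus for f, valid modulo the relators of B. *)
Lemma foxA_gens w : wf_word l w -> span (foxA w *m dA - Z (f (evalw gensA w))).
Proof.
elim: w => [|[i b] w ih] wn.
  by rewrite mul0mx sub0r evalw_nil (hom1 fM); apply: rel_spanN.
have [/= il /ih sw] := wf_cons wn.
set x := letter gensA (i, b); rewrite evalw_cons -/x (homM _ _ fM).
have sl : span (fox_letter psi gensA (i, b) *m dA - Z (f x)).
  have ed : \row_(j < l) ((i == j)%:R : R) *m dA = Z (f (nth 1%g gensA i)).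
    have -> : \row_(j < l) ((i == j)%:R : R) = delta_mx 0 (Ordinal il).
      by apply/rowP => j; rewrite !mxE eqxx /= eq_sym.
    by rewrite -rowE rowK.
  rewrite /fox_letter -scalemxAl ed /x /letter; case: (b) => /=.
    by rewrite scale1r subrr; exact: rel_span0.
  rewrite (homV _ fM) scaleNr -opprD addrC; apply: rel_spanN; exact: span_inv.
have := rel_spanD (rel_spanD sl (rel_spanZ (gbase (pi (f x))) sw)) (span_defect (f x) (f (evalw gensA w))).
congr span; rewrite /= mulmxDl -scalemxAl scalerBr /fox_defect.
set p := _ *m dA; set q := _ *: (_ *m dA); set z := Z (f x); set z' := _ *: Z _; set z'' := Z _.
by row_abelian.
Qed.

Lemma fox_of_gens a : span (Y a *m dA - Z (f a)).
Proof.
have [wn we] := projT2 (word_choice gensAP) a.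
by have := foxA_gens wn; rewrite we.
Qed.

Lemma null_fox w w' : wf_word l w -> wf_word l w' -> evalw gensA w = evalw gensA w' ->
  null (foxA w - foxA w').
Proof.
move=> wn w'n e u du; rewrite pair_derD -scaleN1r.
rewrite -[-1]scale1r scalerN -scaleNr pair_derZ !(pair_fox psiM) // e.
by rewrite mulN1r subrr.
Qed.

Lemma null_defect a b : null (fox_defect psi gensAP a b).
Proof.
move=> u du; have [wa ea] := projT2 (word_choice gensAP) a.
have [wb eb] := projT2 (word_choice gensAP) b.
have [wab eab] := projT2 (word_choice gensAP) (a * b)%g.
have := null_fox (wf_cat wa wb) wab; rewrite evalw_cat ea eb eab => /(_ erefl u du).
by rewrite fox_cat ?ea //; exact: psiM.
Qed.

Variables (phi : 'I_c -> rat) (ps : 'I_l -> rat).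
Hypothesis kill : forall z y, z *m dR + y *m dA = 0 -> null y -> augpair phi z + augpair ps y = 0.

Let phi_ker z : z *m dR = 0 -> augpair phi z = 0.
Proof.
move=> z0; have := kill (z := z) (y := 0); rewrite mul0mx addr0 => /(_ z0 (null0 _)).
by rewrite /augpair [X in _ + X]big1 ?addr0 // => i _; rewrite mxE aug0 mul0r.
Qed.

Local Notation val := (@rel_val B Gam pi gens rels phi).
Local Notation T := (fox_defect pi gensP).

Let val_null y : null y -> span (y *m dA) -> val (y *m dA) = augpair ps y.
Proof.
move=> ny [z ez]; rewrite ez (rel_valE phi_ker).
have := kill (z := - z) (y := y); rewrite mulNmx ez addNr => /(_ erefl ny).
by rewrite augpairN => /eqP; rewrite addrC subr_eq0 => /eqP.
Qed.

(* The functional [phi] on relators defines a central extension of [B] by Q, with cocycle the value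
   of [phi] on the relator [fox_defect x y]; a splitting extending [ps] yields the coefficients [d]. *)
Lemma relator_functional : exists d : 'I_n -> rat,
  (forall i, phi i = augpair d (row i dR)) /\ (forall j, ps j = augpair d (row j dA)).
Proof.
(* C is the extension cocycle. Its pullback to A is the coboundary of g, which combines the
   prescribed values ps with the error made in replacing the Fox row of f(a) by Y(a) dA. *)
pose C x y := val (fox_defect pi gensP x y) : rat^o.
pose g a := augpair ps (Y a) - val (Y a *m dA - Z (f a)) : rat^o.
have valD := rel_valD phi_ker; have valZ := rel_valZ phi_ker; have valB := rel_valB phi_ker.
have valG h t : span t -> val (gbase h *: t) = val t.
  by move=> st; rewrite valZ // augB mul1r.
have s0 : subsp (fun q : rat^o => q = 0).
  by split=> // a u v -> ->; rewrite scaler0 addr0.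
have s1 : subsp (fun q : rat^o => True) by split.
have valS x y : val (T x y) = C x y by [].
have spanD x y : span (T x y) by exact: span_defect.
have val4 t1 t2 t3 t4 : span t1 -> span t2 -> span t3 -> span t4 ->
    val (t1 - t2 + t3 - t4) = val t1 - val t2 + val t3 - val t4.
  move=> h1 h2 h3 h4; have h12 := rel_spanB h1 h2; have h123 := rel_spanD h12 h3.
  by rewrite (valB _ _ h123 h4) (valD _ _ h12 h3) (valB _ _ h1 h2).
have val3 t1 t2 t3 : span t1 -> span t2 -> span t3 -> val (t1 + t2 + t3) = val t1 + val t2 + val t3.
  by move=> h1 h2 h3; rewrite (valD _ _ (rel_spanD h1 h2) h3) (valD _ _ h1 h2).
have [||||w wz sw|a b|h [_ hM hf]] := extend_cochain (c := C) (g := g) fM mono epi s0 s1.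
- by [].
- by [].
- by [].
- move=> x y z.
  have <- : val (gbase (pi x) *: T y z - T (x * y)%g z + T x (y * z)%g - T x y) =
      C y z - C (x * y)%g z + C x (y * z)%g - C x y.
    by rewrite val4 ?valG //; exact: rel_spanZ.
  rewrite -[RHS](rel_val0 phi_ker); congr (val _).
  rewrite /fox_defect scalerBr scalerDr scalerA -gbaseM -piM mulgA.
  set z1 := _ *: Z y; set z2 := _ *: Z z; set z3 := _ *: Z (y * z)%g.
  by move: (Z x) (Z (x * y)%g) (Z _) z1 z2 z3 => z4 z5 z6 z1 z2 z3; row_abelian.
(* The map pi is trivial on B^(m), so on a cycle supported there the defects are Z x + Z y - Z(xy),
   whose weighted sum is 0. *)
- rewrite lin_mchain.
  transitivity (\sum_(p <- w) (aug (p.1 *: 1 : R) : rat) * val (T p.2.1 p.2.2)).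
    by apply: eq_bigr => p _; rewrite augZ aug1 mulr1.
  rewrite -(rel_val_sum phi_ker) // -[RHS](rel_val0 phi_ker); congr (val _).
  apply/rowP => j; rewrite summxE mxE.
  have := congr1 (lin (fun x => Z x 0 j)) wz; rewrite lin_bd2 linear0 lin_mchain => e.
  rewrite -[RHS]e; apply: eq_big_seq => p /In_mem/sw[/pi_derived p1 _].
  by rewrite /fox_defect p1 gbase1 scale1r !mxE -scalerAl mul1r.
(* The defect y of the Fox rows of A is null, so phi on y dA equals ps on y; expanding both sides
   relates C to g. *)
- pose y := fox_defect psi gensAP a b; have ny : null y by exact: null_defect.
  pose Da a := Y a *m dA - Z (f a).
  have sD a' : span (Da a') by exact: fox_of_gens.
  have ey : y *m dA = T (f a) (f b) + Da a + gbase (psi a) *: Da b - Da (a * b)%g.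
    rewrite /y /Da /fox_defect mulmxBl mulmxDl -scalemxAl scalerBr -(homM _ _ fM).
    set p := Y a *m dA; set q := Y b *m dA; set r := Y (a * b)%g *m dA.
    by set q' := _ *: q; set z1 := Z (f a); set z2 := _ *: Z _; set z3 := Z _; row_abelian.
  have sy : span (y *m dA).
    by rewrite ey; apply: rel_spanB => //; apply: rel_spanD; [exact: rel_spanD|exact: rel_spanZ].
  have := val_null ny sy; have sDb := rel_spanZ (gbase (pi (f a))) (sD b).
  rewrite {1}ey (valB _ _ (rel_spanD (rel_spanD (spanD _ _) (sD a)) sDb) (sD _)) val3 // valG //.
  rewrite valS /y /fox_defect !augpairD augpairN augpair_gbase /g -/(Da a) -/(Da b) -/(Da (a * b)%g).
  move=> e; apply/eqP; rewrite subr_eq0; apply/eqP; move: e.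
  set v1 := val (Da a); set v2 := val (Da b); set v3 := val _.
  set u1 := augpair ps _; set u2 := augpair ps _; set u3 := augpair ps _; lra.
(* h splits the extension over B. Adding the value of phi on the difference between the row of w and
   the chosen row gives a function additive on words, hence a functional of Fox rows with
   coefficients d. *)
pose Hw w := h (evalw gens w) + val (fox w - Z (evalw gens w)) : rat.
have sw w : wf_word n w -> span (fox w - Z (evalw gens w)) by exact: fox_ofP.
have Hadd u v : wf_word n u -> wf_word n v -> Hw (u ++ v) = Hw u + Hw v.
  move=> wu wv; rewrite /Hw evalw_cat fox_cat //.
  set x := evalw gens u; set x' := evalw gens v.
  have -> : fox u + gbase (pi x) *: fox v - Z (x * x')%g =
      (fox u - Z x) + gbase (pi x) *: (fox v - Z x') + T x x'.
    by rewrite /fox_defect scalerBr; set p := _ *: fox v; set q := _ *: Z _; row_abelian.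
  rewrite (val3 _ _ _ (sw _ wu) (rel_spanZ _ (sw _ wv)) (spanD _ _)) (valG _ _ (sw _ wv)) valS.
  have := hM x x'; set k := C x x'; set v1 := val _; set v2 := val _ => e.
  have {e}: (h x : rat) + h x' - h (x * x')%g - k = 0 := e.
  lra.
have H0 : Hw [::] = 0 by have := Hadd [::] [::] (fun _ => @False_ind _) (fun _ => @False_ind _); rewrite /=; lra.
have wf1 i b : (i < n)%N -> wf_word n [:: (i, b)] by move=> lt e [<-|[]].
have Hinv i : (i < n)%N -> Hw [:: (i, false)] = - Hw [:: (i, true)].
  move=> lt; have := Hadd _ _ (wf1 i true lt) (wf1 i false lt).
  have -> : Hw ([:: (i, true)] ++ [:: (i, false)]) = Hw [::].
    have e1 : evalw gens ([:: (i, true)] ++ [:: (i, false)]) = evalw gens [::].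
      by rewrite !evalw_cons evalw_nil mulg1 /letter mulgV.
    have e2 : fox ([:: (i, true)] ++ [:: (i, false)]) = fox [::].
      by rewrite /= scaler0 addr0 fox_letter_cancel.
    by rewrite /Hw e1 e2.
  by rewrite H0 => /esym/eqP; rewrite addrC addr_eq0 => /eqP.
pose d (j : 'I_n) := Hw [:: (nat_of_ord j, true)].
have Hd w : wf_word n w -> Hw w = augpair d (fox w).
  elim: w => [_|[i b] w ih wn].
    by rewrite H0 /augpair big1 // => j _; rewrite mxE aug0 mul0r.
  have [/= il wn'] := wf_cons wn.
  rewrite -cat1s Hadd //; last exact: wf1.
  rewrite ih //= augpairD augpair_gbase; congr (_ + _).
  have ed : \row_(j < n) ((i == j)%:R : R) = delta_mx 0 (Ordinal il).
    by apply/rowP => j; rewrite !mxE eqxx /= eq_sym.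
  rewrite /fox_letter augpairZ ed augpair_delta /d /=.
  case: b {wn} => /=; first by rewrite aug1 mul1r.
  by rewrite Hinv // augN augB mulN1r.
exists d; split=> [i|j].
  have [wr er] := relsP (nth_In_rels i); rewrite goneE in er.
  have -> : row i dR = fox (nth [::] rels i) by rewrite rowK.
  rewrite -Hd // /Hw er.
  have sr : span (fox (nth [::] rels i)) by apply: rel_span_rel; exact: nth_In_rels.
  rewrite (valB _ _ sr span1).
  have -> : val (fox (nth [::] rels i)) = phi i.
    have -> : fox (nth [::] rels i) = delta_mx 0 i *m dR by rewrite -rowE rowK.
    by rewrite (rel_valE phi_ker) augpair_delta.
  move: H0; rewrite /Hw evalw_nil /= sub0r (rel_valN phi_ker span1).
  set v1 := val _; set h1 := h _ => e; have {e}: (h1 : rat) - v1 = 0 := e.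
  by rewrite -/h1; lra.
have [wj ej] := projT2 (word_choice gensP) (f (nth 1%g gensA j)).
have -> : row j dA = fox (projT1 (word_choice gensP) (f (nth 1%g gensA j))) by rewrite rowK.
rewrite -Hd // /Hw ej -/(fox_of _ _ _) subrr (rel_val0 phi_ker) addr0.
set aj := nth 1%g gensA j.
have jw : wf_word l [:: (nat_of_ord j, true)] by move=> e [<-|[]] /=.
have ed : foxA [:: (nat_of_ord j, true)] = delta_mx 0 j.
  rewrite /= scaler0 addr0 /fox_letter /= scale1r.
  by apply/rowP => k; rewrite !mxE eqxx /= eq_sym.
have [wa ea] := projT2 (word_choice gensAP) aj.
have ny : null (delta_mx 0 j - Y aj).
  rewrite -ed; apply: null_fox => //.
  by rewrite ea evalw_cons evalw_nil mulg1.
have e1 : (delta_mx 0 j - Y aj) *m dA = - (Y aj *m dA - Z (f aj)).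
  by rewrite mulmxBl -rowE rowK opprB.
have sy := fox_of_gens aj.
have := val_null ny; rewrite e1 => /(_ (rel_spanN sy)).
rewrite (rel_valN phi_ker sy) augpairD augpairN augpair_delta.
have := hf aj; rewrite /g; set h1 := h _; set v1 := val _; set u := augpair ps _ => e.
have {e}: (h1 : rat) - (u - v1) = 0 := e.
lra.
Qed.
End RelatorFunctional.

(** * Relations over Q[Gamma] and their A-parts *)

Lemma rat_separating N (E : 'rV[rat]_N -> Prop) v : subsp E -> ~ E v ->
  exists h : 'I_N -> rat, (forall e, E e -> \sum_i e 0 i * h i = 0) /\ \sum_i v 0 i * h i != 0.
Proof.
move=> sE nEv.
pose S (u : 'rV[rat]_N) (w : rat^o) := exists2 e, E e & u = e + (w : rat) *: v.
have linS : linear_rel S.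
  split; first by exists 0; rewrite ?scale0r ?addr0 //; exact: subsp0.
  move=> a u w u' w' [e Ee ->] [e' Ee' ->]; exists (a *: e + e'); first exact: subspP.
  by rewrite scalerDr scalerDl scalerA addrACA.
have S00 w : S 0 w -> w = 0.
  move=> [e Ee /esym/eqP]; rewrite addr_eq0 => /eqP ee.
  have [//|w0] := eqVneq w 0; case: nEv.
  rewrite -[v]scale1r -[1](mulVf w0) -scalerA -[_ *: v]opprK -ee.
  by apply: (subspZ sE); exact: subspN.
have [S' [[S'0 S'l] SS' _ S'0S tot]] := linear_rel_total (W1 := fun=> True) linS (fun _ _ _ => I).
have [h hP] : {h : 'I_N -> rat^o & forall i, S' (delta_mx 0 i) (h i)}.
  by apply: (@choice 'I_N rat^o (fun i w => S' (delta_mx 0 i) w)) => i; exact: tot.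
have S'h u : S' u (\sum_i u 0 i * h i).
  rewrite {1}[u]row_sum_delta; elim/big_rec2: _ => // i w u' _ ih.
  exact: (S'l (u 0 i)).
have S'f u w : S' u w -> \sum_i u 0 i * h i = w.
  move=> S'w; have := S'l (-1) _ _ _ _ S'w (S'h u); rewrite scaleN1r addNr => /S'0S/S00.
  by rewrite scaleN1r addrC => /eqP; rewrite subr_eq0 => /eqP.
exists h; split=> [e Ee|].
  by apply: S'f; apply: SS'; exists e => //; rewrite scale0r addr0.
rewrite (S'f v 1) ?oner_eq0 //; apply: SS'; exists 0; rewrite ?add0r ?scale1r //.
exact: subsp0.
Qed.

Definition aug_mx (G : groupType) p q (M : 'M[galg G]_(p, q)) : 'M[rat]_(p, q) :=
  \matrix_(i, j) (aug (M i j) : rat).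

Lemma pair_fox_of (D : group) (Gam : groupType) (psi : D -> Gam) (gens : seq D)
    (gensP : forall x, exists w, wf_word (size gens) w /\ evalw gens w = x) u x s :
  (forall x y, psi (x * y)%g = (psi x * psi y)%g) -> derivation psi u ->
  pair_der u (s *: fox_of psi gensP x) = lin (fun g => u g x : rat^o) s.
Proof.
move=> psiM du; have [wx ex] := projT2 (word_choice gensP) x.
elim/galg_ind: s => [g||p q hp hq|a p hp].
- rewrite lin_gbase pair_der_gbase /fox_of (pair_fox psiM (derivation_shift _ du) wx).
  by rewrite ex mulg1.
- by rewrite linear0 scale0r (null0 _ du).
- by rewrite scalerDl pair_derD linearD /= hp hq.
- by rewrite linearZ /= -hp -[p in LHS]mul1r scalerAl -scalerA pair_derZ.
Qed.

Section Pullback.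
Variables (A B : group) (f : A -> B) (m : nat) (Gam : groupType) (pi : B -> Gam).
Variables (gensA : seq A) (gens : seq B) (rels : seq word).
Hypotheses (fM : ishom f) (mono : H1_mono f) (epi : H2_mod_Phi_epi m f).
Hypothesis piM : forall x y, pi (x * y)%g = (pi x * pi y)%g.
Hypothesis pi_derived : forall x, derived B m x -> pi x = 1%g.
Hypothesis gensAP : forall x, exists w, wf_word (size gensA) w /\ evalw gensA w = x.
Hypothesis gensP : forall x, exists w, wf_word (size gens) w /\ evalw gens w = x.
Hypothesis relsP : forall r, List.In r rels -> wf_word (size gens) r /\ evalw gens r = gone B.
Hypothesis presP : forall w, wf_word (size gens) w -> evalw gens w = gone B ->
  releq (size gens) rels w [::].
Variables (k : nat) (P : nat -> Gam -> Prop).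
Hypothesis tP : tfchain k P.
Local Notation R := (galg Gam).
Local Notation n := (size gens).
Local Notation l := (size gensA).
Local Notation c := (size rels).
Local Notation psi := (fun a : A => pi (f a)).
Local Notation Z := (fox_of pi gensP).
Local Notation Y := (fox_of psi gensAP).
Local Notation dR := (fox_rels pi gens rels).
Local Notation dA := (fox_gens f pi gensA gensP).
Local Notation span := (@rel_span B Gam pi gens rels).
Local Notation null := (@null A Gam psi gensA).
Local Notation dd := (col_mx dR dA).

Lemma null_sum (I : Type) (r : seq I) (F : I -> 'rV[R]_l) :
  (forall i, null (F i)) -> null (\sum_(i <- r) F i).
Proof. by move=> nF; apply: big_ind => //; [exact: null0|exact: nullD]. Qed.

(* By duality: a functional killing the augmentations of all liftable vectors is, by
   [relator_functional], induced by a functional on the columns of [dd], so it kills [v]. *)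
Lemma lift_kernel (v : 'rV[rat]_(c + l)) : v *m aug_mx dd = 0 ->
  exists p : 'rV[R]_(c + l), [/\ p *m dd = 0, null (rsubmx p) & aug_mx p = v].
Proof.
move=> vd; pose E (v : 'rV[rat]_(c + l)) :=
  exists p : 'rV[R]_(c + l), [/\ p *m dd = 0, null (rsubmx p) & aug_mx p = v].
have sE : subsp E.
  split.
    exists 0; split; rewrite ?mul0mx //.
      by rewrite linear0; exact: null0.
    by apply/rowP => i; rewrite !mxE aug0.
  move=> a u u' [p [p1 p2 <-]] [p' [p'1 p'2 <-]]; exists ((a *: 1 : R) *: p + p'); split.
  - by rewrite mulmxDl -scalemxAl p1 p'1 scaler0 addr0.
  - have -> : rsubmx ((a *: 1 : R) *: p + p') = (a *: 1 : R) *: rsubmx p + rsubmx p'.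
      by apply/rowP => i; rewrite !mxE.
    by apply: nullD => //; exact: nullZ.
  - by apply/rowP => i; rewrite !mxE augD augM augZ aug1 mulr1.
have [//|nEv] := pselect (E v).
have [h [hE]] := rat_separating sE nEv; case/eqP.
pose phi i := h (lshift l i); pose ps j := h (rshift c j).
have split_sum (p : 'rV[R]_c) (y : 'rV[R]_l) :
    augpair phi p + augpair ps y = \sum_i aug_mx (row_mx p y) 0 i * h i.
  rewrite big_split_ord; congr (_ + _); apply: eq_bigr => i _.
    by rewrite mxE row_mxEl.
  by rewrite mxE row_mxEr.
have kill z y : z *m dR + y *m dA = 0 -> null y -> augpair phi z + augpair ps y = 0.
  move=> e ny; rewrite split_sum; apply: hE; exists (row_mx z y).
  by rewrite mul_row_col row_mxKr.
have [d [d1 d2]] := relator_functional fM mono epi piM pi_derived gensAP relsP presP kill.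
have hd i : h i = augpair d (row i dd).
  rewrite -[i]fintype.splitK; case: (fintype.split i) => j /=.
    by rewrite -/(phi j) d1; congr augpair; apply/rowP => q; rewrite !mxE (unsplitK (inl j)) !mxE.
  by rewrite -/(ps j) d2; congr augpair; apply/rowP => q; rewrite !mxE (unsplitK (inr j)) !mxE.
transitivity (\sum_q (v *m aug_mx dd) 0 q * d q); last first.
  by rewrite vd big1 // => q _; rewrite mxE mul0r.
under [RHS]eq_bigr do rewrite mxE mulr_suml; rewrite exchange_big; apply: eq_bigr => i _.
rewrite hd /augpair mulr_sumr; apply: eq_bigr => q _.
by rewrite ![aug_mx _ _ _]mxE mulrA [row _ _ _ _]mxE.
Qed.

(* Lifts of a basis of the kernel of [aug_mx dd], a basis of a complement and [v] are c + l + 1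
   vectors of length c + l, hence dependent; Strebel's lemma kills the coefficients of the complement. *)
Lemma kernel_torsion (v : 'rV[R]_(c + l)) : v *m dd = 0 ->
  exists2 r : R, r != 0 & null (rsubmx (r *: v)).
Proof.
move=> vd; set K := kermx (aug_mx dd).
have [Pm PmP] : {Pm : 'I_(\rank K) -> 'rV[R]_(c + l) & forall i,
    [/\ Pm i *m dd = 0, null (rsubmx (Pm i)) & aug_mx (Pm i) = row i (row_base K)]}.
  apply: (@choice _ _ (fun i p => [/\ p *m dd = 0, null (rsubmx p) & aug_mx p = row i (row_base K)])) => i.
  by apply: lift_kernel; apply/sub_kermxP; rewrite (submx_trans (row_sub _ _)) // eq_row_base.
pose Qm (j : 'I_(\rank K^C)) : 'rV[R]_(c + l) := \row_q ((row_base K^C)%MS j q *: 1).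
pose M (i : 'I_1 + ('I_(\rank K) + 'I_(\rank K^C))) (q : 'I_(c + l)) : R :=
  match i with inl _ => v 0 q | inr (inl i) => Pm i 0 q | inr (inr j) => Qm j 0 q end.
have [||w [_ w0 wM]] := tf_dependent tP (M := M); [|by []|].
  by rewrite !card_sum !card_ord mxrank_compl subnKC ?rank_leq_row.
pose r := w (inl 0); pose al i := w (inr (inl i)); pose be j := w (inr (inr j)).
have rel : r *: v + (\sum_i al i *: Pm i + \sum_j be j *: Qm j) = 0.
  apply/rowP => q; have := wM q; rewrite !big_sumType big_ord1 /= => e.
  rewrite [RHS]mxE -[RHS]e !mxE !summxE.
  by congr (_ + (_ + _)); apply: eq_bigr => i _; rewrite mxE.
have Qd0 : \sum_j be j *: (Qm j *m dd) = 0.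
  have := congr1 (mulmx^~ dd) rel; rewrite /= !mulmxDl mul0mx -scalemxAl vd scaler0 add0r.
  rewrite !mulmx_suml big1 ?add0r => [e|i _].
    by rewrite -[RHS]e; apply: eq_bigr => j _; rewrite scalemxAl.
  by rewrite -scalemxAl; case: (PmP i) => -> _ _; rewrite scaler0.
(* The complement meets the kernel of [aug_mx dd] in 0, so the products of its basis with dd have
   independent augmentations and Strebel's lemma applies. *)
have be0 j : be j = 0.
  apply: (strebel (M := fun j q => (Qm j *m dd) 0 q) tP _) => [x xM j0|q]; last first.
    have := congr1 (fun t : 'rV_n => t 0 q) Qd0; rewrite summxE [RHS]mxE => e; rewrite -[RHS]e.
    by apply: eq_bigr => j0 _; rewrite [RHS]mxE.
  pose xr := \row_j x j; pose u := xr *m row_base K^C%MS.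
  have ud : u *m aug_mx dd = 0.
    apply/rowP => q; rewrite [RHS]mxE -[RHS](xM q) -mulmxA mxE; apply: eq_bigr => j1 _.
    rewrite mxE; congr (_ * _); rewrite mxE mxE aug_sum; apply: eq_bigr => i _.
    by rewrite augM !mxE augZ aug1 mulr1.
  have uK : (u <= K)%MS by apply/sub_kermxP.
  have uC : (u <= K^C)%MS by rewrite (submx_trans (submxMl _ _)) // eq_row_base.
  have u0 : u = 0 by apply/eqP; rewrite -submx0 -(capmx_compl K) sub_capmx uK.
  have : xr == 0 by rewrite -(mulmx_free_eq0 xr (row_base_free K^C%MS)) -/u u0.
  by move/eqP/rowP/(_ j0); rewrite !mxE.
have relP : r *: v = - \sum_i al i *: Pm i.
  apply/eqP; rewrite -addr_eq0; apply/eqP; rewrite -[RHS]rel; congr (_ + _).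
  by rewrite [X in _ = _ + X]big1 ?addr0 // => j _; rewrite be0 scale0r.
exists r; last first.
  have -> : rsubmx (r *: v) = \sum_i (- al i) *: rsubmx (Pm i).
    rewrite relP -sumrN; apply/rowP => q; rewrite mxE !summxE; apply: eq_bigr => i _.
    by rewrite !mxE mulNr.
  by apply: null_sum => i; apply: nullZ; case: (PmP i).
apply: contraPneq w0 => r0 [i]; suff -> : w i = 0 by rewrite eqxx.
(* If r were 0, the lifts Pm would satisfy a relation; they augment to a basis of the kernel, so
   Strebel's lemma makes every coefficient 0. *)
have al0 i0 : al i0 = 0.
  apply: (strebel (M := fun i q => Pm i 0 q) tP _) => [x xM j0|q]; last first.
    have /rowP/(_ q) := relP; rewrite r0 scale0r mxE mxE => /esym/eqP; rewrite oppr_eq0 => /eqP.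
    by rewrite summxE => e; rewrite -[RHS]e; apply: eq_bigr => j0 _; rewrite mxE.
  have : \row_j x j *m row_base K = 0.
    apply/rowP => q; rewrite [RHS]mxE -[RHS](xM q) mxE; apply: eq_bigr => j1 _; rewrite mxE.
    by case: (PmP j1) => _ _ /rowP/(_ q); rewrite !mxE => <-.
  move/eqP; rewrite (mulmx_free_eq0 _ (row_base_free K)) => /eqP/rowP/(_ j0).
  by rewrite !mxE.
case: i => [i|[i|j]]; [by rewrite (ord1 i)|exact: al0|exact: be0].
Qed.

Lemma torsion_pullback (r : R) (x : A) : r != 0 -> span (r *: Z (f x)) ->
  exists2 s : R, s != 0 & forall u, derivation psi u -> lin (fun g => u g x : rat^o) s = 0.
Proof.
move=> r0 [z ez].
have [z' ez'] : span (r *: (Y x *m dA)).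
  have -> : r *: (Y x *m dA) = r *: (Y x *m dA - Z (f x)) + r *: Z (f x).
    by rewrite -scalerDr subrK.
  by apply: rel_spanD; [apply/rel_spanZ/fox_of_gens|exists z].
(* The A-part of this relation is r times the Fox row of x. *)
have [|s s0 ns] := kernel_torsion (v := row_mx (- z') (r *: Y x)).
  by rewrite mul_row_col mulNmx -scalemxAl ez' addNr.
exists (s * r); first exact: galg_domain (tf_unique_products tP) s0 r0.
move=> u du; have := ns u du.
rewrite scale_row_mx row_mxKr scalerA => <-.
by rewrite (pair_fox_of gensAP _ _ (psiM fM piM)) ?mulrA.
Qed.
End Pullback.

(** * The torsion-free derived series *)

Lemma quotient_group (B : group) (N : B -> Prop) : subgrp N -> normal_sub N ->
  exists (Gam : group) (pi : B -> Gam), [/\ ishom pi, forall y, exists x, pi x = y &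
    forall x, pi x = 1%g <-> N x].
Proof.
move=> sN nN; have [rep [rep1 repP]] := coset_rep sN.
have repK x : rep (rep x) = rep x by apply/repP.
pose T := {x : B | rep x = x}.
pose cl x : T := exist _ (rep x) (repK x).
have clP x y : N (x * y^-1)%g -> cl x = cl y by move=> /repP e; apply: eq_exist.
have valK (t : T) : cl (sval t) = t by case: t => x xP; apply: eq_exist.
have clMl x y : cl (rep x * y)%g = cl (x * y)%g.
  by apply: clP; rewrite invgM mulgA mulgK.
have clMr x y : cl (x * rep y)%g = cl (x * y)%g.
  apply: clP; have := nN _ x^-1%g (rep1 y).
  by rewrite /monoid.conjg invgK invgM !mulgA.
pose mul (s t : T) := cl (sval s * sval t)%g.
have mulA : associative mul.
  by move=> s t u; rewrite /mul /= clMl clMr mulgA.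
have mul1 : left_id (cl 1%g) mul by move=> t; rewrite /mul /= clMl mul1g valK.
have mulV : left_inverse (cl 1%g) (fun t : T => cl (sval t)^-1%g) mul.
  by move=> t; rewrite /mul /= clMl mulVg.
exists (@Defs.Group T mul (cl 1%g) (fun t : T => cl (sval t)^-1%g) mulA mul1 mulV), cl; split.
- by move=> x y; apply/esym; rewrite /= /mul /= clMl clMr.
- by move=> t; exists (sval t); exact: valK.
- move=> x; rewrite -goneE /=; split=> [[/repP]|Nx]; first by rewrite invg1 mulg1.
  by apply: clP; rewrite invg1 mulg1.
Qed.

Lemma common_denominator (T : choiceType) (c : {malg rat[T]}) :
  exists2 d : int, d != 0 & exists m : T -> int, forall t, (m t)%:~R = d%:~R * c@_t :> rat.
Proof.
suff [d d0 dP] : exists2 d : int, d != 0 &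
    forall t, t \in finmap.enum_fset (msupp c) -> exists m : int, m%:~R = d%:~R * c@_t :> rat.
  exists d => //; have [|m mP] := @choice T int (fun t m => m%:~R = d%:~R * c@_t :> rat); last by exists m.
  move=> t; case: (boolP (t \in msupp c)) => [|/mcoeff_outdom ->]; first exact: dP.
  by exists 0; rewrite mulr0.
elim: (finmap.enum_fset (msupp c)) => [|t s [d d0 dP]]; first by exists 1.
exists (d * denq c@_t); first by rewrite mulf_neq0 ?denq_neq0.
move=> t'; rewrite inE => /predU1P[->|/dP[m em]].
  exists (d * numq c@_t); rewrite !intrM -mulrA; congr (_ * _).
  by rewrite [in RHS]mulrC -numqE.
by exists (m * denq c@_t); rewrite !intrM em mulrAC.
Qed.

Lemma gprod_hom (D : group) (P : D -> Prop) (chi : D -> rat) s : hom_on P chi -> subgrp P ->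
  (forall x, List.In x s -> P x) -> P (gprod s) /\ chi (gprod s) = \sum_(x <- s) chi x.
Proof.
move=> hchi sP; elim: s => [|x s ih] sPs.
  split; first exact: (subgrp1 sP).
  have := hchi _ _ (subgrp1 sP) (subgrp1 sP); rewrite mulg1 big_nil.
  by move/eqP; rewrite -subr_eq subrr eq_sym => /eqP.
have [Ps es] : P (gprod s) /\ chi (gprod s) = \sum_(x <- s) chi x.
  by apply: ih => y ys; apply: sPs; right.
have Px : P x by apply: sPs; left.
by split; [exact: (subgrpM sP)|rewrite big_cons -es; exact: hchi].
Qed.

(** * Torsion detected by derivations *)

Section TorsionWitness.
Variables (D : group) (Gam : groupType) (psi : D -> Gam).
Hypothesis psiM : forall x y, psi (x * y)%g = (psi x * psi y)%g.
Local Notation R := (galg Gam).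
Local Notation N := (fun x => psi x = 1%g).

Let psi1 := psi1 psiM.
Let psiV := psiV psiM.

Lemma ker_subgrp : subgrp N.
Proof. by split=> [|x y ex ey|x ex]; rewrite ?psiM ?psiV ?ex ?ey ?mulg1 ?invg1. Qed.

Lemma ker_normal : normal_sub N.
Proof. by move=> x g ex; rewrite /monoid.conjg !psiM psiV ex mul1g mulVg. Qed.

(** As psi need not be onto, D acts on Gam with several orbits g psi(D); o chooses a point in each
    and s an element of D carrying it to g. *)
Lemma orbit_section : exists (o : Gam -> Gam) (s : Gam -> D),
  (forall g, g = (o g * psi (s g))%g) /\ (forall g a, o (g * psi a)%g = o g).
Proof.
pose Im g := exists a, psi a = g.
have sIm : subgrp Im.
  split; first by exists 1%g; exact: psi1.
    by move=> _ _ [a <-] [b <-]; exists (a * b)%g; exact: psiM.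
  by move=> _ [a <-]; exists a^-1%g; exact: psiV.
have [rep [rep1 repP]] := coset_rep sIm; pose o g := ((rep g^-1)^-1)%g.
have [s sP] : {s : Gam -> D & forall g, psi (s g) = (rep g^-1 * g)%g}.
  apply: (@choice Gam D (fun g a => psi a = (rep g^-1 * g)%g)) => g.
  by have := rep1 g^-1%g; rewrite invgK.
exists o, s; split=> [g|g a]; first by rewrite sP mulKg.
congr (_^-1)%g; apply/repP; rewrite invgK invgM -mulgA mulVg mulg1.
by exists a^-1%g; exact: psiV.
Qed.

(* The crossed homomorphism a |-> s(g) a s(g a)^-1 into the kernel turns every
   homomorphism from the kernel to Q into derivations, one for each orbit of [D] on [Gam]. *)
Lemma derivation_torsion (s : R) (x : D) : N x -> s != 0 ->
  (forall u, derivation psi u -> lin (fun g => u g x : rat^o) s = 0) ->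
  exists r : seq (int * D), (exists g, coset_coef N r g != 0) /\
    commsub N N (gprod [seq gzpow (Defs.conjg x p.2) p.1 | p <- r]).
Proof.
move=> Nx s0 ann; have [o [sec [secP oP]]] := orbit_section.
have psec g : psi (sec g) = ((o g)^-1 * g)%g by rewrite [X in _ = (_ * X)%g]secP mulKg.
pose cr g a := (sec g * a * (sec (g * psi a))^-1)%g.
have crN g a : N (cr g a).
  by rewrite /cr !psiM psiV !psec oP !mulgA mulgV.
have N1 := ker_subgrp; have nN := ker_normal.
have crM g a b : cr g (a * b)%g = (cr g a * cr (g * psi a) b)%g.
  by rewrite /cr psiM !mulgA mulgVK.
have crx g : cr g x = (sec g * x * (sec g)^-1)%g by rewrite /cr Nx mulg1.
have [g0 g0s] : exists g0, s@_g0 != 0.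
  apply: contra_notP (negP s0) => nz; apply/eqP/malgP => g; rewrite mcoeff0.
  by apply: contra_notP nz => /eqP; exists g.
have [d d0 [m mP]] := common_denominator s.
(* Keeping the orbit of g0 alone makes the conjugators sec(g)^-1 lie in distinct cosets of the
   kernel, so the integral coefficient m(g0) is not cancelled. *)
pose gs := [seq g <- finmap.enum_fset (msupp s) | o g == o g0].
pose r0 := [seq (m g, (sec g)^-1%g) | g <- gs].
pose y := gprod [seq gzpow (Defs.conjg x p.2) p.1 | p <- r0].
have ey : y = gprod [seq gz (cr g x) (m g) | g <- gs].
  rewrite /y /r0 -map_comp; congr gprod; apply: eq_map => g /=.
  by rewrite gzpowE conjE crx /monoid.conjg invgK mulgA.
have ychi chi : hom_on N chi -> N y /\ chi y = \sum_(g <- gs) chi (cr g x) *~ m g.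
  move=> hchi; rewrite ey.
  have [|Ny ->] := gprod_hom hchi N1 (s := [seq gz (cr g x) (m g) | g <- gs]).
    by move=> _ /List.in_map_iff[g [<- _]]; exact: (subgrp_gz _ N1).
  split=> //; rewrite big_map; apply: eq_bigr => g _.
  exact: (morph_gz _ N1 hchi).
(* If no power of y lay in [N, N], a homomorphism chi on N with chi(y) = 1 and the derivation it
   yields on this orbit would give 1 = d times the pairing of s with x, which is 0. *)
have [k k0 yk] : exists2 k : nat, (0 < k)%N & commsub N N (y ^+ k)%g.
  apply: contrapT => nk.
  have Ny : N y by case: (ychi (fun=> 0)) => // ? ? _ _; rewrite addr0.
  have [||k k0 yk|chi [hchi _ chiy]] := separating_hom N1 (commsub_subgrp N N) _ _ Ny.
  - apply: (commsub_min N1) => a b Na Nb.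
    by rewrite commgEl; apply: (subgrpM N1); [exact: (subgrpV N1)|exact: nN].
  - by move=> a b Na Nb; exact: commsub_mem.
  - by apply: nk; exists k.
  pose u g a : rat := if o g == o g0 then chi (cr g a) else 0.
  have du : derivation psi u.
    move=> g a b; rewrite /u oP; case: eqP => _; last by rewrite addr0.
    by rewrite crM hchi.
  have := ann u du; have [_ yc] := ychi chi hchi; move: yc; rewrite chiy /gs big_filter.
  move=> yc1 lin0; have : d%:~R * lin (fun g => u g x : rat^o) s = 1.
    rewrite /lin mulr_sumr [RHS]yc1 [RHS]big_mkcond; apply: eq_bigr => g _.
    rewrite /u; case: (o g == o g0); last by rewrite scaler0 mulr0.
    by rewrite rat_scaleE -[_ *~ m g]mulrzr mP; ring.
  by rewrite lin0 mulr0 => /eqP; rewrite eq_sym oner_eq0.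
(* Repeating the list k times replaces y by y^k and the coefficient m(g0) by k m(g0). *)
exists (flatten (nseq k r0)); split; last first.
  suff -> : gprod [seq gzpow (Defs.conjg x p.2) p.1 | p <- flatten (nseq k r0)] = (y ^+ k)%g by [].
  elim: (k) => [|j ih]; first by [].
  by rewrite /= map_cat gprod_cat ih expgS.
exists (sec g0)^-1%g.
have -> : coset_coef N (flatten (nseq k r0)) (sec g0)^-1%g = m g0 *+ k.
  elim: (k) => [|j ih]; first by rewrite /coset_coef big_nil.
  rewrite mulrS -ih /coset_coef /= big_cat; congr (_ + _).
  have ugs : uniq gs by rewrite filter_uniq // finmap.fset_uniq.
  have g0gs : g0 \in gs by rewrite mem_filter eqxx /= -mcoeff_neq0 in g0s *.
  rewrite big_map (bigD1_seq g0) //= !gE invgK; case: pdecP => [_|[]]; last by rewrite psiM psiV mulgV.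
  rewrite big_seq_cond big1 ?addr0 // => g /andP[]; rewrite mem_filter => /andP[/eqP eo _] ne.
  rewrite /= !gE; case: pdecP => // e; case/eqP: ne; rewrite [g]secP [g0]secP eo; congr (_ * _)%g.
  by move: e; rewrite psiM psiV => /mulg1_eq/invg_inj.
rewrite mulrn_eq0 negb_or -lt0n k0 /= -(intr_eq0 rat) mP mulf_neq0 ?intr_eq0 //.
Qed.
End TorsionWitness.

(** The left Ore condition, from the dependence of two vectors with one coordinate, s and -t. *)
Lemma common_left_multiple (G : groupType) k (P : nat -> G -> Prop) (s t : galg G) : tfchain k P ->
  s != 0 -> t != 0 -> exists a b, a * s = b * t /\ a * s != 0.
Proof.
move=> tP s0 t0; have dom := @galg_domain G _ _ (tf_unique_products tP).
pose M (i : bool) (_ : unit) := if i then s else - t.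
have [|//|v [_ [i vi] vM]] := tf_dependent tP (M := M); first by rewrite card_bool card_unit.
have e : v true * s = v false * t.
  have := vM tt; rewrite big_bool /= mulrN => /eqP; rewrite addr_eq0 opprK.
  by move/eqP.
exists (v true), (v false); split=> //.
by case: i vi => vi; [|rewrite e]; apply: dom.
Qed.

(** * Torsion expressed by Fox rows *)

Section SpanTorsion.
Variables (B : group) (Gam : groupType) (pi : B -> Gam) (gens : seq B) (rels : seq word).
Hypothesis piM : forall x y, pi (x * y)%g = (pi x * pi y)%g.
Hypothesis gensP : forall x, exists w, wf_word (size gens) w /\ evalw gens w = x.
Hypothesis relsP : forall r, List.In r rels -> wf_word (size gens) r /\ evalw gens r = gone B.
Hypothesis presP : forall w, wf_word (size gens) w -> evalw gens w = gone B ->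
  releq (size gens) rels w [::].
Local Notation R := (galg Gam).
Local Notation n := (size gens).
Local Notation Z := (fox_of pi gensP).
Local Notation span := (@rel_span B Gam pi gens rels).
Local Notation N := (fun x => pi x = 1%g).
Implicit Types x y g : B.

Let pi1 : pi 1%g = 1%g := psi1 piM.
Let piV x : pi x^-1%g = (pi x)^-1%g := psiV piM x.

Definition span_eq (t t' : 'rV[R]_n) := span (t - t').

Lemma span_eq_refl t : span_eq t t.
Proof. by rewrite /span_eq subrr; exact: rel_span0. Qed.

Lemma span_eq_sym t t' : span_eq t t' -> span_eq t' t.
Proof. by rewrite /span_eq -opprB => /rel_spanN; rewrite opprK. Qed.

Lemma span_eq_trans t t' t'' : span_eq t t' -> span_eq t' t'' -> span_eq t t''.
Proof. by move=> h h'; have := rel_spanD h h'; rewrite addrA subrK. Qed.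

Lemma span_eqD t1 t2 t1' t2' : span_eq t1 t1' -> span_eq t2 t2' -> span_eq (t1 + t2) (t1' + t2').
Proof. by move=> h h'; have := rel_spanD h h'; rewrite /span_eq addrACA -opprD. Qed.

Lemma span_eqZ r t t' : span_eq t t' -> span_eq (r *: t) (r *: t').
Proof. by move/(rel_spanZ r); rewrite scalerBr. Qed.

Lemma span_eqP t t' : span_eq t t' -> span t' -> span t.
Proof. by move=> h h'; have := rel_spanD h h'; rewrite subrK. Qed.

Lemma fox_of_mul x y : span_eq (Z (x * y)%g) (Z x + gbase (pi x) *: Z y).
Proof. by apply: span_eq_sym; exact: fox_defectP. Qed.

Lemma fox_of_kerM x y : pi x = 1%g -> span_eq (Z (x * y)%g) (Z x + Z y).
Proof. by move=> e; have := fox_of_mul x y; rewrite e gbase1 scale1r. Qed.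

(** Compare the two expansions of g x^g = x g. Conjugation on the right becomes left multiplication
    by an inverse, hence the inverses in [torsion_span]. *)
Lemma fox_of_conj x g : pi x = 1%g -> span_eq (Z (x ^ g)%g) (gbase (pi g)^-1%g *: Z x).
Proof.
move=> e; have h1 := fox_of_mul g (x ^ g)%g.
have h2 := fox_of_kerM g e; rewrite conjgC in h2.
have h := span_eq_trans (span_eq_sym h1) h2.
have := rel_spanZ (gbase (pi g)^-1%g) h.
rewrite scalerBr scalerDr scalerDr scalerA -gbaseM mulVg gbase1 scale1r /span_eq.
set a := _ *: Z g; set b := Z _; set d := _ *: Z x.
by congr span; row_abelian.
Qed.

Lemma fox_of_gz x z : pi x = 1%g -> span_eq (Z (gz x z)) (z%:~R *: Z x).
Proof.
move=> Nx; have step (j : int) : span_eq (Z (gz x (j + 1))) (Z (gz x j) + Z x).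
  by rewrite gzS; apply: fox_of_kerM; exact: (subgrp_gz _ (ker_subgrp piM)).
elim/int_rect: z => [|j ih|j ih].
- by rewrite scale0r /span_eq subr0; exact: fox_of1.
- rewrite -[j.+1]addn1 PoszD; apply: span_eq_trans (step _) _.
  by rewrite intrD scalerDl scale1r; apply: span_eqD ih (span_eq_refl _).
- have e : - (j : int) = - (j.+1 : int) + 1 by lia.
  have := span_eq_trans (span_eq_sym (step (- (j.+1 : int)))) _; rewrite -e => /(_ _ ih) h.
  have := span_eqD h (span_eq_refl (- Z x)); rewrite addrK e intrD scalerDl scale1r.
  by rewrite addrK.
Qed.

Lemma fox_of_commsub x : commsub N N x -> span (Z x).
Proof.
have sN := ker_subgrp piM => h.
suff [] : N x /\ span (Z x) by [].
move: x h; apply: (commsub_min (S := fun x => N x /\ span (Z x))) => [|x y Nx Ny].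
  split=> [|x y [Nx sx] [Ny sy]|x [Nx sx]].
  - by split; [|exact: fox_of1].
  - split; first by rewrite piM Nx Ny mulg1.
    by apply: span_eqP (fox_of_kerM _ Nx) _; exact: rel_spanD.
  - split; first by rewrite piV Nx invg1.
    have h := fox_of_kerM x^-1%g Nx; rewrite mulgV in h.
    have h' : span (Z x + Z x^-1%g) by apply: span_eqP (span_eq_sym h) _; exact: fox_of1.
    by have := rel_spanB h' sx; rewrite addrC addrA addNr add0r.
split; first by rewrite commgEl piM piV (ker_normal piM) // Nx invg1 mulg1.
have h1 := fox_of_kerM [~ x, y]%g (etrans (piM y x) (etrans (congr2 _ Ny Nx) (mulg1 _))).
rewrite -commgC in h1.
have h2 := fox_of_kerM y Nx; have h3 := fox_of_kerM x Ny.
have := span_eq_trans (span_eq_sym h2) (span_eq_trans h1 (span_eqD h3 (span_eq_refl _))).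
move/rel_spanN; congr span; set a := Z x; set b := Z y; set d := Z _; row_abelian.
Qed.

Lemma fox_of_gprod s : (forall x, List.In x s -> pi x = 1%g) ->
  span_eq (Z (gprod s)) (\sum_(x <- s) Z x).
Proof.
elim: s => [|x s ih] sN; first by rewrite big_nil /span_eq subr0; exact: fox_of1.
rewrite big_cons; apply: span_eq_trans (fox_of_kerM _ _) _; first by apply: sN; left.
by apply: span_eqD (span_eq_refl _) (ih _) => y ys; apply: sN; right.
Qed.

Lemma torsion_span x (r : seq (int * B)) : pi x = 1%g -> (exists g, coset_coef N r g != 0) ->
  commsub N N (gprod [seq gzpow (Defs.conjg x p.2) p.1 | p <- r]) ->
  exists2 s : R, s != 0 & span (s *: Z x).
Proof.
move=> Nx [g rg] cr; pose s : R := \sum_(p <- r) p.1%:~R * gbase (pi p.2)^-1%g.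
have Nc y : N (x ^ y)%g := ker_normal piM y Nx.
exists s.
  apply: contraNneq rg => s0; have /eqP := congr1 (mcoeff (pi g)^-1%g) s0.
  rewrite mcoeff0 raddf_sum /coset_coef -(intr_eq0 rat) rmorph_sum; move/eqP=> e; apply/eqP.
  rewrite -[RHS]e; apply: eq_bigr => p _ /=.
  have -> : (p.1%:~R : R) = (p.1%:~R : rat) *: 1 by rewrite scaler_int.
  rewrite -scalerAl mul1r mcoeffZ mcoeffU !gE piM piV.
  have -> : pdec ((pi g)^-1 * pi p.2 = 1)%g = ((pi p.2)^-1 == (pi g)^-1)%g.
    by apply/pdecP/eqP => [/mulg1_eq <-|<-]; rewrite ?invgK ?mulVg.
  by case: eqP => _; rewrite ?mulr1 ?mulr0.
apply: span_eqP (fox_of_commsub cr); apply: span_eq_sym; apply: span_eq_trans (fox_of_gprod _) _.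
  move=> _ /List.in_map_iff[p [<- _]]; rewrite gzpowE conjE.
  exact: (subgrp_gz _ (ker_subgrp piM)).
rewrite big_map /s scaler_suml; elim/big_rec2: _ => [|p t t' _ ih]; first exact: span_eq_refl.
apply: span_eqD => //; rewrite gzpowE conjE -scalerA.
by apply: span_eq_trans (fox_of_gz _ (Nc _)) _; apply: span_eqZ; exact: fox_of_conj.
Qed.

(** Derivations kill the relator rows, hence s times the Fox row of x, so [derivation_torsion]
    applies. *)
Lemma span_torsion x (s : R) : pi x = 1%g -> s != 0 -> span (s *: Z x) ->
  exists r : seq (int * B), (exists g, coset_coef N r g != 0) /\
    commsub N N (gprod [seq gzpow (Defs.conjg x p.2) p.1 | p <- r]).
Proof.
move=> Nx s0 [z ez]; apply: (derivation_torsion piM Nx s0) => u du.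
rewrite -(pair_fox_of gensP _ _ piM du) ez.
suff nz : null pi (z *m fox_rels pi gens rels) by exact: nz.
rewrite mulmx_sum_row; apply: big_ind => [||i _]; [exact: null0|exact: nullD|].
apply: nullZ => v dv; rewrite rowK.
have [wr er] : wf_word n (nth [::] rels i) /\ evalw gens (nth [::] rels i) = gone B.
  by apply: relsP; apply: In_mem; exact: mem_nth.
by rewrite (pair_fox piM dv wr) er; exact: derivation1 dv.
Qed.

Variables (k : nat) (P : nat -> Gam -> Prop).
Hypothesis tP : tfchain k P.

Definition span_torsion_sub x := pi x = 1%g /\ exists2 s : R, s != 0 & span (s *: Z x).
Local Notation T := span_torsion_sub.

Let dom (s t : R) : s != 0 -> t != 0 -> s * t != 0.
Proof. exact: galg_domain (tf_unique_products tP). Qed.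

(** Products need a common nonzero multiple of the two annihilators, which the Ore condition
    provides. *)
Lemma span_torsion_subgrp : subgrp T.
Proof.
have sN := ker_subgrp piM; split=> [|x y [Nx [s s0 sx]] [Ny [t t0 ty]]|x [Nx [s s0 sx]]].
- by split=> //; exists 1; rewrite ?oner_eq0 // scale1r; exact: fox_of1.
- split; first exact: (subgrpM sN).
  have [a [b [ab ab0]]] := common_left_multiple tP s0 t0; exists (a * s) => //.
  apply: span_eqP (span_eqZ _ (fox_of_kerM _ Nx)) _; rewrite scalerDr {2}ab -!scalerA.
  by apply: rel_spanD; exact: rel_spanZ.
- split; first exact: (subgrpV sN).
  exists s => //; have h := fox_of_kerM x^-1%g Nx; rewrite mulgV in h.
  have h' : span (Z x + Z x^-1%g) by apply: span_eqP (span_eq_sym h) _; exact: fox_of1.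
  have := rel_spanB (rel_spanZ s h') sx.
  by rewrite scalerDr addrC addrA addNr add0r.
Qed.

Lemma span_torsion_normal : normal_sub T.
Proof.
move=> x g [Nx [s s0 sx]]; split; first exact: (ker_normal piM).
exists (s * gbase (pi g)); first by apply: dom => //; exact: gbase_neq0.
apply: span_eqP (span_eqZ _ (fox_of_conj g Nx)) _.
by rewrite scalerA -mulrA -gbaseM mulgV gbase1 mulr1.
Qed.

Lemma span_torsion_comm : commutators_in N T.
Proof.
move=> x y Nx Ny; split.
  by rewrite commgEl piM piV (ker_normal piM) // Nx invg1 mulg1.
exists 1; rewrite ?oner_eq0 // scale1r; apply: fox_of_commsub; exact: commsub_mem.
Qed.

Lemma span_torsion_isol m x : (0 < m)%N -> pi x = 1%g -> T (x ^+ m)%g -> T x.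
Proof.
move=> m0 Nx [_ [s s0 sx]]; split=> //; exists (s * m%:R).
  apply: dom => //; rewrite -scaler_nat scaler_eq0 oner_eq0 orbF.
  by rewrite pnatr_eq0 -lt0n.
rewrite -scalerA; apply: span_eqP _ sx; apply: span_eqZ; apply: span_eq_sym.
exact: (fox_of_gz m Nx).
Qed.
End SpanTorsion.

(** * Induction along the torsion-free derived series *)

Lemma commsub_mono (A : group) (P Q P' Q' : A -> Prop) x : (forall y, P y -> P' y) ->
  (forall y, Q y -> Q' y) -> commsub P Q x -> commsub P' Q' x.
Proof. by move=> hP hQ [s [sPQ ->]]; exists s; split=> // e /sPQ[/hP ? /hQ ?]. Qed.

Lemma derived_decr (A : group) i j x : (i <= j)%N -> derived A j x -> derived A i x.
Proof.
move=> ij; rewrite -(subnKC ij) addnC; elim: (j - i)%N x => [//|d ih] x.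
rewrite addSn => hx; apply: ih; elim: {d i j ij} (d + i)%N x hx => [//|d ih] x.
by apply: commsub_mono.
Qed.

Lemma gprod_morph (A B : group) (f : A -> B) s : ishom f -> f (gprod s) = gprod [seq f x | x <- s].
Proof. by move=> fM; elim: s => [|x s ih] /=; [exact: hom1|rewrite fM ih]. Qed.

Lemma gzpow_morph (A B : group) (f : A -> B) x z : ishom f -> f (gzpow x z) = gzpow (f x) z.
Proof.
move=> fM; have pow m : f (gpow x m) = gpow (f x) m.
  by elim: m => [|m ih] /=; [exact: hom1|rewrite fM ih].
by case: z => m /=; rewrite ?ginvE ?homV // ?fM pow.
Qed.

(** The equivalence at level k makes A/A^(k)_H -> B/B^(k)_H injective, so a nonzero annihilator
    stays nonzero. *)
Lemma tfderived_push (A B : group) (f : A -> B) k : ishom f ->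
  (forall x, tfderived B k (f x) <-> tfderived A k x) ->
  forall x, tfderived A k.+1 x -> tfderived B k.+1 (f x).
Proof.
move=> fM fk x [Nx [r [[g rg] cr]]]; split; first exact/fk.
exists [seq (p.1, f p.2) | p <- r]; split.
  exists (f g); suff -> : coset_coef (tfderived B k) [seq (p.1, f p.2) | p <- r] (f g) =
    coset_coef (tfderived A k) r g by [].
  rewrite /coset_coef big_map; apply: eq_bigr => p _ /=; congr (if _ then _ else _).
  by rewrite ginvE -homV // -fM; apply/pdecP/pdecP; rewrite fk.
suff -> : gprod [seq gzpow (Defs.conjg (f x) p.2) p.1 | p <- [seq (p.1, f p.2) | p <- r]] =
    f (gprod [seq gzpow (Defs.conjg x p.2) p.1 | p <- r]).
  by apply: commsub_hom cr => // y /fk.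
rewrite gprod_morph // -!map_comp; congr gprod; apply: eq_map => p /=.
by rewrite gzpow_morph // /Defs.conjg !fM ginvE homV.
Qed.

(** What the induction must carry for B/B^(k)_H to be poly-(torsion-free abelian); the definition of
    [tfderived] does not even make its terms visibly subgroups. *)
Record tf_regular (B : group) (k : nat) : Prop := TFregular {
  tfr_grp : forall i, (i <= k)%N -> subgrp (tfderived B i);
  tfr_normal : forall i, (i <= k)%N -> normal_sub (tfderived B i);
  tfr_comm : forall i, (i < k)%N -> commutators_in (tfderived B i) (tfderived B i.+1);
  tfr_isol : forall i, (i < k)%N -> forall m x, (0 < m)%N -> tfderived B i x ->
    tfderived B i.+1 (x ^+ m)%g -> tfderived B i.+1 x }.

Lemma tfderived_decr (B : group) i j x : (i <= j)%N -> tfderived B j x -> tfderived B i x.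
Proof. by move=> ij; rewrite -(subnKC ij) addnC; elim: (j - i)%N => // d ih [/ih]. Qed.

Lemma derived_tfderived (B : group) k x : tf_regular B k -> derived B k x -> tfderived B k x.
Proof.
move=> rB; elim: k rB x => // k ih rB x; apply: commsub_min; first exact: (tfr_grp rB).
have rk : tf_regular B k.
  split=> i ik; have ik' := leqW ik; [exact: (tfr_grp rB)|exact: (tfr_normal rB)|exact: (tfr_comm rB)|].
  exact: (tfr_isol rB).
by move=> y z /(ih rk) Ny /(ih rk); exact: (tfr_comm rB).
Qed.

Lemma tfchain_quotient (B Gam : group) (pi : B -> Gam) k : tf_regular B k -> ishom pi ->
  (forall y, exists x, pi x = y) -> (forall x, pi x = 1%g <-> tfderived B k x) ->
  tfchain k (fun i y => exists2 x, tfderived B i x & pi x = y).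
Proof.
move=> rB piM surj ker; have piV x := homV x piM.
have pi_pow x m : pi (x ^+ m)%g = (pi x ^+ m)%g.
  by elim: m => [|m ih]; [exact: hom1|rewrite !expgS -ih; exact: piM].
split.
- by move=> y; have [x <-] := surj y; exists x.
- by move=> _ [x /ker ex <-].
- move=> i ik; have sN := tfr_grp rB ik; split.
  + by exists 1%g; [exact: (subgrp1 sN)|exact: hom1].
  + by move=> _ _ [x Nx <-] [y Ny <-]; exists (x * y)%g; [exact: (subgrpM sN)|exact: piM].
  + by move=> _ [x Nx <-]; exists x^-1%g; [exact: (subgrpV sN)|exact: piV].
- by move=> i ik _ [x Nx <-]; exists x => //; exact: tfderived_decr Nx.
- move=> i ik _ _ [x Nx <-] [y Ny <-]; exists [~ x, y]%g; first exact: (tfr_comm rB).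
  by rewrite /commg /monoid.conjg -!piV -!homM.
- move=> i ik m _ m0 [x Nx <-] [y Ny e]; exists x => //.
  have sN := tfr_grp rB ik; apply: (tfr_isol rB ik m0 Nx).
  apply: (subgrpMr sN (y := y^-1%g)); first exact: (subgrpV sN).
  apply: (tfderived_decr ik); apply/ker; rewrite homM // piV pi_pow e.
  exact: mulgV.
Qed.

Lemma tfderived_pullback (A B : group) (f : A -> B) m : fin_gen A -> fin_pres B -> ishom f ->
  H1_mono f -> H2_mod_Phi_epi m f -> forall k, (k <= m.+1)%N ->
  tf_regular B k /\ forall x, tfderived B k (f x) <-> tfderived A k x.
Proof.
move=> [gensA gensAP] [gens [rels [gensP [relsP presP]]]] fM mono epi.
elim=> [_|k ih km].
  split; last by [].
  by split=> // i; rewrite ?leqn0 ?ltn0 // => /eqP ->.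
have [rB fk] := ih (ltnW km); have sN := tfr_grp rB (leqnn k).
have [Gam [pi [piM surj ker]]] := quotient_group sN (tfr_normal rB (leqnn k)).
have tP := tfchain_quotient rB piM surj ker.
have kerE : tfderived B k = (fun x => pi x = 1%g).
  by apply/funext => x; apply/propext; split=> /ker.
have kerA : tfderived A k = (fun x => pi (f x) = 1%g).
  by apply/funext => x; apply/propext; split=> [/fk/ker|/ker/fk].
(* This is where k <= m enters: B^(m) lies in B^(k), hence in B^(k)_H. *)
have pi_derived x : derived B m x -> pi x = 1%g.
  by move=> hx; apply/ker; apply: derived_tfderived => //; exact: derived_decr hx.
have TE : tfderived B k.+1 = span_torsion_sub pi rels gensP.
  apply/funext => x; rewrite /= kerE; apply/propext.
  split=> [[Nx [r [rg cr]]]|[Nx [s s0 sx]]]; split=> //.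
    exact: (torsion_span piM gensP relsP presP Nx rg cr).
  exact: (span_torsion piM relsP Nx s0 sx).
split.
  split=> i.
  - rewrite leq_eqVlt => /orP[/eqP ->|ik]; last exact: (tfr_grp rB).
    by rewrite TE; exact: (span_torsion_subgrp piM gensP relsP presP tP).
  - rewrite leq_eqVlt => /orP[/eqP ->|ik]; last exact: (tfr_normal rB).
    by rewrite TE; exact: (span_torsion_normal piM relsP presP tP).
  - rewrite ltnS leq_eqVlt => /orP[/eqP ->|ik]; last exact: (tfr_comm rB).
    by rewrite TE kerE; exact: (span_torsion_comm piM gensP relsP presP).
  - rewrite ltnS leq_eqVlt => /orP[/eqP ->|ik]; last exact: (tfr_isol rB).
    by rewrite TE kerE => j x; exact: (span_torsion_isol piM relsP presP tP).
move=> x; split; last exact: tfderived_push.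
rewrite TE => -[Nx [s s0 sx]].
have [t t0 ann] := torsion_pullback fM mono epi piM pi_derived gensAP relsP presP tP s0 sx.
rewrite /= kerA; split=> //.
exact: (derivation_torsion (psiM fM piM) Nx t0 ann).
Qed.

Theorem theorem5p3
  (H : nat -> forall A B : group, (A -> B) -> Prop)
  (Hclass : forall n : nat, (0 < n)%N -> class_of_maps (H n))
  (Hsub : forall n : nat, (0 < n)%N ->
            forall (A B : group) (f : A -> B), H n A B f -> Hmono n f)
  (A : group) (n : nat) :
  fin_pres A -> (0 < n)%N ->
  (forall a : A, derived A n a -> GammaS H n a) /\
  (forall a : A, GammaS H n a -> tfderived A n a /\ rlcs A (2 ^ n) a).
Proof.
move=> fpA n0; split=> [a dera|a [B [f [Hf derfa]]]].
  have [iso _] := Hclass n n0; exists A, id; split=> //.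
  by apply: iso => //; split=> //; exists id.
have [fgA [fpB [fM [mono epi]]]] := Hsub n n0 A B f Hf.
split; last exact: derived_rlcs derfa.
have [|rB pull] := tfderived_pullback fgA fpB fM mono epi (k := n); first by rewrite prednK.
by apply/pull/derived_tfderived.
Qed.
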